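(* Let $(M,\mathcal E,\mathfrak m)$ be a quasi-regular, strongly local Dirichlet space admitting a carré du champ $\Gamma$. Then $L^2(T^*M)$ and $L^2(TM)$ are $L^2$-normed $L^\infty$-modules (over $M$ with respect to $\mathfrak m$) with pointwise norms both denoted by $|\cdot|$. They come with a linear differential $d:\mathcal F_e\to L^2(T^*M)$ and a linear gradient $\nabla:\mathcal F_e\to L^2(TM)$ such that for every $f\in\mathcal F_e$, $$|df|=|\nabla f|=\Gamma(f)^{1/2}\quad\mathfrak m\text{-a.e.}$$
   Context: Dirichlet space. $M$ is a topological Lusin space (a continuous injective image of a Polish space) with a $\sigma$-finite Borel measure $\mathfrak m$ of full topological support; $L^p(M):=L^p(M,\mathfrak m)$. $(\mathcal E,\mathcal F)$ is a symmetric, quasi-regular, strongly local Dirichlet form on $L^2(M)$ with dense domain $\mathcal F$; $\mathcal E(f):=\mathcal E(f,f)$. The extended domain $\mathcal F_e$ is the set of ($\mathfrak m$-a.e. classes of) measurable $f:M\to\mathbb R$ that are $\mathfrak m$-a.e. limits of sequences $(f_n)$ in $\mathcal F$ with $\mathcal E(f_n-f_m)\to 0$; $\mathcal E(f):=\lim_n\mathcal E(f_n)$. Every $f\in\mathcal F_e$ has an $\mathcal E$-quasi-continuous $\mathfrak m$-version $\tilde f$. The energy measure is the symmetric bilinear map $\mu$ on $\mathcal F_e\times\mathcal F_e$ with values in finite signed Borel (Radon) measures not charging $\mathcal E$-polar sets determined by $2\int_M\tilde h\,d\mu_{f,g}=\mathcal E(fh,g)+\mathcal E(gh,f)-\mathcal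 E(fg,h)$ for $f,g,h\in\mathcal F\cap L^\infty(M)$ and extended to $\mathcal F_e$ by approximation; $\mu_f:=\mu_{f,f}\ge 0$. $\mathcal E$ admits a carré du champ if $\mu_f\ll\mathfrak m$ for all $f\in\mathcal F$; then $\Gamma(f,g):=d\mu_{f,g}/d\mathfrak m\in L^1(M)$ for $f,g\in\mathcal F_e$ and $\Gamma(f):=\Gamma(f,f)$. Modules. An $L^p$-normed $L^\infty$-module is a real Banach space $\mathcal M$ with a bilinear multiplication $L^\infty(M)\times\mathcal M\to\mathcal M$ satisfying $(fg)v=f(gv)$, $1_Mv=v$, and a nonnegatively valued map $|\cdot|:\mathcal M\to L^p(M)$ (pointwise norm) with $|fv|=|f||v|$ $\mathfrak m$-a.e. and $\|v\|_{\mathcal M}=\||v|\|_{L^p(M)}$. The dual module $\mathcal M^*$ is the space of bounded linear maps $L:\mathcal M\to L^1(M)$ with $L(fv)=fL(v)$ for $f\in L^\infty(M)$, with pointwise norm $|L|:=\operatorname{esssup}\{|L(v)|: v\in\mathcal M,\ |v|\le 1\ \mathfrak m\text{-a.e.}\}$. Cotangent and tangent module. $\mathrm{Pcm}$ is the set of sequences $(f_i,A_i)_{i\in\mathbb N}$ with $(A_i)$ a Borel partition of $M$, $f_i\in\mathcal F_e$ and $\sum_i\mu_{f_i}[A_i]<\infty$; two elements $(f_i,A_i)$, $(g_j,B_j)$ are equivalent if $\mu_{f_i-g_j}[A_i\cap B_j]=0$ for all $i,j$; $[f_i,A_i]$ denotes the class. The quotient is a vector space via $[f_i,A_i]+[g_j,B_j]:=[f_i+g_j,A_i\cap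 B_j]$, $\lambda[f_i,A_i]:=[\lambda f_i,A_i]$, carries a multiplication by simple functions $h=\sum_j 1_{B_j}h_j$ ($B_j$ a finite Borel partition) via $h[f_i,A_i]:=[h_jf_i,A_i\cap B_j]$, which extends by continuity to bounded functions, and the norm $\|[f_i,A_i]\|^2:=\sum_i\mu_{f_i}[A_i]$. $L^2(T^*M)$ is its completion, with pointwise norm extending $|[f_i,A_i]|=\sum_i1_{A_i}\Gamma(f_i)^{1/2}$. The differential is $df:=[f,M]$ (the class of the sequence $(f,M),(0,\emptyset),(0,\emptyset),\dots$). $L^2(TM):=L^2(T^*M)^*$; $\sharp:L^2(T^*M)\to L^2(TM)$ is the Riesz isomorphism, $\langle\omega^\sharp,X\rangle=\omega(X)$ $\mathfrak m$-a.e., where $\langle\cdot,\cdot\rangle$ is the polarization of the squared pointwise norm; and $\nabla f:=(df)^\sharp$. *)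

(* Defs.v *)
From HB Require Import structures.
From mathcomp Require Import all_boot all_order all_algebra.
From mathcomp Require Import all_classical all_reals all_analysis.
From mathcomp Require Import measurable_realfun.

Set Implicit Arguments.
Unset Strict Implicit.
Unset Printing Implicit Defensive.

Import Order.TTheory GRing.Theory Num.Theory.
Import numFieldNormedType.Exports.

Local Open Scope classical_set_scope.
Local Open Scope ring_scope.

Lemma filterS4 (T : Type) (F : set_system T) {FF : Filter F} :
  forall {P Q R S U : set T}, (forall x, P x -> Q x -> R x -> S x -> U x) ->
  F P -> F Q -> F R -> F S -> F U.
Proof.
by move=> P Q R S U PU FP FQ FR; apply: filter_app; move: FP FQ FR; exact: filterS3.
Qed.

Lemma filterS5 (T : Type) (F : set_system T) {FF : Filter F} :
  forall {P Q R S U V : set T}, (forall x, P x -> Q x -> R x -> S x -> U x -> V x) ->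
  F P -> F Q -> F R -> F S -> F U -> F V.
Proof.
by move=> P Q R S U V PV FP FQ FR FS; apply: filter_app; move: FP FQ FR FS; exact: filterS4.
Qed.

(* The algebra L^0 of m-a.e. classes of measurable real-valued functions. All
   function spaces below are subsets of it, so that equality of their elements
   is Leibniz equality. *)
Section L0.
Context d (X : measurableType d) (R : realType) (m : {measure set X -> \bar R}).

Definition L0 : Type := {mfun_ m, X >-> R}.
HB.instance Definition _ := Choice.on L0.

Definition L0_fun (f : L0) : X -> R := aqEqMfun_to_fun f.
Coercion L0_fun : L0 >-> Funclass.

(* junk value for non-measurable functions: the class of 0 *)
Definition L0_class (f : X -> R) : L0 :=
  match pselect (measurable_fun setT f) with
  | left mf => \pi_({mfun_ m, X >-> R})%qT (mfun_Sub (mem_set mf))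
  | right _ => \pi_({mfun_ m, X >-> R})%qT (cst 0 : {mfun X >-> R})
  end.

Lemma measurable_L0 (f : L0) : measurable_fun setT f.
Proof. exact: measurable_funPT. Qed.

Lemma L0_eqP (f g : L0) : f = g <-> {ae m, forall x, f x = g x}.
Proof.
split=> [->|fg]; first exact: aeW.
have : repr (f : {mfun_ m, X >-> R}) = repr (g : {mfun_ m, X >-> R})
    %[mod {mfun_ m, X >-> R}]%qT.
  by apply/eqmodP/asboolP; move: fg; apply: filterS => x fg _.
by rewrite !reprK.
Qed.

Lemma L0_classE (f : X -> R) : measurable_fun setT f ->
  {ae m, forall x, L0_class f x = f x}.
Proof.
move=> mf; rewrite /L0_class; case: pselect => // mf'.
set F := mfun_Sub _.
have : repr (\pi_({mfun_ m, X >-> R})%qT F) = F %[mod {mfun_ m, X >-> R}]%qT.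
  by rewrite reprK.
by move=> /eqmodP/asboolP; apply: filterS => x; exact.
Qed.

Definition L0_zero := L0_class (cst 0).
Definition L0_one := L0_class (cst 1).
Definition L0_opp (f : L0) := L0_class (\- f).
Definition L0_add (f g : L0) := L0_class (f \+ g).
Definition L0_mul (f g : L0) := L0_class (f \* g).
Definition L0_scale (a : R) (f : L0) := L0_class (a \*: (f : X -> R^o)).

Lemma L0_zeroE : {ae m, forall x, L0_zero x = 0}.
Proof. exact/L0_classE/measurable_cst. Qed.
Lemma L0_oneE : {ae m, forall x, L0_one x = 1}.
Proof. exact/L0_classE/measurable_cst. Qed.
Lemma L0_oppE f : {ae m, forall x, L0_opp f x = - f x}.
Proof. by apply: L0_classE; apply: measurableT_comp => //; exact: measurable_L0. Qed.
Lemma L0_addE f g : {ae m, forall x, L0_add f g x = f x + g x}.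
Proof. by apply: L0_classE; apply: measurable_funD; exact: measurable_L0. Qed.
Lemma L0_mulE f g : {ae m, forall x, L0_mul f g x = f x * g x}.
Proof. by apply: L0_classE; apply: measurable_funM; exact: measurable_L0. Qed.
Lemma L0_scaleE a f : {ae m, forall x, L0_scale a f x = a * f x}.
Proof. by apply: L0_classE; apply: measurable_funM; [exact: measurable_cst|exact: measurable_L0]. Qed.

Lemma L0_addA : associative L0_add.
Proof.
move=> f g h; apply/L0_eqP.
apply: (filterS4 _ (L0_addE f (L0_add g h)) (L0_addE g h)
  (L0_addE (L0_add f g) h) (L0_addE f g)).
by move=> x -> -> -> ->; rewrite addrA.
Qed.

Lemma L0_addC : commutative L0_add.
Proof. by move=> f g; congr L0_class; apply/funext => x /=; rewrite addrC. Qed.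

Lemma L0_add0 : left_id L0_zero L0_add.
Proof.
move=> f; apply/L0_eqP; apply: (filterS2 _ _ (L0_addE L0_zero f) L0_zeroE).
by move=> x -> ->; rewrite add0r.
Qed.

Lemma L0_addN : left_inverse L0_zero L0_opp L0_add.
Proof.
move=> f; apply/L0_eqP.
apply: (filterS3 _ _ (L0_addE (L0_opp f) f) (L0_oppE f) L0_zeroE).
by move=> x -> -> ->; rewrite addNr.
Qed.

HB.instance Definition _ :=
  GRing.isZmodule.Build L0 L0_addA L0_addC L0_add0 L0_addN.

Lemma L0_mulA : associative L0_mul.
Proof.
move=> f g h; apply/L0_eqP.
apply: (filterS4 _ (L0_mulE f (L0_mul g h)) (L0_mulE g h)
  (L0_mulE (L0_mul f g) h) (L0_mulE f g)).
by move=> x -> -> -> ->; rewrite mulrA.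
Qed.

Lemma L0_mulC : commutative L0_mul.
Proof. by move=> f g; congr L0_class; apply/funext => x /=; rewrite mulrC. Qed.

Lemma L0_mul1 : left_id L0_one L0_mul.
Proof.
move=> f; apply/L0_eqP; apply: (filterS2 _ _ (L0_mulE L0_one f) L0_oneE).
by move=> x -> ->; rewrite mul1r.
Qed.

Lemma L0_mulD : left_distributive L0_mul L0_add.
Proof.
move=> f g h; apply/L0_eqP.
apply: (filterS5 _ (L0_mulE (L0_add f g) h) (L0_addE f g)
  (L0_addE (L0_mul f h) (L0_mul g h)) (L0_mulE f h) (L0_mulE g h)).
by move=> x -> -> -> -> ->; rewrite mulrDl.
Qed.

HB.instance Definition _ :=
  GRing.Zmodule_isComPzRing.Build L0 L0_mulA L0_mulC L0_mul1 L0_mulD.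

Lemma L0_scaleA a b f : L0_scale a (L0_scale b f) = L0_scale (a * b) f.
Proof.
apply/L0_eqP; apply: (filterS3 _ _ (L0_scaleE a (L0_scale b f)) (L0_scaleE b f)
  (L0_scaleE (a * b) f)).
by move=> x -> -> ->; rewrite mulrA.
Qed.

Lemma L0_scale1 : left_id 1 L0_scale.
Proof.
by move=> f; apply/L0_eqP; apply: filterS (L0_scaleE 1 f) => x ->; rewrite mul1r.
Qed.

Lemma L0_scaleDr : right_distributive L0_scale +%R.
Proof.
move=> a f g; apply/L0_eqP.
apply: (filterS5 _ (L0_scaleE a (f + g)) (L0_addE f g)
  (L0_addE (L0_scale a f) (L0_scale a g)) (L0_scaleE a f) (L0_scaleE a g)).
by move=> x -> -> -> -> ->; rewrite mulrDr.
Qed.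

Lemma L0_scaleDl f : {morph L0_scale^~ f : a b / a + b}.
Proof.
move=> a b; apply/L0_eqP.
apply: (filterS4 _ (L0_scaleE (a + b) f)
  (L0_addE (L0_scale a f) (L0_scale b f)) (L0_scaleE a f) (L0_scaleE b f)).
by move=> x -> -> -> ->; rewrite mulrDl.
Qed.

HB.instance Definition _ := GRing.Zmodule_isLmodule.Build R L0
  L0_scaleA L0_scale1 L0_scaleDr L0_scaleDl.

End L0.

Section Lp.
Context d (X : measurableType d) (R : realType) (m : {measure set X -> \bar R}).

Definition Lp (p : \bar R) : set (L0 m) := [set f | finite_norm m p f].

Definition Lp_norm (p : \bar R) (f : L0 m) : R := fine ('N[m]_p [EFin \o f])%E.

Lemma Lp1_lin (a : R) (f g : L0 m) : Lp 1%E f -> Lp 1%E g ->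
  Lp 1%E (a *: f + g) /\
  Lp_norm 1%E (a *: f + g) <= `|a| * Lp_norm 1%E f + Lp_norm 1%E g.
Proof.
rewrite /Lp /Lp_norm /finite_norm /= !Lnorm1.
set I := fun h : X -> R => (\int[m]_x `|(h x)%:E|)%E.
change ((I f < +oo)%E -> (I g < +oo)%E -> (I (a *: f + g : L0 m)%R < +oo)%E /\
  fine (I (a *: f + g : L0 m)%R) <= `|a| * fine (I f) + fine (I g)).
move=> f1 g1.
have mE (h : X -> R) : measurable_fun setT h ->
    measurable_fun setT (fun x => `|(h x)%:E|%E).
  by move=> mh; apply: measurableT_comp => //; exact/measurable_EFinP.
pose k : X -> R := fun x => a * f x + g x.
have maf : measurable_fun setT (fun x => a * f x).
  by apply: measurable_funM => //; exact: measurable_L0.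
have mafg : measurable_fun setT k.
  by apply: measurable_funD => //; exact: measurable_L0.
have -> : I (a *: f + g : L0 m)%R = I k.
  apply: ae_eq_integral => //; [exact/mE/measurable_L0|exact: mE|].
  apply: (filterS2 _ _ (L0_addE (a *: f) g) (L0_scaleE a f)).
  by move=> x e1 e2 _; rewrite /= /k -e2 -e1.
have le : (I k <= `|a|%:E * I f + I g)%E.
  rewrite /I -ge0_integralZl//; last exact/mE/measurable_L0.
  rewrite -ge0_integralD//; last 2 first.
  - by apply: emeasurable_funM; [exact: measurable_cst|exact/mE/measurable_L0].
  - exact/mE/measurable_L0.
  apply: ge0_le_integral => //.
  - exact: mE.
  - apply: emeasurable_funD; last exact/mE/measurable_L0.
    by apply: emeasurable_funM; [exact: measurable_cst|exact/mE/measurable_L0].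
  - by move=> x _ /=; rewrite -EFinM -EFinD lee_fin -normrM ler_normD.
have fin h : (I h < +oo)%E -> I h \is a fin_num.
  by move=> h1; rewrite ge0_fin_numE// integral_ge0.
have fr : (`|a|%:E * I f + I g)%E \is a fin_num.
  by rewrite fin_numD fin_numM// ?fin.
have fl : (I k < +oo)%E.
  by apply: (le_lt_trans le); rewrite ltey_eq fr.
split => //.
have -> : `|a| * fine (I f) + fine (I g) = fine (`|a|%:E * I f + I g)%E.
  by move: (fin f f1) (fin g g1); generalize (I f) (I g) => u w fu fw;
    rewrite fineD ?fineM ?fin_numM.
by apply: fine_le => //; exact: fin.
Qed.

Lemma L0_zeroN1 : Lp 1%E (0 : L0 m) /\ Lp_norm 1%E (0 : L0 m) = 0.
Proof.
rewrite /Lp /Lp_norm /finite_norm /= Lnorm1.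
suff -> : (\int[m]_x `|(EFin \o (0%R : L0 m)) x| = 0)%E by [].
rewrite -[RHS](integral0 m setT); apply: ae_eq_integral => //.
  by apply: measurableT_comp => //; apply/measurable_EFinP; exact: measurable_L0.
by apply: filterS (L0_zeroE m) => x e _ /=; rewrite e normr0.
Qed.

(* Least upper bound of a family of classes for the m-a.e. order; all essential
   suprema met here are finite m-a.e., whence real-valued upper bounds. *)
Definition is_esssup (S : set (L0 m)) (g : L0 m) : Prop :=
  (forall f, S f -> {ae m, forall x, f x <= g x}) /\
  (forall g' : L0 m, (forall f, S f -> {ae m, forall x, f x <= g' x}) ->
     {ae m, forall x, g x <= g' x}).

Definition esssup (S : set (L0 m)) : L0 m := xget 0 (is_esssup S).

End Lp.

Section Modules.
Context d (X : measurableType d) (R : realType) (m : {measure set X -> \bar R}).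
Local Notation Loo := (@Lp _ _ _ m +oo%E).

Definition is_Banach (V : lmodType R) (nrm : V -> R) : Prop :=
  exists (B : completeNormedModType R) (phi : {linear V -> B}),
    bijective phi /\ forall v, nrm v = `|phi v|.

(* act f v is only meaningful for f in L^oo(m) *)
Record Lp_normed_module (p : \bar R) (V : lmodType R) (nrm : V -> R)
    (act : L0 m -> V -> V) (pn : V -> L0 m) : Prop := {
  lpm_Banach : is_Banach nrm ;
  lpm_linearl : forall a f g v, Loo f -> Loo g ->
    act (a *: f + g) v = a *: act f v + act g v ;
  lpm_linearr : forall a f v w, Loo f ->
    act f (a *: v + w) = a *: act f v + act f w ;
  lpm_mulA : forall f g v, Loo f -> Loo g -> act (f * g) v = act f (act g v) ;
  lpm_mul1 : forall v, act 1 v = v ;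
  lpm_pn_Lp : forall v, Lp p (pn v) ;
  lpm_pn_ge0 : forall v, {ae m, forall x, 0 <= pn v x} ;
  lpm_pnM : forall f v, Loo f ->
    {ae m, forall x, pn (act f v) x = `|f x| * pn v x} ;
  lpm_norm : forall v, nrm v = Lp_norm p (pn v)
}.

Section Dual.
Variables (V : normedModType R) (act : L0 m -> V -> V) (pn : V -> L0 m).

Record is_dual_elt (L : V -> L0 m) : Prop := {
  dual_linear : forall a v w, L (a *: v + w) = a *: L v + L w ;
  dual_L1 : forall v, Lp 1%E (L v) ;
  dual_bounded : exists C : R, forall v, Lp_norm 1%E (L v) <= C * `|v| ;
  dual_Loo_linear : forall f v, Loo f -> L (act f v) = f * L v
}.

Definition dual_pred : {pred V -> L0 m} := [pred L | `[< is_dual_elt L >]].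

Lemma dual_submod_closed : submod_closed dual_pred.
Proof.
split.
  apply/asboolP; split.
  - move=> a v w; change (0 = a *: 0 + 0 :> L0 m).
    by rewrite scaler0 addr0.
  - by move=> v; case: (L0_zeroN1 m).
  - by exists 0 => v; rewrite mul0r; case: (L0_zeroN1 m) => _ ->.
  - by move=> f v _; change (0 = f * 0 :> L0 m); rewrite mulr0.
move=> a L1 L2 /asboolP[lin1 int1 [C1 b1] loo1] /asboolP[lin2 int2 [C2 b2] loo2].
have E v : (a *: L1 + L2) v = a *: L1 v + L2 v by [].
apply/asboolP; split.
- move=> b v w; rewrite !E lin1 lin2 !scalerDr !scalerA mulrC.
  by rewrite !addrA; congr (_ + _); rewrite addrAC.
- by move=> v; rewrite E; have [] := Lp1_lin a (int1 v) (int2 v).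
- exists (`|a| * C1 + C2) => v; rewrite E.
  have [_ /le_trans] := Lp1_lin a (int1 v) (int2 v).
  by apply; rewrite mulrDl lerD// -mulrA; exact: ler_wpM2l.
- move=> f v foo; rewrite !E loo1// loo2// mulrDr; congr (_ + _).
  apply/L0_eqP.
  apply: (filterS4 _ (L0_scaleE a (f * L1 v)) (L0_mulE f (L1 v))
    (L0_mulE f (a *: L1 v)) (L0_scaleE a (L1 v))).
  by move=> x e1 e2 e3 e4; rewrite e1 e2 e3 e4 mulrCA.
Qed.

HB.instance Definition _ := GRing.isSubmodClosed.Build R (V -> L0 m)
  dual_pred dual_submod_closed.

Record dual : Type := Dual { dual_fun :> V -> L0 m; _ : dual_fun \in dual_pred }.
HB.instance Definition _ := [isSub for dual_fun].
HB.instance Definition _ := [Choice of dual by <:].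
HB.instance Definition _ := [SubChoice_isSubLmodule of dual by <:].

(* junk value 0 if f is not in L^oo(m) *)
Definition dual_act (f : L0 m) (L : dual) : dual :=
  insubd (0 : dual) (fun v => f * L v).

(* operator norm of maps from V to L^1(m) *)
Definition dual_norm (L : dual) : R :=
  sup [set Lp_norm 1%E (L v) | v in [set v | `|v| <= 1]].

Definition dual_pn (L : dual) : L0 m :=
  esssup [set g | exists2 v, {ae m, forall x, pn v x <= 1} &
                  g = L0_class m (fun x => `|L v x|)].

End Dual.

Section Riesz.
Variables (V : normedModType R) (act : L0 m -> V -> V) (pn : V -> L0 m).
Local Notation dual := (dual act).

Definition pinner (W : lmodType R) (q : W -> L0 m) (v w : W) : L0 m :=
  4^-1 *: (q (v + w) ^+ 2 - q (v - w) ^+ 2).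

Definition is_Riesz_isomorphism (sharp : V -> dual) : Prop :=
  [/\ (forall a v w, sharp (a *: v + w) = a *: sharp v + sharp w),
      bijective sharp &
      forall (v : V) (L : dual), pinner (@dual_pn _ act pn) (sharp v) L = L v].

End Riesz.
End Modules.

Section Dirichlet.
Context (R : realType) (M : ptopologicalType).
Local Notation X := (g_sigma_algebraType (@open M)).
Variable m : {sigma_finite_measure set X -> \bar R}.
Local Notation L0 := (L0 m).
Local Notation L2 := (@Lp _ _ _ m 2%:E).
Local Notation Loo := (@Lp _ _ _ m +oo%E).

Definition Lusin : Prop :=
  exists (P : completePseudoMetricType R) (phi : P -> M),
    [/\ hausdorff_space P, @second_countable P,
        continuous phi, injective phi & phi @` setT = setT].

Definition full_support : Prop :=
  forall U : set M, open U -> U !=set0 -> (0 < m U)%E.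

Variables (F : set L0) (E : L0 -> L0 -> R).

Definition E1 (f : L0) : R := E f f + Lp_norm 2%:E f ^+ 2.

(* E is only meaningful on F *)
Record Dirichlet_form : Prop := {
  dom_L2 : F `<=` L2 ;
  dom0 : F 0 ;
  dom_lin : forall a f g, F f -> F g -> F (a *: f + g) ;
  dom_dense : forall f, L2 f -> forall e : R, 0 < e ->
    exists2 g, F g & Lp_norm 2%:E (f - g) < e ;
  form_linear : forall a f g h, F f -> F g -> F h ->
    E (a *: f + g) h = a * E f h + E g h ;
  form_sym : forall f g, F f -> F g -> E f g = E g f ;
  form_ge0 : forall f, F f -> 0 <= E f f ;
  form_closed : forall u : nat -> L0, (forall n, F (u n)) ->
    (forall e : R, 0 < e ->
       exists N, forall n k, (N <= n)%N -> (N <= k)%N -> E1 (u n - u k) < e) ->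
    exists2 f, F f & (fun n => E1 (u n - f)) @ \oo --> (0 : R) ;
  form_Markov : forall f, F f ->
    let g := L0_class m (fun x => Num.min (Num.max (f x) 0) 1) in
    F g /\ E g g <= E f f
}.

(* Locality up to additive constants, without reference to compact supports: on a
   space that is not locally compact, functions of compact support may vanish. *)
Definition strongly_local : Prop :=
  forall f g (a : R), F f -> F g ->
    {ae m, forall x, (f x - a) * g x = 0} -> E f g = 0.

Definition nest (K : nat -> set M) : Prop :=
  [/\ forall k, closed (K k), forall k, K k `<=` K k.+1 &
      forall f, F f -> forall e : R, 0 < e ->
        exists g k, [/\ F g, {ae m, forall x, ~ K k x -> g x = 0} &
                        E1 (f - g) < e]].

Definition polar (N : set M) : Prop :=
  exists2 K, nest K & N `<=` ~` (\bigcup_k K k).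

Definition quasi_continuous (f : M -> R) : Prop :=
  exists2 K, nest K & forall k, {within K k, continuous f}.

Definition quasi_version (f : L0) (ft : M -> R) : Prop :=
  quasi_continuous ft /\ {ae m, forall x, ft x = f x}.

Record quasi_regular : Prop := {
  qr_compact : exists2 K, nest K & forall k, compact (K k) ;
  qr_dense : forall f, F f -> forall e : R, 0 < e ->
    exists g, [/\ F g, exists gt, quasi_version g gt & E1 (f - g) < e] ;
  qr_separate : exists (N : set M) (u : nat -> L0) (ut : nat -> M -> R),
    [/\ polar N, forall n, F (u n) /\ quasi_version (u n) (ut n) &
        forall x y, ~ N x -> ~ N y -> x <> y -> exists n, ut n x <> ut n y]
}.

Definition approximates (u : nat -> L0) (f : L0) : Prop :=
  [/\ forall n, F (u n),
      forall e : R, 0 < e ->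
        exists N, forall n k, (N <= n)%N -> (N <= k)%N ->
          E (u n - u k) (u n - u k) < e &
      {ae m, forall x, (fun n => u n x) @ \oo --> f x}].

Definition Fe : set L0 := [set f | exists u, approximates u f].

(* The integral against a finite signed measure, through its Jordan decomposition;
   it does not depend on the Hahn decomposition nuPN. *)
Definition charge_integral (nu : {charge set X -> \bar R}) (P N : set X)
    (nuPN : hahn_decomposition nu P N) (h : X -> R) : \bar R :=
  (\int[jordan_pos nuPN]_x (h x)%:E - \int[jordan_neg nuPN]_x (h x)%:E)%E.

Variable mu : L0 -> L0 -> {charge set X -> \bar R}.

(* mu f g is meaningful for f and g in Fe. em_formula determines it on bounded
   elements of F (the measures do not charge polar sets, so that the values of ht
   off the nest are irrelevant) and em_approx, which in particular covers
   truncations, extends it to F and to Fe. *)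
Record energy_measure : Prop := {
  em_linear : forall a f g h (A : set X), Fe f -> Fe g -> Fe h -> measurable A ->
    mu (a *: f + g) h A = (a%:E * mu f h A + mu g h A)%E ;
  em_sym : forall f g (A : set X), Fe f -> Fe g -> measurable A ->
    mu f g A = mu g f A ;
  em_ge0 : forall f (A : set X), Fe f -> measurable A -> (0 <= mu f f A)%E ;
  em_polar : forall f g (A : set X), Fe f -> Fe g -> measurable A -> polar A ->
    mu f g A = 0%E ;
  em_formula : forall f g h (ht : X -> R),
    F f -> Loo f -> F g -> Loo g -> F h -> Loo h ->
    measurable_fun setT ht -> quasi_version h ht ->
    forall P N (nuPN : hahn_decomposition (mu f g) P N),
      (2%:E * charge_integral nuPN ht)%E =
      (E (f * h) g + E (g * h) f - E (f * g) h)%:E ;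
  em_approx : forall f g u v (A : set X),
    approximates u f -> approximates v g -> measurable A ->
    (fun n => mu (u n) (v n) A) @ \oo --> mu f g A
}.

Definition carre_du_champ : Prop := forall f, F f -> mu f f `<< m.

Definition Gamma (f g : L0) : L0 := L0_class m (fine \o Radon_Nikodym (mu f g) m).

Definition Borel_partition (A : nat -> set X) : Prop :=
  [/\ forall i, measurable (A i), trivIset setT A & \bigcup_i A i = setT].

Definition piece : Type := (nat -> L0) * (nat -> set X).

Definition pcm_norm2 (x : piece) : \bar R :=
  (\sum_(0 <= i <oo) mu (x.1 i) (x.1 i) (x.2 i))%E.

Definition Pcm : set piece :=
  [set x | [/\ Borel_partition x.2, forall i, Fe (x.1 i) & (pcm_norm2 x < +oo)%E]].

Definition pcm_equiv (x y : piece) : Prop :=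
  forall i j, mu (x.1 i - y.1 j) (x.1 i - y.1 j) (x.2 i `&` y.2 j) = 0%E.

(* Families indexed by pairs are renumbered along the injection pickle from
   nat * nat to nat; the indices not reached carry (0, set0). *)
Definition pcm_pairs (f : nat -> nat -> L0) (A : nat -> nat -> set X) : piece :=
  (fun n => if pickle_inv n is Some (i, j) then f i j else 0,
   fun n => if pickle_inv n is Some (i, j) then A i j else set0).

Definition pcm_add (x y : piece) : piece :=
  pcm_pairs (fun i j => x.1 i + y.1 j) (fun i j => x.2 i `&` y.2 j).

Definition pcm_scale (a : R) (x : piece) : piece := (fun i => a *: x.1 i, x.2).

(* A simple function is given by a Borel partition with finitely many nonempty
   pieces and its values on them. *)
Definition simple_partition (B : nat -> set X) (n : nat) : Prop :=
  Borel_partition B /\ forall j, (n <= j)%N -> B j = set0.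

Definition simple_class (B : nat -> set X) (c : nat -> R) (n : nat) : L0 :=
  L0_class m (fun x => \sum_(j < n) \1_(B j) x * c j).

Definition pcm_mul (B : nat -> set X) (c : nat -> R) (x : piece) : piece :=
  pcm_pairs (fun i j => c j *: x.1 i) (fun i j => x.2 i `&` B j).

Definition pcm_pn (x : piece) : L0 :=
  L0_class m (fun y => fine
    (\sum_(0 <= i <oo) (\1_(x.2 i) y * Num.sqrt (Gamma (x.1 i) (x.1 i) y))%:E)%E).

Definition pcm_single (f : L0) : piece :=
  (fun i => if i == 0%N then f else 0, fun i => if i == 0%N then setT else set0).

(* T is the completion of Pcm modulo pcm_equiv, iota the canonical map from Pcm
   (arbitrary off Pcm), act the extension by continuity of the multiplication by
   simple functions to L^oo(m) (arbitrary off L^oo(m)) and pn the continuous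
   extension of the pointwise norm. *)
Record cotangent_module (T : completeNormedModType R) (iota : piece -> T)
    (act : L0 -> T -> T) (pn : T -> L0) : Prop := {
  iota_equiv : forall x y, Pcm x -> Pcm y -> (iota x = iota y <-> pcm_equiv x y) ;
  iota_add : forall x y, Pcm x -> Pcm y -> iota (pcm_add x y) = iota x + iota y ;
  iota_scale : forall a x, Pcm x -> iota (pcm_scale a x) = a *: iota x ;
  iota_norm : forall x, Pcm x -> `|iota x| ^+ 2 = fine (pcm_norm2 x) ;
  iota_dense : dense (iota @` Pcm) ;
  act_linearl : forall a f g v, Loo f -> Loo g ->
    act (a *: f + g) v = a *: act f v + act g v ;
  act_linearr : forall a f v w, Loo f ->
    act f (a *: v + w) = a *: act f v + act f w ;
  act_bounded : forall f v, Loo f -> `|act f v| <= Lp_norm +oo%E f * `|v| ;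
  act_simple : forall B c n x, simple_partition B n -> Pcm x ->
    act (simple_class B c n) (iota x) = iota (pcm_mul B c x) ;
  pn_L2 : forall v, L2 (pn v) ;
  pn_continuous : forall (v : T) (e : R), 0 < e ->
    \forall w \near v, Lp_norm 2%:E (pn w - pn v) < e ;
  pn_iota : forall x, Pcm x -> pn (iota x) = pcm_pn x
}.

Definition differential (T : Type) (iota : piece -> T) (f : L0) : T :=
  iota (pcm_single f).

Definition gradient (T W : Type) (iota : piece -> T) (sharp : T -> W) (f : L0) : W :=
  sharp (differential iota f).

Definition linear_on (D : set L0) (V : lmodType R) (T : L0 -> V) : Prop :=
  forall a f g, D f -> D g -> D (a *: f + g) /\ T (a *: f + g) = a *: T f + T g.

End Dirichlet.

(* Main.v *)
(* Everything is expressed through the maps v |-> 1_A v, A Borel, on the Hilbert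
   space L^2(T^*M): the identity |1_A v|^2 = \int_A |v|^2 for all A determines the
   pointwise norm |v|, hence by polarization the pointwise inner product, and by
   Riesz representation the multiplication by g in L^oo, characterized by
   (g v, w) = \int g <v, w>. The pointwise rules (bilinearity, Cauchy-Schwarz,
   |g v| = |g| |v|) follow from their integrated versions. Applied to the functional
   v |-> \int L(v), Riesz representation also identifies the module with its dual.

   For the existence, L^2(T^*M) is realized as the reproducing kernel Hilbert space of
   the positive kernel ((A, f), (B, g)) |-> mu_{f,g}(A `&` B), whose kernel functions
   are the forms 1_A df; there 1_A l = l(A `&` -, -), the pointwise norm is the square
   root of the Radon-Nikodym density of A |-> |1_A v|^2, and [f_i, A_i] is the unique
   v with 1_(A_i) v = 1_(A_i) df_i for all i. Conversely, density of the classes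
   [f_i, A_i] shows that every cotangent module has this structure. *)

From HB Require Import structures.
Require Import Defs.
From mathcomp Require Import all_boot all_order all_algebra.
From mathcomp Require Import all_classical all_reals all_analysis.
From mathcomp Require Import measurable_realfun ess_sup_inf.
From mathcomp Require Import ring lra.
Import Order.TTheory GRing.Theory Num.Theory.
Import numFieldNormedType.Exports.
Local Open Scope classical_set_scope.
Local Open Scope ring_scope.

Set Implicit Arguments.
Unset Strict Implicit.
Unset Printing Implicit Defensive.

(** The statement concerns every cotangent module, and such a module is known only through its
    axioms: these contain neither an inner product nor the nonnegativity of [pn]. What makes the
    Hilbert structure available is that the energy measures satisfy the parallelogram law on each
    Borel set, hence so does [pcm_norm2] on a common refinement of two partitions. Since equality in
    [L0] holds only almost everywhere, no argument may use uncountably many pointwise conditions: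
    identities are compared through integrals over Borel sets, inequalities through rational
    parameters or thresholds [1 / (n + 1)]. [Hilbert_module] is the interface at which an arbitrary
    module and the constructed one meet, so that the rules for action and pointwise norm are proved
    once. A reproducing kernel space consists of genuine functions, so its construction needs
    neither a quotient nor Cauchy sequences, and multiplication by [1_A] becomes composition with a
    map of generators. The price is the positivity of the kernel: the energy measures are only a
    bilinear family of charges, nonnegative on the diagonal, whereas the kernel mixes different
    Borel sets. *)

(** * Quadratic inequalities and approximate representation of functionals *)

Lemma sqr_le_of_quadratic (R : realType) (a b c : R) :
  0 <= c -> (forall t, 0 <= a + 2 * (t * b) + t ^+ 2 * c) -> b ^+ 2 <= a * c.
Proof.
move=> c0 h; case: (eqVneq c 0) => [c00|cN0].
  have -> : b = 0.
    apply/eqP; apply: contraT => bN0.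
    (* With [c = 0] the expression takes the value [-1] at this [t]. *)
    have := h (- (a + 1) / (2 * b)); rewrite c00.
    have -> : - (a + 1) / (2 * b) * b = - (a + 1) / 2 by field.
    lra.
  by rewrite c00; lra.
have cp : 0 < c by rewrite lt_neqAle eq_sym cN0.
have := h (- b / c).
have -> : a + 2 * (- b / c * b) + (- b / c) ^+ 2 * c = (a * c - b ^+ 2) / c by field.
by rewrite pmulr_lge0 ?invr_gt0// subr_ge0.
Qed.

(** Serves the pointwise Cauchy-Schwarz inequality, where only countably many inequalities can be
    required outside a common null set. *)
Lemma sqr_le_of_quadratic_rat (R : realType) (a b c : R) :
  0 <= c -> (forall q : rat, 0 <= a + 2 * (ratr q * b) + ratr q ^+ 2 * c) ->
  b ^+ 2 <= a * c.
Proof.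
move=> c0 h; apply: sqr_le_of_quadratic => // t.
rewrite leNgt; apply/negP => p0.
(* [D] exceeds the difference quotients of the quadratic between [t] and points of [[t, t + 1]], so
   the value stays negative at a rational less than [- p / D] to the right of [t]. *)
set p := (a + _ + _) in p0; pose D := 2 * `|b| + (2 * `|t| + 1) * c + 1.
have D0 : 0 < D by rewrite /D ltr_wpDl// addr_ge0// mulr_ge0// addr_ge0// mulr_ge0.
pose e := Num.min 1 (- p / D).
have e0 : 0 < e by rewrite lt_min ltr01 divr_gt0// oppr_gt0.
have /rat_in_itvoo[q] : t < t + e by rewrite ltrDl.
rewrite in_itv/= => /andP[tq qt].
have := h q; rewrite leNgt => /negP; apply.
set s : R := ratr q - t.
have s0 : 0 < s by rewrite subr_gt0.
have se : s < e by rewrite ltrBlDl.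
have s1 : s < 1 by apply: (lt_le_trans se); rewrite ge_min lexx.
have sp : s * D < - p.
  by rewrite -ltr_pdivlMr//; apply: (lt_le_trans se); rewrite ge_min lexx orbT.
have -> : ratr q = t + s by rewrite /s addrC subrK.
have -> : a + 2 * ((t + s) * b) + (t + s) ^+ 2 * c =
  p + s * (2 * b + (2 * t + s) * c) by rewrite /p; ring.
suff : s * (2 * b + (2 * t + s) * c) <= s * D by lra.
rewrite ler_pM2l// /D.
have tt : (2 * t + s) * c <= (2 * `|t| + 1) * c.
  by rewrite ler_wpM2r// lerD ?(ltW s1)// ler_wpM2l// ler_norm.
have := ler_norm b; lra.
Qed.

(* Nearly minimizing [|h|^2 - 2 l(h)] gives an approximate representation of [l];
   no completeness is involved. *)
Lemma approximate_Riesz (R : realType) (H : Type) (b : H -> H -> R) (l : H -> R)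
    (comb : H -> R -> H -> H) (h0 : H) (C : R) :
  (forall h, 0 <= b h h) ->
  (forall h t k, b (comb h t k) (comb h t k) =
     b h h + 2 * (t * b h k) + t ^+ 2 * b k k) ->
  (forall h t k, l (comb h t k) = l h + t * l k) ->
  (forall h, l h ^+ 2 <= C * b h h) ->
  forall e, 0 < e -> exists h, forall k, (l k - b h k) ^+ 2 <= e * b k k.
Proof.
move=> b0 bc lc lb e e0.
pose J h := b h h - 2 * l h.
(* Arithmetic-geometric mean inequality: [2 * l h] is at most [b h h] plus [|C|]. *)
have Jlb h : - `|C| <= J h.
  have hC : l h ^+ 2 <= `|C| * b h h.
    by apply: (le_trans (lb h)); rewrite ler_wpM2r// ler_norm.
  rewrite /J; move: hC (b0 h) (normr_ge0 C); move: (l h) (b h h) `|C|.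
  move=> x y c xyc y0 c0; have [x0|x0] := leP x 0; first by lra.
  suff : 2 * x <= y + c by lra.
  rewrite -ler_sqr ?nnegrE ?addr_ge0// ?mulr_ge0 ?(ltW x0)//.
  by have := sqr_ge0 (y - c); rewrite exprMn !sqrrD sqrrN; nra.
have Jinf : has_inf (range J).
  split; first by exists (J h0), h0.
  by exists (- `|C|) => _ [h _ <-].
have [_ [h _ <-] Jh] := inf_adherent e0 Jinf.
(* Moving from the near-minimizer [h] in the direction [k] lowers [J] by less than [e]; this is a
   nonnegative quadratic in [t] with constant term [e], whose discriminant gives the claim. *)
exists h => k; rewrite -sqrrN opprB.
apply: sqr_le_of_quadratic => // t.
have : inf (range J) <= J (comb h t k) by apply: ge_inf; [case: Jinf|exists (comb h t k)].
move: Jh; rewrite /J bc lc; lra.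
Qed.

(** * The inner product of a norm that satisfies the parallelogram law *)

Section inner_product.
Context (R : realType) (V : normedModType R).

Definition parallelogram := forall x y : V,
  `|x + y| ^+ 2 + `|x - y| ^+ 2 = 2 * (`|x| ^+ 2 + `|y| ^+ 2).

Definition ip (x y : V) : R := 4^-1 * (`|x + y| ^+ 2 - `|x - y| ^+ 2).

Hypothesis para : parallelogram.

Lemma ipC x y : ip x y = ip y x.
Proof. by rewrite /ip (addrC x) distrC. Qed.

Lemma ipvv x : ip x x = `|x| ^+ 2.
Proof.
by rewrite /ip subrr normr0 -(mulr2n x) normrMn; field.
Qed.

(** Alternating sum of four instances of the parallelogram law; the norms of [x - y + z] and
    [x - y - z] cancel by [f1] and [f2]. *)
Lemma ipDl x y z : ip (x + y) z = ip x z + ip y z.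
Proof.
have e1 := para (x + z) y; have e2 := para (x - z) y.
have e3 := para (y + z) x; have e4 := para (y - z) x.
have f1 : `|x + z - y| = `|y - z - x|.
  by rewrite -[in RHS]normrN !opprB addrA.
have f2 : `|x - z - y| = `|y + z - x|.
  by rewrite -[in RHS]normrN opprB opprD addrA addrAC.
move: e1 e2 e3 e4; rewrite f1 f2 /ip.
have -> : x + z + y = x + y + z by rewrite addrAC.
have -> : x - z + y = x + y - z by rewrite addrAC.
have -> : y + z + x = x + y + z by rewrite addrAC (addrC y).
have -> : y - z + x = x + y - z by rewrite addrAC (addrC y).
lra.
Qed.

Lemma ipNl x y : ip (- x) y = - ip x y.
Proof.
apply/eqP; rewrite -addr_eq0 -ipDl addNr /ip sub0r add0r normrN.
by rewrite subrr mulr0.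
Qed.

Lemma ipBl x y z : ip (x - y) z = ip x z - ip y z.
Proof. by rewrite ipDl ipNl. Qed.

Lemma ip0l y : ip 0 y = 0.
Proof. by have := ipBl y y y; rewrite !subrr. Qed.

Lemma ip_bound x y : `|ip x y| <= `|x| ^+ 2 + `|y| ^+ 2.
Proof.
have := para x y; rewrite /ip ler_norml.
have := sqr_ge0 `|x + y|; have := sqr_ge0 `|x - y|.
have := sqr_ge0 `|x|; have := sqr_ge0 `|y|.
move=> *; apply/andP; split; lra.
Qed.

(* Additivity in [a] and local boundedness give homogeneity: comparing [n * a] with
   its integer part bounds [n * (ip (a x) y - a ip x y)] uniformly in [n]. *)
Lemma ipZl a x y : ip (a *: x) y = a * ip x y.
Proof.
pose g b := ip (b *: x) y - b * ip x y.
have gD b c : g (b + c) = g b + g c by rewrite /g scalerDl ipDl; ring.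
have g1 : g 1 = 0 by rewrite /g scale1r; ring.
have g0 : g 0 = 0 by rewrite /g scale0r ip0l; ring.
have gN b : g (- b) = - g b by apply/eqP; rewrite -addr_eq0 -gD addNr g0.
have gn b n : g (b *+ n) = g b *+ n.
  by elim: n => [|n IH]; rewrite ?mulr0n ?g0// !mulrS gD IH.
have gz (z : int) : g z%:~R = 0.
  case: z => n; first by rewrite -pmulrn gn g1 mul0rn.
  by rewrite NegzE mulrNz gN -pmulrn gn g1 mul0rn oppr0.
pose C := `|x| ^+ 2 + `|y| ^+ 2 + `|ip x y|.
have gb b : `|b| <= 1 -> `|g b| <= C.
  move=> b1; apply: (le_trans (ler_normB _ _)); apply: lerD.
    apply: (le_trans (ip_bound _ _)); rewrite lerD2r normrZ exprMn.
    rewrite ler_piMl ?sqr_ge0// expr_le1//.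
  by rewrite normrM ler_piMl.
apply/eqP; rewrite -subr_eq0 -/(g a); apply: contraT => ga.
have ga0 : 0 < `|g a| by rewrite normr_gt0.
have [n nC] : exists n : nat, C < n%:R * `|g a|.
  exists (Num.truncn (C / `|g a|)).+1; rewrite -ltr_pdivrMr//.
  exact: truncnS_gt.
suff : n%:R * `|g a| <= C by rewrite leNgt nC.
have -> : n%:R * `|g a| = `|g (a *+ n)| by rewrite gn normrMn mulr_natl.
have /andP[f1 f2] := floor_itv (a *+ n).
rewrite -[X in g X](subrK (Num.floor (a *+ n))%:~R) gD gz addr0; apply: gb.
by rewrite ger0_norm ?subr_ge0// lerBlDr; rewrite intrD in f2; rewrite addrC ltW.
Qed.

Lemma ip_linear_l a x y z : ip (a *: x + y) z = a * ip x z + ip y z.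
Proof. by rewrite ipDl ipZl. Qed.

Lemma ip_linear_r a x y z : ip z (a *: x + y) = a * ip z x + ip z y.
Proof. by rewrite ipC ip_linear_l ![ip _ z]ipC. Qed.

Lemma ip_CS x y : `|ip x y| <= `|x| * `|y|.
Proof.
rewrite -ler_sqr ?nnegrE ?mulr_ge0// exprMn real_normK ?num_real//.
apply: sqr_le_of_quadratic; first exact: sqr_ge0.
move=> t; suff <- : `|t *: y + x| ^+ 2 =
  `|x| ^+ 2 + 2 * (t * ip x y) + t ^+ 2 * `|y| ^+ 2 by exact: sqr_ge0.
by rewrite -!ipvv !(ip_linear_l, ip_linear_r) (ipC y x); ring.
Qed.

Lemma ip_inj x y : (forall z, ip x z = ip y z) -> x = y.
Proof.
move=> h; apply/eqP; rewrite -subr_eq0 -normr_eq0 -sqrf_eq0 -ipvv ipBl h.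
by rewrite subrr.
Qed.

End inner_product.

(** * Riesz representation and dense subsets *)

Lemma cauchy_seq_cvg (R : realType) (V : completeNormedModType R) (u : nat -> V) :
  (forall e : R, 0 < e -> exists N, forall n k, (N <= n)%N -> (N <= k)%N ->
     `|u n - u k| < e) -> cvgn u.
Proof.
move=> h; apply/cauchy_cvgP/cauchy_ballP => e e0.
have [N hN] := h _ e0; near_simpl.
exists ([set n | (N <= n)%N], [set n | (N <= n)%N]).
  by split; exact: nbhs_infty_ge.
by move=> [n k] [/= Nn Nk]; rewrite -ball_normE /=; exact: hN.
Qed.

(** Completeness enters only here: the approximate representing vectors of [approximate_Riesz] with
    errors [1 / (n + 1)] form a Cauchy sequence, and their limit represents [l] exactly. *)
Lemma Riesz_representation (R : realType) (V : completeNormedModType R)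
    (l : V -> R) (C : R) :
  parallelogram V ->
  (forall a x y, l (a *: x + y) = a * l x + l y) ->
  (forall x, `|l x| <= C * `|x|) ->
  exists w, forall v, l v = ip w v.
Proof.
move=> para lin lb.
have app (e : R) : 0 < e -> exists h, forall v, `|l v - ip h v| <= e * `|v|.
  move=> e0; have := @approximate_Riesz R V (@ip R V) l (fun h t k => t *: k + h)
    0 (C ^+ 2) _ _ _ _ (e ^+ 2) _.
  case.
  - by move=> h; rewrite ipvv sqr_ge0.
  - move=> h t k; rewrite !(ip_linear_l para, ip_linear_r para) (ipC k h); ring.
  - by move=> h t k; rewrite lin addrC.
  - move=> h; rewrite ipvv -exprMn -[l h ^+ 2]real_normK ?num_real//.
    by rewrite ler_sqr// nnegrE (le_trans _ (lb h)).
  - by rewrite exprn_gt0.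
  move=> h hk; exists h => v; move: (hk v); rewrite ipvv -exprMn.
  rewrite -[(_ - _) ^+ 2]real_normK ?num_real// ler_sqr// nnegrE mulr_ge0//.
  exact: ltW.
have /choice[h hP] : forall n : nat, exists h, forall v,
    `|l v - ip h v| <= n.+1%:R^-1 * `|v|.
  by move=> n; apply: app; rewrite invr_gt0.
have hh n k : `|h n - h k| <= n.+1%:R^-1 + k.+1%:R^-1.
  (* Both approximations of [l] are tested on the difference [z] itself, and [|z|] is cancelled. *)
  set z := h n - h k; case: (eqVneq z 0) => [->|z0].
    by rewrite normr0 addr_ge0.
  rewrite -(ler_pM2r (_ : 0 < `|z|)) ?normr_gt0// -expr2 -ipvv.
  rewrite {1}/z ipBl//.
  have -> : ip (h n) z - ip (h k) z = (l z - ip (h k) z) - (l z - ip (h n) z) by ring.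
  apply: (le_trans (ler_norm _)); apply: (le_trans (ler_normB _ _)).
  by rewrite mulrDl addrC lerD.
have small (e : R) : 0 < e -> exists N, forall n, (N <= n)%N -> n.+1%:R^-1 < e.
  move=> e0; exists (Num.truncn e^-1) => n Nn.
  rewrite invf_plt ?posrE//; apply: (lt_le_trans (truncnS_gt _)).
  by rewrite ler_nat ltnS.
have ch : cvgn h.
  apply: cauchy_seq_cvg => e e0.
  have [|N hN] := small (e / 2); first by rewrite divr_gt0.
  exists N => n k /hN n1 /hN n2; by apply: (le_lt_trans (hh n k)); rewrite (splitr e) ltrD.
exists (limn h) => v; apply/eqP; rewrite -subr_eq0 -normr_le0.
apply/ler_addgt0Pl => e e0; rewrite addr0.
pose e' := e / (2 * (`|v| + 1)).
have v1 : 0 < `|v| + 1 by rewrite ltr_wpDl.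
have e'0 : 0 < e' by rewrite divr_gt0// mulr_gt0.
have [N hN] := small _ e'0.
have [n Nn nl] : exists2 n, (N <= n)%N & `|limn h - h n| < e'.
  have /cvgrPdist_lt/(_ _ e'0)[N' _ N'P] := ch.
  exists (maxn N N'); first exact: leq_maxl.
  by apply: N'P; rewrite /= leq_maxr.
have -> : l v - ip (limn h) v = (l v - ip (h n) v) - ip (limn h - h n) v.
  by rewrite ipBl//; ring.
apply: (le_trans (ler_normB _ _)).
have -> : e = e' * (`|v| + 1) + e' * (`|v| + 1) by rewrite /e'; field; rewrite lt0r_neq0.
have v1' : `|v| <= `|v| + 1 by rewrite lerDl.
apply: lerD.
  by apply: (le_trans (hP n v)); rewrite ler_pM// ltW// hN.
by apply: (le_trans (ip_CS para _ _)); rewrite ler_pM// ltW.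
Qed.

Definition approximable (R : realType) (V : normedModType R) (D : set V) :=
  forall v (e : R), 0 < e -> exists2 w, D w & `|v - w| < e.

Lemma approximable_seq (R : realType) (V : normedModType R) (D : set V) (v : V) :
  approximable D -> exists2 u : nat -> V, (forall n, D (u n)) & u @ \oo --> v.
Proof.
move=> aD; have /choice[u uP] : forall n : nat, exists w, D w /\ `|v - w| < n.+1%:R^-1.
  by move=> n; have [|w] := aD v (n.+1%:R^-1); [rewrite invr_gt0|exists w].
exists u => [n|]; first by case: (uP n).
apply/cvgrPdist_lt => e e0; near=> n.
have [_ /lt_trans] := uP n; apply.
by near: n; exact: near_infty_natSinv_lt (PosNum e0).
Unshelve. all: by end_near. Qed.

Lemma cvg_sqr_norm (R : realType) (V : normedModType R) (u : nat -> V) (v : V) :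
  u @ \oo --> v -> (fun n => `|u n| ^+ 2) @ \oo --> `|v| ^+ 2.
Proof. by move=> uv; apply: (@cvgM R nat \oo); apply: cvg_norm. Qed.

Lemma parallelogram_dense (R : realType) (V : normedModType R) (D : set V) :
  approximable D ->
  (forall x y, D x -> D y ->
    `|x + y| ^+ 2 + `|x - y| ^+ 2 = 2 * (`|x| ^+ 2 + `|y| ^+ 2)) ->
  parallelogram V.
Proof.
move=> aD pD x y.
have [u uD ux] := approximable_seq x aD; have [v vD vy] := approximable_seq y aD.
have c1 : (fun n => `|u n + v n| ^+ 2 + `|u n - v n| ^+ 2) @ \oo -->
    `|x + y| ^+ 2 + `|x - y| ^+ 2.
  by apply: (@cvgD R R^o nat \oo); apply: cvg_sqr_norm; [exact: cvgD|exact: cvgB].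
have c2 : (fun n => 2 * (`|u n| ^+ 2 + `|v n| ^+ 2)) @ \oo -->
    2 * (`|x| ^+ 2 + `|y| ^+ 2).
  apply: (@cvgM R nat \oo); first exact: cvg_cst.
  by apply: (@cvgD R R^o nat \oo); exact: cvg_sqr_norm.
have e : (fun n => `|u n + v n| ^+ 2 + `|u n - v n| ^+ 2) =
    (fun n => 2 * (`|u n| ^+ 2 + `|v n| ^+ 2)) by apply/funext => n; exact: pD.
by rewrite -(cvg_lim _ c1)// -(cvg_lim _ c2)// e.
Qed.

Lemma dense_approximable (R : realType) (V : normedModType R) (D : set V) :
  dense D -> approximable D.
Proof.
move=> dD v e e0; have [||w [vw Dw]] := dD (ball v e).
- by exists v; exact: ballxx.
- exact: ball_open.
- by exists w => //; rewrite -ball_normE in vw.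
Qed.

Lemma approximable_eq (R : realType) (V W : normedModType R) (D : set V)
    (f g : V -> W) (C : R) : approximable D ->
  (forall v w, `|f v - f w| <= C * `|v - w|) ->
  (forall v w, `|g v - g w| <= C * `|v - w|) ->
  (forall v, D v -> f v = g v) -> f = g.
Proof.
move=> aD fC gC fg; apply/funext => v; apply/eqP; rewrite -subr_eq0 -normr_le0.
apply/ler_addgt0Pl => e e0; rewrite addr0.
(* The sign of [C] is arbitrary; [C'] is a positive replacement by which one can divide. *)
pose C' := `|C| + 1; have C'0 : 0 < C' by rewrite ltr_wpDl.
have [|w Dw vw] := aD v (e / (2 * C')); first by rewrite divr_gt0// mulr_gt0.
have le z : C * z <= C' * `|z|.
  apply: (le_trans (ler_norm _)); rewrite normrM ler_wpM2r// lerDl//.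
rewrite -(subrKA (f w)) (_ : f w - g v = - (g v - g w)); last by rewrite fg// opprB.
apply: (le_trans (ler_normB _ _)).
apply: (le_trans (lerD (fC _ _) (gC _ _))).
apply: (le_trans (lerD (le _) (le _))); rewrite normr_id.
by move: vw; rewrite ltr_pdivlMr ?mulr_gt0// => vw; lra.
Qed.

Lemma approximable_dense (R : realType) (V : normedModType R) (D : set V) :
  approximable D -> dense D.
Proof.
move=> aD O [v Ov] oO; have /nbhs_ballP[r /= r0 rO] := open_nbhs_nbhs (conj oO Ov).
have [w Dw vw] := aD v r r0.
by exists w; split => //; apply: rO; rewrite -ball_normE.
Qed.

(** * Reproducing kernel Hilbert spaces *)

Section rkhs.
Context (R : realType) (K : Type).

(** A list stands for a formal linear combination of points of [K]. Lists are never identified with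
    each other, since only the linear extension [ev] and the bilinear extension [gram] are evaluated
    on them. *)
Definition ev (l : K -> R) (s : seq (R * K)) : R := \sum_(p <- s) p.1 * l p.2.

Definition gram (k : K -> K -> R) (s t : seq (R * K)) : R :=
  ev (fun x => ev (k x) t) s.

Record kernel := Kernel {
  kernel_fun :> K -> K -> R ;
  kernel_sym : forall x y, kernel_fun x y = kernel_fun y x ;
  kernel_psd : forall s, 0 <= gram kernel_fun s s }.

Definition seq_scale (a : R) (s : seq (R * K)) := [seq (a * p.1, p.2) | p <- s].

Lemma ev_cat l s t : ev l (s ++ t) = ev l s + ev l t.
Proof. exact: big_cat. Qed.

Lemma ev_cons l p s : ev l (p :: s) = p.1 * l p.2 + ev l s.
Proof. exact: big_cons. Qed.

Lemma ev_scale l a s : ev l (seq_scale a s) = a * ev l s.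
Proof.
by rewrite /ev big_map mulr_sumr; apply: eq_bigr => p _; rewrite mulrA.
Qed.

Lemma ev_linear a l l' s :
  ev (fun x => a * l x + l' x) s = a * ev l s + ev l' s.
Proof.
rewrite /ev mulr_sumr -big_split; apply: eq_bigr => p _ /=; ring.
Qed.

Lemma gramD (c c' : K -> K -> R) s t :
  gram (fun x y => c x y + c' x y) s t = gram c s t + gram c' s t.
Proof.
rewrite /gram /ev -big_split; apply: eq_bigr => p _ /=.
by rewrite -mulrDr -big_split; congr (_ * _); apply: eq_bigr => q _ /=; rewrite -mulrDr.
Qed.

Lemma cvg_ev (u : nat -> K -> R) l s : (forall x, (fun n => u n x) @ \oo --> l x) ->
  (fun n => ev (u n) s) @ \oo --> ev l s.
Proof.
move=> ul; elim: s => [|[a x] s IH].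
  by rewrite /ev big_nil; under eq_fun do rewrite big_nil; exact: cvg_cst.
rewrite ev_cons; under eq_fun do rewrite ev_cons.
by apply: cvgD => //=; apply: cvgM => //; exact: cvg_cst.
Qed.

Variable k : kernel.

Lemma gramC s t : gram k s t = gram k t s.
Proof.
rewrite /gram /ev; under eq_bigr do rewrite mulr_sumr.
rewrite exchange_big; apply: eq_bigr => p _; rewrite mulr_sumr.
by apply: eq_bigr => q _; rewrite kernel_sym; ring.
Qed.

Lemma gram_combl s a t u : gram k (s ++ seq_scale a t) u = gram k s u + a * gram k t u.
Proof. by rewrite /gram ev_cat ev_scale. Qed.

Lemma gram_scale a s : gram k (seq_scale a s) (seq_scale a s) = a ^+ 2 * gram k s s.
Proof. by rewrite {1}/gram ev_scale -/(gram _ _ _) gramC {1}/gram ev_scale mulrA. Qed.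

Lemma gram_comb s a t : gram k (s ++ seq_scale a t) (s ++ seq_scale a t) =
  gram k s s + 2 * (a * gram k s t) + a ^+ 2 * gram k t t.
Proof.
rewrite gram_combl (gramC s (_ ++ _)) gram_combl (gramC t (_ ++ _)) gram_combl.
by rewrite (gramC t s); ring.
Qed.

Lemma gram_CS s t : gram k s t ^+ 2 <= gram k s s * gram k t t.
Proof.
apply: sqr_le_of_quadratic; first exact: kernel_psd.
by move=> a; rewrite -gram_comb; exact: kernel_psd.
Qed.

(** The functions on [K] whose linear extension is bounded for the seminorm of [gram] are, by Riesz,
    exactly the elements of the reproducing kernel Hilbert space. Defining the space as a dual
    performs the quotient by null vectors and the completion at once. *)
Definition rkhs_bounded (l : K -> R) : Prop :=
  exists C, forall s, ev l s ^+ 2 <= C * gram k s s.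

Definition rkhs_pred : {pred K -> R} := [pred l | `[< rkhs_bounded l >]].

Lemma rkhs_submod_closed : submod_closed rkhs_pred.
Proof.
split.
  apply/asboolP; exists 0 => s; rewrite /ev big1 ?expr0n ?mul0r//.
  by move=> p _; rewrite mulr0.
move=> a l l' /asboolP[C lC] /asboolP[C' lC']; apply/asboolP.
(* From [(a * x + y) ^+ 2 <= 2 * (a * x) ^+ 2 + 2 * y ^+ 2]. *)
exists (2 * (a ^+ 2 * C + C')) => s; rewrite [ev _ _]ev_linear.
have := lC s; have := lC' s; move: (ev l s) (ev l' s) => x y h' h.
have : 0 <= (a * x - y) ^+ 2 by exact: sqr_ge0.
have : a ^+ 2 * x ^+ 2 <= a ^+ 2 * (C * gram k s s) by rewrite ler_wpM2l// sqr_ge0.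
by lra.
Qed.

HB.instance Definition _ := GRing.isSubmodClosed.Build R (K -> R)
  rkhs_pred rkhs_submod_closed.

Record rkhs : Type := Rkhs { rkhs_fun :> K -> R; _ : rkhs_fun \in rkhs_pred }.
HB.instance Definition _ := [isSub for rkhs_fun].
HB.instance Definition _ := [Choice of rkhs by <:].
HB.instance Definition _ := [SubChoice_isSubLmodule of rkhs by <:].

Lemma rkhsP (l : rkhs) : rkhs_bounded l.
Proof. by case: l => l /= /asboolP. Qed.

Lemma rkhs_linE a (l l' : rkhs) x : (a *: l + l') x = a * l x + l' x.
Proof. by []. Qed.

Lemma rkhs_ext (l l' : rkhs) : (forall x, l x = l' x) -> l = l'.
Proof. by move=> ll'; exact/val_inj/funext. Qed.

Lemma ev_rkhs_linear a (l l' : rkhs) s :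
  ev (a *: l + l') s = a * ev l s + ev l' s.
Proof. exact: ev_linear. Qed.

Definition rkhs_values (l : K -> R) : set R :=
  [set `|ev l s| | s in [set s | gram k s s <= 1]].

Definition rkhs_norm (l : rkhs) : R := sup (rkhs_values l).

Lemma rkhs_values_sup (l : rkhs) : has_sup (rkhs_values l).
Proof.
split.
  by exists `|ev l [::]|, [::] => //; rewrite /mkset /gram /ev big_nil.
have [C lC] := rkhsP l; exists (1 + `|C|) => _ [s s1 <-].
have C0 : 0 <= `|C| by [].
rewrite -ler_sqr ?nnegrE// ?addr_ge0// real_normK ?num_real//.
apply: (le_trans (lC s)); apply: (@le_trans _ _ `|C|).
  apply: (le_trans (ler_norm _)); rewrite normrM ler_piMr//.
  by rewrite ger0_norm ?kernel_psd.
by rewrite sqrrD; nra.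
Qed.

Lemma rkhs_norm_ge0 l : 0 <= rkhs_norm l.
Proof.
apply: (@le_trans _ _ `|ev l [::]|) => //.
apply: sup_upper_bound; first exact: rkhs_values_sup.
by exists [::] => //; rewrite /mkset /gram /ev big_nil.
Qed.

Lemma ev_le_norm (l : rkhs) s : ev l s ^+ 2 <= rkhs_norm l ^+ 2 * gram k s s.
Proof.
(* On a null vector of [gram] boundedness alone forces [ev l s = 0]; any other list can be rescaled
   to have Gram value 1. *)
case: (eqVneq (gram k s s) 0) => [s0|sN0].
  by have [C /(_ s)] := rkhsP l; rewrite s0 !mulr0.
have sp : 0 < gram k s s by rewrite lt_neqAle eq_sym sN0 kernel_psd.
set a := Num.sqrt (gram k s s).
have ap : 0 < a by rewrite sqrtr_gt0.
have a2 : a ^+ 2 = gram k s s by rewrite sqr_sqrtr// ltW.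
have : `|ev l (seq_scale a^-1 s)| <= rkhs_norm l.
  apply: sup_upper_bound; first exact: rkhs_values_sup.
  exists (seq_scale a^-1 s) => //=.
  by rewrite gram_scale -a2 exprVn mulVf// expf_neq0// lt0r_neq0.
rewrite ev_scale normrM gtr0_norm ?invr_gt0// ler_pdivrMl// => h.
rewrite -a2 -exprMn -[X in X <= _]real_normK ?num_real//.
by rewrite ler_sqr ?nnegrE ?mulr_ge0 ?rkhs_norm_ge0 ?(ltW ap)// mulrC.
Qed.

Lemma rkhs_norm_le (l : rkhs) D : 0 <= D ->
  (forall s, ev l s ^+ 2 <= D ^+ 2 * gram k s s) -> rkhs_norm l <= D.
Proof.
move=> D0 h; apply: ge_sup; first by case: (rkhs_values_sup l).
move=> _ [s s1 <-]; rewrite -ler_sqr ?nnegrE// real_normK ?num_real//.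
by apply: (le_trans (h s)); rewrite ler_piMr// sqr_ge0.
Qed.

Lemma ev1 (l : K -> R) x : ev l [:: (1, x)] = l x.
Proof. by rewrite /ev big_seq1 mul1r. Qed.

Lemma rkhs_normD l l' : rkhs_norm (l + l') <= rkhs_norm l + rkhs_norm l'.
Proof.
apply: ge_sup; first by case: (rkhs_values_sup (l + l')).
move=> _ [s s1 <-].
have := ev_rkhs_linear 1 l l' s; rewrite scale1r mul1r => ->.
apply: (le_trans (ler_normD _ _)); apply: lerD;
  (apply: sup_upper_bound; [exact: rkhs_values_sup|by exists s]).
Qed.

Lemma rkhs_normZ a l : rkhs_norm (a *: l) = `|a| * rkhs_norm l.
Proof.
have le b l' : rkhs_norm (b *: l') <= `|b| * rkhs_norm l'.
  apply: rkhs_norm_le => [|s]; first by rewrite mulr_ge0// rkhs_norm_ge0.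
  have -> : ev (b *: l') s = b * ev l' s.
    have := ev_rkhs_linear b l' 0 s; rewrite addr0 => ->.
    by rewrite [X in _ + X]big1 ?addr0// => p _; rewrite mulr0.
  rewrite !exprMn real_normK ?num_real// -[leRHS]mulrA.
  by rewrite ler_wpM2l ?sqr_ge0// ev_le_norm.
apply/eqP; rewrite eq_le le /=; case: (eqVneq a 0) => [->|a0].
  by rewrite normr0 mul0r rkhs_norm_ge0.
rewrite -ler_pdivlMl ?normr_gt0//.
have := le a^-1 (a *: l); rewrite scalerA mulVf// scale1r.
by rewrite normfV.
Qed.

Lemma rkhs_norm0_eq0 l : rkhs_norm l = 0 -> l = 0.
Proof.
move=> l0; apply/val_inj/funext => x /=.
have := ev_le_norm l [:: (1, x)].
rewrite l0 expr0n/= mul0r ev1 => h; apply/eqP.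
by rewrite -sqrf_eq0 eq_le h sqr_ge0.
Qed.

HB.instance Definition _ := Lmodule_isNormed.Build R rkhs
  rkhs_normD rkhs_normZ rkhs_norm0_eq0.

Lemma rkhs_normE (l : rkhs) : `|l| = rkhs_norm l. Proof. by []. Qed.

(** Centres [u n] of balls of radius [1 / (n + 1)] in the filter converge pointwise, since
    evaluations are bounded by the norm. The estimates between [u n] and [u m] pass to the limit in
    [m] on each list, so the pointwise limit [l] is bounded and is also the limit in norm. *)
Lemma rkhs_complete (G : set_system rkhs) : ProperFilter G -> cauchy G -> cvg G.
Proof.
move=> PG /cauchy_ballP cG.
have /choice[c cP] : forall e : {posnum R}, exists l : rkhs, G (ball l e%:num).
  move=> e; have [[A B] /= [GA GB] AB] := cG _ (gt0 e).
  have [l Al] := filter_ex GA; exists l.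
  by apply: filterS GB => x Bx; apply: (AB (l, x)).
pose pn n : {posnum R} := PosNum (ltac:(by rewrite invr_gt0) : 0 < (n.+1%:R : R)^-1).
pose u n := c (pn n).
have uG n : G (ball (u n) n.+1%:R^-1) by exact: cP.
have uu n m : `|u n - u m| <= n.+1%:R^-1 + m.+1%:R^-1.
  have [x []] := filter_ex (filterI (uG n) (uG m)).
  rewrite -ball_normE/= => x1 x2; rewrite -(subrKA x).
  by apply: (le_trans (ler_normD _ _)); rewrite lerD// ltW// distrC.
have evB (l l' : rkhs) s : ev (l - l') s = ev l s - ev l' s.
  by rewrite -scaleN1r addrC ev_rkhs_linear mulN1r addrC.
have evu n m s : (ev (u n) s - ev (u m) s) ^+ 2 <=
    (n.+1%:R^-1 + m.+1%:R^-1) ^+ 2 * gram k s s.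
  rewrite -evB; apply: (le_trans (ev_le_norm _ _)).
  by rewrite ler_wpM2r ?kernel_psd// ler_sqr ?nnegrE ?rkhs_norm_ge0 ?addr_ge0// uu.
have small (e : R) : 0 < e -> exists n : nat, n.+1%:R^-1 < e.
  move=> e0; exists (Num.truncn e^-1).
  by rewrite invf_plt ?posrE//; exact: truncnS_gt.
have mono (n m : nat) : (n <= m)%N -> (m.+1%:R^-1 <= n.+1%:R^-1 :> R).
  by move=> nm; rewrite lef_pV2 ?posrE// ler_nat.
have abs_le s n m : (n <= m)%N ->
    `|ev (u n) s - ev (u m) s| <= (2 * n.+1%:R^-1) * Num.sqrt (gram k s s).
  move=> nm; rewrite -ler_sqr ?nnegrE ?mulr_ge0// exprMn real_normK ?num_real//.
  rewrite sqr_sqrtr ?kernel_psd//; apply: (le_trans (evu _ _ _)).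
  rewrite ler_wpM2r ?kernel_psd// ler_sqr ?nnegrE ?addr_ge0 ?mulr_ge0//.
  by rewrite mulr_natl mulr2n lerD2l mono.
have evc s : cvgn (fun n => ev (u n) s).
  apply: (@cauchy_seq_cvg R R^o) => e e0.
  have d0 : 0 < e / (4 * (Num.sqrt (gram k s s) + 1)).
    by rewrite divr_gt0// mulr_gt0// ltr_wpDl.
  have [N hN] := small _ d0; exists N => n m Nn Nm.
  rewrite -(subrKA (ev (u N) s)); apply: (le_lt_trans (ler_normD _ _)).
  rewrite (distrC _ (ev (u N) s)).
  apply: (le_lt_trans (lerD (abs_le _ _ _ Nn) (abs_le _ _ _ Nm))).
  move: hN; rewrite ltr_pdivlMr ?mulr_gt0 ?ltr_wpDl//.
  set q := N.+1%:R^-1; move: (Num.sqrt _) => r.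
  have : 0 < q by rewrite invr_gt0.
  lra.
pose l x := limn (fun n => u n x).
have ul x : (fun n => u n x) @ \oo --> l x.
  by have := evc [:: (1, x)]; under eq_fun do rewrite ev1.
have evl s : (fun n => ev (u n) s) @ \oo --> ev l s by exact: cvg_ev.
have lu n s : (ev l s - ev (u n) s) ^+ 2 <= (2 * n.+1%:R^-1) ^+ 2 * gram k s s.
  rewrite -[X in X <= _]real_normK ?num_real//.
  rewrite -[X in _ * X]sqr_sqrtr ?kernel_psd// -exprMn.
  rewrite ler_sqr ?nnegrE ?mulr_ge0// distrC.
  have cv : (fun m => `|ev (u n) s - ev (u m) s|) @ \oo --> `|ev (u n) s - ev l s|.
    by apply: cvg_norm; apply: cvgB => //; exact: cvg_cst.
  rewrite -(cvg_lim _ cv)//; apply: limr_le; first by apply/cvg_ex; eexists; exact: cv.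
  by exists n => // m nm; exact: abs_le.
have lB : rkhs_bounded l.
  (* [l] is at bounded distance from [u 0], which is bounded; the factor 2 comes from squaring this
     sum. *)
  exists (2 * ((2 * 0.+1%:R^-1) ^+ 2 + rkhs_norm (u 0) ^+ 2)) => s.
  have h1 := lu 0 s; have h2 := ev_le_norm (u 0) s.
  have : 0 <= (ev l s - 2 * ev (u 0) s) ^+ 2 by exact: sqr_ge0.
  move: h1 h2; move: (ev l s) (ev (u 0) s) (gram k s s) (rkhs_norm _ ^+ 2).
  by move: ((_ * _) ^+ 2) => D x y g N *; lra.
have lP : l \in rkhs_pred by apply/asboolP.
pose L := Rkhs lP.
have uL n : `|L - u n| <= 2 * n.+1%:R^-1.
  by apply: rkhs_norm_le => [|s]; rewrite ?mulr_ge0// evB; exact: lu.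
apply/cvg_ex; exists L; apply/cvg_ballP => e e0; near_simpl.
have [n hn] := small (e / 3) (divr_gt0 e0 (ltr0Sn R 2)).
apply: filterS (uG n) => x; rewrite -ball_normE/= => ux.
rewrite -(subrKA (u n)); apply: (le_lt_trans (ler_normD _ _)).
move: (uL n) ux hn; move: (n.+1%:R^-1) `|L - u n| `|u n - x| => *; lra.
Qed.

HB.instance Definition _ := Uniform_isComplete.Build rkhs rkhs_complete.

Lemma kvec_subproof x : k x \in rkhs_pred.
Proof.
apply/asboolP; exists (k x x) => s.
have := gram_CS [:: (1, x)] s; rewrite {1}/gram ev1.
by rewrite {1}/gram ev1 ev1.
Qed.

Definition kvec x : rkhs := Rkhs (kvec_subproof x).

Definition kspan (s : seq (R * K)) : rkhs := \sum_(p <- s) p.1 *: kvec p.2.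

Lemma kspanE s x : kspan s x = ev (k x) s.
Proof.
rewrite /kspan /ev; elim: s => [|p s IH]; first by rewrite !big_nil.
by rewrite !big_cons rkhs_linE IH /= kernel_sym.
Qed.

Lemma ev_kspan s t : ev (kspan s) t = gram k s t.
Proof.
rewrite gramC /gram /ev; apply: eq_bigr => p _; congr (_ * _).
exact: kspanE.
Qed.

Lemma kspan_norm s : `|kspan s| ^+ 2 = gram k s s.
Proof.
have sg : Num.sqrt (gram k s s) ^+ 2 = gram k s s by rewrite sqr_sqrtr ?kernel_psd.
apply/eqP; rewrite eq_le; apply/andP; split.
  rewrite -sg ler_sqr ?nnegrE//; apply: rkhs_norm_le => // t.
  by rewrite sg ev_kspan gram_CS.
have := ev_le_norm (kspan s) s; rewrite ev_kspan -rkhs_normE expr2.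
case: (eqVneq (gram k s s) 0) => [-> _|s0]; first exact: sqr_ge0.
by rewrite ler_pM2r// lt_neqAle eq_sym s0 kernel_psd.
Qed.

Lemma kvec_norm x : `|kvec x| ^+ 2 = k x x.
Proof.
have -> : kvec x = kspan [:: (1, x)] by rewrite /kspan big_seq1 scale1r.
by rewrite kspan_norm /gram !ev1.
Qed.

Lemma kspan_cat s t : kspan (s ++ t) = kspan s + kspan t.
Proof. exact: big_cat. Qed.

Lemma kspan_scale a s : kspan (seq_scale a s) = a *: kspan s.
Proof.
by rewrite /kspan big_map scaler_sumr; apply: eq_bigr => p _; rewrite scalerA.
Qed.

(** A list that represents [ev l] up to a small error for [gram] gives a kernel combination close to
    [l] in the dual norm, so density is [approximate_Riesz] on lists. *)
Lemma kspan_dense : approximable (range kspan).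
Proof.
(* Half of [e], because [rkhs_norm_le] yields only a weak inequality. *)
move=> l e e0; have e20 : 0 < e / 2 by rewrite divr_gt0.
have [s sP] := @approximate_Riesz R (seq (R * K)) (gram k) (ev l)
  (fun s a t => s ++ seq_scale a t) [::] (rkhs_norm l ^+ 2)
  (@kernel_psd k) gram_comb (fun s a t => ltac:(by rewrite ev_cat ev_scale))
  (ev_le_norm l) ((e / 2) ^+ 2) (exprn_gt0 2 e20).
exists (kspan s); first by exists s.
apply: (@le_lt_trans _ _ (e / 2)); last by rewrite ltr_pdivrMr// ltr_pMr// ltr1n.
apply: rkhs_norm_le; first exact: ltW.
move=> t; rewrite -scaleN1r addrC ev_rkhs_linear mulN1r addrC ev_kspan.
exact: sP.
Qed.

Lemma rkhs_parallelogram : parallelogram rkhs.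
Proof.
apply: (parallelogram_dense kspan_dense) => _ _ [s _ <-] [t _ <-].
rewrite !kspan_norm -(scaleN1r (kspan t)) -kspan_scale -!kspan_cat !kspan_norm.
have := gram_comb s 1 t.
have -> : seq_scale 1 t = t.
  by rewrite -[RHS]map_id; apply: eq_map => -[a x]; rewrite /= mul1r.
move=> ->; rewrite gram_comb; ring.
Qed.

Section pullback.
Variable phi : K -> K.
Let push (s : seq (R * K)) := [seq (p.1, phi p.2) | p <- s].
Hypothesis phi_le : forall s, gram k (push s) (push s) <= gram k s s.

Let ev_push l s : ev l (push s) = ev (l \o phi) s.
Proof. by rewrite /ev big_map. Qed.

(** Composition with [phi] is dual to pushing combinations forward; as the latter contracts [gram],
    the former preserves boundedness and contracts the norm. *)
Lemma pullback_subproof (l : rkhs) : l \o phi \in rkhs_pred.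
Proof.
apply/asboolP; exists (rkhs_norm l ^+ 2) => s; rewrite -ev_push.
by apply: (le_trans (ev_le_norm _ _)); rewrite ler_wpM2l// sqr_ge0.
Qed.

Definition pullback (l : rkhs) : rkhs := Rkhs (pullback_subproof l).

Lemma pullback_linear a l l' : pullback (a *: l + l') = a *: pullback l + pullback l'.
Proof. exact/val_inj. Qed.

Lemma pullback_contraction l : `|pullback l| <= `|l|.
Proof.
apply: rkhs_norm_le; first exact: rkhs_norm_ge0.
move=> s; rewrite -ev_push; apply: (le_trans (ev_le_norm _ _)).
by rewrite ler_wpM2l// sqr_ge0.
Qed.

End pullback.
End rkhs.

(* Sealed: the unifier would otherwise unfold the quotients behind [L0]. *)
HB.lock Definition intg d (X : measurableType d) (R : realType)
    (m : {measure set X -> \bar R}) (A : set X) (f : L0 m) : R :=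
  \int[m]_(x in A) f x.

(** * Integrals of classes of functions, [L^1] and [L^2] *)

Section L0_integration.
Context d (X : measurableType d) (R : realType) (m : {measure set X -> \bar R}).
Implicit Types (f g h : L0 m) (A B : set X).
Local Notation L0 := (L0 m).

Lemma L0_exprE f n : {ae m, forall x, (f ^+ n : L0) x = f x ^+ n}.
Proof.
elim: n => [|n IH]; first exact: L0_oneE.
by rewrite exprS; apply: filterS2 (L0_mulE f (f ^+ n)) IH => x -> ->; rewrite exprS.
Qed.

Lemma L0_linE a f g : {ae m, forall x, (a *: f + g : L0) x = a * f x + g x}.
Proof. by apply: filterS2 (L0_addE (a *: f) g) (L0_scaleE a f) => x -> ->. Qed.

Lemma L0_subE f g : {ae m, forall x, (f - g : L0) x = f x - g x}.
Proof. by apply: filterS2 (L0_addE f (- g)) (L0_oppE g) => x -> ->. Qed.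

Definition summable f := m.-integrable setT (EFin \o f).

Lemma summableS A f : measurable A -> summable f -> m.-integrable A (EFin \o f).
Proof. by move=> mA; exact: integrableS. Qed.

Lemma EFin_intg A f : measurable A -> summable f ->
  (intg A f)%:E = (\int[m]_(x in A) (f x)%:E)%E.
Proof. by move=> mA sf; rewrite intg.unlock fineK//; exact/integrable_fin_num/summableS. Qed.

Lemma ae_integrable (u v : X -> R) : measurable_fun setT v ->
  {ae m, forall x, u x = v x} -> m.-integrable setT (EFin \o u) ->
  m.-integrable setT (EFin \o v).
Proof.
move=> mv uv /integrableP[/measurable_EFinP mu fu]; apply/integrableP; split.
  exact/measurable_EFinP.
apply: le_lt_trans fu; rewrite le_eqVlt; apply/orP; left; apply/eqP.
apply: ae_eq_integral => //.
- by apply: measurableT_comp => //; exact/measurable_EFinP.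
- by apply: measurableT_comp => //; exact/measurable_EFinP.
- by apply: filterS uv => x uv _ /=; rewrite uv.
Qed.

Lemma ae_Rintegral (u v : X -> R) A : measurable A -> measurable_fun setT u ->
  measurable_fun setT v -> {ae m, forall x, u x = v x} ->
  \int[m]_(x in A) u x = \int[m]_(x in A) v x.
Proof.
move=> mA mu mv uv; congr fine; apply: ae_eq_integral => //.
- by apply/measurable_EFinP; exact: measurable_funTS.
- by apply/measurable_EFinP; exact: measurable_funTS.
- by apply: filterS uv => x -> _.
Qed.

Lemma summable_lin a f g : summable f -> summable g -> summable (a *: f + g).
Proof.
move=> sf sg.
apply: (@ae_integrable (fun x => a * f x + g x)).
- exact: measurable_L0.
- by apply: filterS (L0_linE a f g) => x ->.
- have -> : EFin \o (fun x => a * f x + g x) =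
      ((cst a%:E \* (EFin \o f)) \+ (EFin \o g))%E by [].
  by apply: integrableD => //; exact: integrableZl.
Qed.

Lemma intg_lin a f g A : measurable A -> summable f -> summable g ->
  intg A (a *: f + g) = a * intg A f + intg A g.
Proof.
move=> mA sf sg.
have sfA := summableS mA sf; have sgA := summableS mA sg.
rewrite intg.unlock -RintegralZl// -RintegralD//; last first.
  have -> : EFin \o (fun x => a * f x) = (cst a%:E \* (EFin \o f))%E by [].
  exact: integrableZl.
apply: ae_Rintegral => //; last exact: L0_linE.
apply: measurable_funD; last exact: measurable_L0.
by apply: measurable_funM => //; exact: measurable_L0.
Qed.

Lemma Lp1P f : Lp 1%E f <-> summable f.
Proof.
rewrite -Lfun1_integrable /Lp/=; split => [h|].
  by apply/andP; split; rewrite inE//=; exact: measurable_L0.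
by move=> /andP[_]; rewrite inE.
Qed.

Lemma summable0 : summable 0.
Proof. by apply/Lp1P; have [] := L0_zeroN1 m. Qed.

Lemma summableD f g : summable f -> summable g -> summable (f + g).
Proof. by rewrite -{2}(scale1r f); exact: summable_lin. Qed.

Lemma summableZ a f : summable f -> summable (a *: f).
Proof. by rewrite -[a *: f]addr0 => sf; apply: summable_lin => //; exact: summable0. Qed.

Lemma summableB f g : summable f -> summable g -> summable (f - g).
Proof. by move=> sf sg; rewrite -scaleN1r addrC; exact: summable_lin. Qed.

Lemma intgD f g A : measurable A -> summable f -> summable g ->
  intg A (f + g) = intg A f + intg A g.
Proof. by move=> mA sf sg; rewrite -{1}(scale1r f) intg_lin// mul1r. Qed.

Lemma intg0 A : measurable A -> intg A (0 : L0) = 0.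
Proof.
move=> mA; have := intgD mA summable0 summable0.
by rewrite addr0 => /eqP; rewrite -subr_eq0 opprD addNKr oppr_eq0 => /eqP.
Qed.

Lemma intgZ a f A : measurable A -> summable f -> intg A (a *: f) = a * intg A f.
Proof.
by move=> mA sf; rewrite -[a *: f]addr0 intg_lin ?intg0 ?addr0//; exact: summable0.
Qed.

Lemma intgB f g A : measurable A -> summable f -> summable g ->
  intg A (f - g) = intg A f - intg A g.
Proof.
by move=> mA sf sg; rewrite addrC -scaleN1r intg_lin// mulN1r addrC.
Qed.

Lemma intg_ge0 f A : measurable A -> {ae m, forall x, 0 <= f x} -> 0 <= intg A f.
Proof.
move=> mA f0; rewrite intg.unlock; apply: fine_ge0.
rewrite (_ : integral _ _ _ = \int[m]_(x in A) `|(f x)%:E|)%E ?integral_ge0//.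
have mf : measurable_fun A (EFin \o f).
  by apply/measurable_EFinP/measurable_funTS; exact: measurable_L0.
apply: ae_eq_integral => //; first exact: measurableT_comp.
by apply: filterS f0 => x f0 _ /=; rewrite ger0_norm.
Qed.

Lemma le_intg f g A : measurable A -> summable f -> summable g ->
  {ae m, forall x, f x <= g x} -> intg A f <= intg A g.
Proof.
move=> mA sf sg fg; rewrite -subr_ge0 -intgB//; apply: intg_ge0 => //.
by apply: filterS2 fg (L0_subE g f) => x fg ->; rewrite subr_ge0.
Qed.

Lemma intg_inj f g : summable f -> summable g ->
  (forall A, measurable A -> intg A f = intg A g) -> f = g.
Proof.
move=> sf sg fg; apply/L0_eqP.
have : ae_eq m setT (EFin \o f) (EFin \o g).
  apply: integral_ae_eq => //.
    by apply/measurable_EFinP; exact: measurable_L0.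
  by move=> A _ mA; rewrite -!EFin_intg// fg.
by apply: filterS => x /(_ I)[].
Qed.

Definition ind A : L0 := L0_class m (\1_A).

Lemma indE A : measurable A -> {ae m, forall x, ind A x = \1_A x}.
Proof. by move=> mA; apply: L0_classE; exact: measurable_indic. Qed.

Lemma intg_ind A B f : measurable A -> measurable B ->
  intg A (ind B * f) = intg (A `&` B) f.
Proof.
move=> mA mB; rewrite intg.unlock Rintegral_mkcondr.
have mf := measurable_L0 f; have mi := measurable_indic mB.
rewrite (@ae_Rintegral _ (fun x => \1_B x * f x))//.
- by apply: eq_Rintegral => x _; rewrite patchE indicE; case: ifPn; rewrite ?mul1r ?mul0r.
- exact: measurable_funM.
- by apply: filterS2 (L0_mulE (ind B) f) (indE mB) => x -> ->.
Qed.

Lemma summable_dom f g : summable g -> {ae m, forall x, `|f x| <= g x} -> summable f.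
Proof.
move=> /integrableP[mg fg] le; apply/integrableP; split.
  by apply/measurable_EFinP; exact: measurable_L0.
apply: le_lt_trans fg; apply: ae_ge0_le_integral => //.
- by apply: measurableT_comp => //; apply/measurable_EFinP; exact: measurable_L0.
- exact: measurableT_comp.
- by apply: filterS le => x le _ /=; rewrite lee_fin (le_trans le) ?ler_norm.
Qed.

Lemma sqrE f : {ae m, forall x, (f ^+ 2 : L0) x = f x ^+ 2}. Proof. exact: L0_exprE. Qed.

Lemma Lp2P f : Lp 2%:E f <-> summable (f ^+ 2).
Proof.
have mf := measurable_L0 f.
have msq : measurable_fun setT (fun x => f x ^+ 2) by exact: measurable_funX.
split=> [h|/(ae_integrable msq (sqrE f)) /integrableP[_ h]].
  apply: (@ae_integrable (fun x => f x ^+ 2)); first exact: measurable_L0.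
    by apply: filterS (sqrE f) => x ->.
  apply: Lfun2_integrable_sqr; rewrite inE; apply/andP; split; rewrite inE//=.
rewrite /Lp/= /finite_norm unlock; apply: poweR_lty.
under eq_integral => x _ do rewrite /= powR_mulrn//.
by under eq_integral => x _ do rewrite -normrX -abse_EFin.
Qed.

Lemma Lp_norm2 f : Lp 2%:E f -> Lp_norm 2%:E f ^+ 2 = intg setT (f ^+ 2).
Proof.
move=> f2; have s2 := (Lp2P f).1 f2.
apply: EFin_inj; rewrite EFin_intg//.
have -> : (\int[m]_x ((f ^+ 2 : L0) x)%:E = \int[m]_x ((f x) ^+ 2)%:E)%E.
  apply: ae_eq_integral => //.
  - by apply/measurable_EFinP; exact: measurable_L0.
  - by apply/measurable_EFinP; apply: measurable_funX; exact: measurable_L0.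
  - by apply: filterS (sqrE f) => x -> _.
have Nf : ('N[m]_2%:E [EFin \o f])%E \is a fin_num by rewrite ge0_fin_numE ?Lnorm_ge0.
rewrite /Lp_norm -powR_mulrn ?fine_ge0 ?Lnorm_ge0// -poweR_EFin fineK//.
rewrite poweR_Lnorm//.
under eq_integral => x _ do rewrite /= powR_mulrn//.
by apply: eq_integral => x _; rewrite -normrX ger0_norm ?sqr_ge0.
Qed.

Lemma Lp_norm_ge0 p f : 0 <= Lp_norm p f.
Proof. by rewrite fine_ge0 ?Lnorm_ge0. Qed.

Lemma Lp2_mul f g : Lp 2%:E f -> Lp 2%:E g -> summable (f * g).
Proof.
move=> f2 g2; have sfg : summable (f ^+ 2 + g ^+ 2).
  by apply: summableD; exact/Lp2P.
apply: (summable_dom sfg).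
apply: filterS4 (L0_mulE f g) (L0_addE (f ^+ 2) (g ^+ 2)) (sqrE f) (sqrE g).
move=> x -> -> -> ->; rewrite ler_norml.
have := sqr_ge0 (f x - g x); have := sqr_ge0 (f x + g x).
have := sqr_ge0 (f x); have := sqr_ge0 (g x).
by move=> *; apply/andP; split; nra.
Qed.

Lemma sqr_lin a f g : (a *: f + g) ^+ 2 =
  a ^+ 2 *: (f ^+ 2) + (2 * a *: (f * g) + g ^+ 2).
Proof.
apply/L0_eqP.
apply: filterS5 (sqrE (a *: f + g)) (L0_linE a f g)
  (L0_linE (a ^+ 2) (f ^+ 2) (2 * a *: (f * g) + g ^+ 2))
  (L0_linE (2 * a) (f * g) (g ^+ 2)) (filterI (filterI (sqrE f) (sqrE g)) (L0_mulE f g)).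
by move=> x -> -> -> -> [[-> ->] ->]; ring.
Qed.

Lemma Lp2_lin a f g : Lp 2%:E f -> Lp 2%:E g -> Lp 2%:E (a *: f + g).
Proof.
move=> f2 g2; apply/Lp2P; rewrite sqr_lin; apply: summable_lin; first exact/Lp2P.
by apply: summable_lin; [exact: Lp2_mul|exact/Lp2P].
Qed.

Lemma Lp2_sub f g : Lp 2%:E f -> Lp 2%:E g -> Lp 2%:E (f - g).
Proof. by move=> f2 g2; rewrite addrC -scaleN1r; exact: Lp2_lin. Qed.

Lemma sqr_ge0_ae f : {ae m, forall x, 0 <= (f ^+ 2 : L0) x}.
Proof. by apply: filterS (sqrE f) => x ->; exact: sqr_ge0. Qed.

Lemma intg_sqr_lin A a f g : measurable A -> Lp 2%:E f -> Lp 2%:E g ->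
  intg A ((a *: f + g) ^+ 2) =
  a ^+ 2 * intg A (f ^+ 2) + 2 * a * intg A (f * g) + intg A (g ^+ 2).
Proof.
move=> mA f2 g2; have fg := Lp2_mul f2 g2.
have f22 := (Lp2P _).1 f2; have g22 := (Lp2P _).1 g2.
by rewrite sqr_lin intg_lin// ?intg_lin// ?addrA//; exact: summable_lin.
Qed.

Lemma intg_CS A f g : measurable A -> Lp 2%:E f -> Lp 2%:E g ->
  intg A (f * g) ^+ 2 <= intg A (f ^+ 2) * intg A (g ^+ 2).
Proof.
move=> mA f2 g2; rewrite [leRHS]mulrC; apply: sqr_le_of_quadratic.
  by apply: intg_ge0 => //; exact: sqr_ge0_ae.
move=> t; have : 0 <= intg A ((t *: f + g) ^+ 2).
  by apply: intg_ge0 => //; exact: sqr_ge0_ae.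
by rewrite intg_sqr_lin//; lra.
Qed.

Lemma intg_sqr_le A f : measurable A -> Lp 2%:E f ->
  intg A (f ^+ 2) <= Lp_norm 2%:E f ^+ 2.
Proof.
move=> mA f2; have sf := (Lp2P _).1 f2; rewrite Lp_norm2// -[X in intg X _](setTI A).
rewrite -intg_ind//; apply: le_intg => //; last first.
  apply: filterS3 (L0_mulE (ind A) (f ^+ 2)) (indE mA) (sqr_ge0_ae f).
  move=> x -> -> h; rewrite indicE; case: (_ \in _); by rewrite ?mul1r ?mul0r.
apply: (summable_dom sf).
apply: filterS3 (L0_mulE (ind A) (f ^+ 2)) (indE mA) (sqr_ge0_ae f).
move=> x -> -> h; rewrite indicE ger0_norm; case: (_ \in _); by rewrite ?mul1r ?mul0r.
Qed.

(** Expansion of [g ^+ 2] about [f], with Cauchy-Schwarz for the mixed term. It serves to pass to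
    limits in integrals of squared pointwise norms. *)
Lemma intg_sqr_continuous A f g : measurable A -> Lp 2%:E f -> Lp 2%:E g ->
  `|intg A (g ^+ 2) - intg A (f ^+ 2)| <=
  Lp_norm 2%:E (g - f) ^+ 2 + 2 * (Lp_norm 2%:E (g - f) * Lp_norm 2%:E f).
Proof.
move=> mA f2 g2; set h := g - f.
have h2 : Lp 2%:E h by exact: Lp2_sub.
have -> : g = 1 *: h + f by rewrite scale1r /h subrK.
rewrite intg_sqr_lin// expr1n mul1r mulr1 addrK.
apply: (le_trans (ler_normD _ _)); apply: lerD.
  by rewrite ger0_norm ?intg_sqr_le//; apply: intg_ge0 => //; exact: sqr_ge0_ae.
rewrite normrM normr_nat ler_wpM2l//.
rewrite -ler_sqr ?nnegrE ?mulr_ge0 ?Lp_norm_ge0// exprMn real_normK ?num_real//.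
apply: (le_trans (intg_CS mA h2 f2)).
apply: ler_pM; rewrite ?intg_sqr_le//; apply: intg_ge0 => //; exact: sqr_ge0_ae.
Qed.

Definition absL f : L0 := L0_class m (fun x => `|f x|).

Lemma absLE f : {ae m, forall x, absL f x = `|f x|}.
Proof. by apply: L0_classE; apply: measurableT_comp => //; exact: measurable_L0. Qed.

Lemma summable_abs f : summable f -> summable (absL f).
Proof.
move=> /integrable_norm; apply: ae_integrable; first exact: measurable_L0.
by apply: filterS (absLE f) => x ->.
Qed.

Lemma Lp_norm1_abs f : Lp_norm 1%E f = intg setT (absL f).
Proof.
rewrite /Lp_norm Lnorm1 intg.unlock; apply: ae_Rintegral => //.
  by apply: measurableT_comp => //; exact: measurable_L0.
by apply: filterS (absLE f) => x ->.
Qed.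

Lemma intg_le_norm1 f : summable f -> `|intg setT f| <= Lp_norm 1%E f.
Proof.
by move=> sf; rewrite /Lp_norm Lnorm1 intg.unlock; exact: le_normr_Rintegral.
Qed.

Lemma intg_setC A f : measurable A -> summable f ->
  intg A f + intg (~` A) f = intg setT f.
Proof.
move=> mA sf; have mCA := measurableC mA.
rewrite intg.unlock -Rintegral_setU//.
- by rewrite setUv.
- by rewrite setUv.
- by apply/disj_setPS; rewrite setICr.
Qed.

Lemma intg_set0 f : intg set0 f = 0.
Proof. by rewrite intg.unlock Rintegral_set0. Qed.

End L0_integration.

(** * Essentially bounded functions *)

Section Loo.
Context d (X : measurableType d) (R : realType) (m : {measure set X -> \bar R}).
Implicit Types (f g h : L0 m) (A B : set X).
Local Notation L0 := (L0 m).
Local Notation Loo := (@Lp _ _ _ m +oo%E).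

Lemma Loo_le f : Loo f -> {ae m, forall x, `|f x| <= Lp_norm +oo%E f}.
Proof.
rewrite /Lp/= /finite_norm /Lp_norm unlock; case: ifPn => [m0|m0 _].
  move=> foo; have fe : ess_sup m (abse \o (EFin \o f)) \is a fin_num.
    rewrite ge0_fin_numE//; apply: ess_sup_gee => //; apply: aeW => x /=.
    by rewrite lee_fin.
  apply: filterS (ess_sup_ge m (abse \o (EFin \o f))) => x.
  by rewrite /= -[X in (_ <= X)%E](fineK fe) lee_fin.
(* Here the whole space is null: the [L^oo] norm is 0 by convention, and every property holds almost
   everywhere. *)
exists setT; split => //.
by apply/eqP; rewrite -measure_le0 leNgt.
Qed.

Lemma Loo_norm_le f C : 0 <= C -> {ae m, forall x, `|f x| <= C} ->
  Loo f /\ Lp_norm +oo%E f <= C.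
Proof.
move=> C0 fC; rewrite /Lp/= /finite_norm /Lp_norm unlock; case: ifPn => [m0|m0//].
have sle : (ess_sup m (abse \o (EFin \o f)) <= C%:E)%E.
  by apply/ess_supP; apply: filterS fC => x; rewrite /= lee_fin.
have s0 : (0 <= ess_sup m (abse \o (EFin \o f)))%E.
  by apply: ess_sup_gee => //; apply: aeW => x /=; rewrite lee_fin.
have sy := le_lt_trans sle (ltry C).
split => //; rewrite -[C]/(fine C%:E) fine_le// ge0_fin_numE//.
Qed.

Lemma LooP f : Loo f <-> exists C, {ae m, forall x, `|f x| <= C}.
Proof.
split=> [/Loo_le h|[C fC]]; first by exists (Lp_norm +oo%E f).
apply: (proj1 (@Loo_norm_le f `|C| _ _)) => //.
by apply: filterS fC => x /le_trans; apply; exact: ler_norm.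
Qed.

Lemma Loo_lin a f g : Loo f -> Loo g -> Loo (a *: f + g).
Proof.
move=> /LooP[C fC] /LooP[D gD]; apply/LooP; exists (`|a| * C + D).
apply: filterS3 (L0_linE a f g) fC gD => x -> h1 h2.
by apply: (le_trans (ler_normD _ _)); rewrite normrM lerD// ler_wpM2l.
Qed.

Lemma Loo_mul f g : Loo f -> Loo g -> Loo (f * g).
Proof.
move=> /LooP[C fC] /LooP[D gD]; apply/LooP; exists (C * D).
by apply: filterS3 (L0_mulE f g) fC gD => x -> h1 h2; rewrite normrM ler_pM.
Qed.

Lemma Loo0 : Loo 0.
Proof.
by apply/LooP; exists 0; apply: filterS (L0_zeroE m) => x ->; rewrite normr0.
Qed.

Lemma Loo1 : Loo 1.
Proof.
by apply/LooP; exists 1; apply: filterS (L0_oneE m) => x ->; rewrite normr1.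
Qed.

Lemma Loo_ind A : measurable A -> Loo (ind m A).
Proof.
move=> mA; apply/LooP; exists 1; apply: filterS (indE m mA) => x ->.
by rewrite indicE; case: (_ \in _); rewrite ?normr1 ?normr0.
Qed.

Lemma summable_Loo f g : Loo f -> summable g -> summable (f * g).
Proof.
move=> /Loo_le fC sg; apply: (summable_dom (summableZ (Lp_norm +oo%E f) (summable_abs sg))).
apply: filterS4 (L0_mulE f g) (L0_scaleE (Lp_norm +oo%E f) (absL g)) (absLE g) fC.
by move=> x -> -> -> h; rewrite normrM ler_wpM2r.
Qed.

(** The range [[-C, C]] is cut into half-open intervals of length [e]; [f] is replaced by their left
    ends on the preimages. *)
Lemma Loo_step f e : Loo f -> 0 < e -> exists (B : nat -> set X) (c : nat -> R) n,
  (forall j, measurable (B j)) /\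
  Lp_norm +oo%E (f - \sum_(j < n) c j *: ind m (B j)) <= e.
Proof.
move=> foo e0; have := Loo_le foo; set C := Lp_norm _ _ => fC.
pose B (j : nat) := f @^-1` `[j%:R * e - C, j.+1%:R * e - C[%classic.
pose c (j : nat) := j%:R * e - C.
(* A value of modulus at most [C] lies in the interval of index [truncn ((f x + C) / e)], which is
   below [n]. *)
pose n := (Num.truncn ((C + C) / e)).+1.
have mB j : measurable (B j) by rewrite -[B j]setTI; apply: measurable_L0.
exists B, c, n; split => //.
have sE k : {ae m, forall x,
    (\sum_(j < k) c j *: ind m (B j) : L0) x = \sum_(j < k) c j * \1_(B j) x}.
  elim: k => [|k IH].
    by rewrite big_ord0; apply: filterS (L0_zeroE m) => x ->; rewrite big_ord0.
  rewrite big_ord_recr/= addrC.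
  apply: filterS3 (L0_linE (c k) (ind m (B k)) (\sum_(j < k) c j *: ind m (B j)))
    (indE m (mB k)) IH => x -> -> ->.
  by rewrite big_ord_recr/= addrC.
apply: (proj2 (Loo_norm_le (ltW e0) _)).
apply: filterS3 fC (sE n) (L0_subE f (\sum_(j < n) c j *: ind m (B j))) => x fx.
move=> sx ->; rewrite sx => {sx}.
have fx0 : 0 <= f x + C by move: fx; rewrite ler_norml; lra.
pose j0 := Num.truncn ((f x + C) / e).
have /andP[j01 j02] := truncn_itv (divr_ge0 fx0 (ltW e0)).
move: j01 j02; rewrite -/j0 ler_pdivlMr// ltr_pdivrMr// => j01 j02.
have j0n : (j0 < n)%N.
  rewrite ltnS le_truncn// ler_wpM2r ?invr_ge0 ?(ltW e0)//.
  by rewrite lerD2r (le_trans (ler_norm _)).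
have inB (j : 'I_n) : (x \in B j) = (j == Ordinal j0n).
  apply/idP/eqP => [|->]; last first.
    by rewrite inE /B /= in_itv/=; apply/andP; split; lra.
  rewrite inE /B/= in_itv/= => /andP[h1 h2]; apply/val_inj => /=.
  have : (j%:R : R) < j0.+1%:R by rewrite -(ltr_pM2r e0); lra.
  have : (j0%:R : R) < j.+1%:R by rewrite -(ltr_pM2r e0); lra.
  by rewrite !ltr_nat !ltnS => h3 h4; apply/eqP; rewrite eqn_leq h3 h4.
rewrite (bigD1 (Ordinal j0n))//= big1 => [|j jj].
  have /= := inB (Ordinal j0n); rewrite eqxx indicE => ->.
  rewrite mulr1 addr0 ger0_norm /c; last by lra.
  by move: j02; rewrite -natr1 mulrDl mul1r; lra.
by rewrite indicE inB (negbTE jj) mulr0.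
Qed.

Lemma intg_ge0_ae f : summable f -> (forall A, measurable A -> 0 <= intg A f) ->
  {ae m, forall x, 0 <= f x}.
Proof.
move=> sf f0; pose N := f @^-1` `]-oo, 0[%classic.
have mN : measurable N by rewrite -[N]setTI; exact: measurable_L0.
pose g : L0 := ind m N * f.
have gE : {ae m, forall x, g x = \1_N x * f x}.
  by apply: filterS2 (L0_mulE (ind m N) f) (indE m mN) => x -> ->.
have sg : summable g by exact: summable_Loo (Loo_ind mN) sf.
have s0 := summable0 m.
have g0 : {ae m, forall x, g x <= (0 : L0) x}.
  apply: filterS2 gE (L0_zeroE m) => x -> ->; rewrite indicE.
  have [|_] := boolP (x \in N); last by rewrite mul0r.
  by rewrite inE /N /= in_itv/= mul1r => /ltW.
have /L0_eqP : g = 0.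
  apply: intg_inj => // A mA; apply/eqP; rewrite eq_le le_intg//= intg0//.
  by rewrite intg_ind//; apply: f0; exact: measurableI.
apply: filterS3 gE (L0_zeroE m) => x -> ->; rewrite indicE.
have [_|] := boolP (x \in N); first by rewrite mul1r => ->.
by rewrite notin_setE /N /= in_itv/= => /negP; rewrite -leNgt.
Qed.

End Loo.

HB.lock Definition pin d (X : measurableType d) (R : realType)
    (m : {measure set X -> \bar R}) (V : lmodType R) (q : V -> L0 m) (v w : V) : L0 m :=
  pinner q v w.

(** * Hilbert modules: pointwise inner product and action of [L^oo] *)

Section Hilbert_module.
Context d (X : measurableType d) (R : realType) (m : {measure set X -> \bar R}).
Implicit Types (f g h : L0 m) (A B : set X).
Local Notation L0 := (L0 m).
Local Notation Loo := (@Lp _ _ _ m +oo%E).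
Context (T : completeNormedModType R) (P : set X -> T -> T) (pn : T -> L0).
Implicit Types (v w u : T).

(* [P A] plays the role of the multiplication by the indicator function of [A];
   the multiplication by [L^oo] is recovered from [P] by Riesz representation. *)
Record Hilbert_module : Prop := {
  hm_parallelogram : parallelogram T ;
  hm_linear : forall A a v w, measurable A -> P A (a *: v + w) = a *: P A v + P A w ;
  hm_setI : forall A B v, measurable A -> measurable B -> P (A `&` B) v = P A (P B v) ;
  hm_setT : forall v, P setT v = v ;
  hm_pn_ge0 : forall v, {ae m, forall x, 0 <= pn v x} ;
  hm_pn_L2 : forall v, Lp 2%:E (pn v) ;
  hm_intg : forall A v, measurable A -> intg A (pn v ^+ 2) = `|P A v| ^+ 2 }.

Hypothesis hm : Hilbert_module.
Let para := hm_parallelogram hm.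

Lemma hmD A v w : measurable A -> P A (v + w) = P A v + P A w.
Proof. by move=> mA; have := hm_linear hm 1 v w mA; rewrite !scale1r. Qed.

Lemma hm0 A : measurable A -> P A 0 = 0.
Proof. by move=> mA; have := hmD 0 0 mA; rewrite addr0 -[LHS]addr0 => /addrI. Qed.

Lemma hmZ A a v : measurable A -> P A (a *: v) = a *: P A v.
Proof. by move=> mA; have := hm_linear hm a v 0 mA; rewrite hm0// !addr0. Qed.

Lemma hmB A v w : measurable A -> P A (v - w) = P A v - P A w.
Proof. by move=> mA; rewrite -scaleN1r hmD// hmZ// scaleN1r. Qed.

Lemma summable_pn2 v : summable (pn v ^+ 2).
Proof. exact/Lp2P/(hm_pn_L2 hm). Qed.

Lemma hm_norm v : `|v| = Lp_norm 2%:E (pn v).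
Proof.
apply/eqP; rewrite -(@eqrXn2 _ 2)// ?Lp_norm_ge0// Lp_norm2; last exact: hm_pn_L2.
by rewrite (hm_intg hm)// hm_setT.
Qed.

Lemma hm_set0 v : P set0 v = 0.
Proof.
by apply/eqP; rewrite -normr_eq0 -sqrf_eq0 -(hm_intg hm)// intg_set0.
Qed.

(** Orthogonality of the parts over [A] and over its complement follows from the additivity of the
    integral in [hm_intg], by polarization; the self-adjointness of [P A] is a consequence. *)
Lemma hm_ip_split A v w : measurable A ->
  ip v w = ip (P A v) (P A w) + ip (P (~` A) v) (P (~` A) w).
Proof.
move=> mA; have mCA := measurableC mA.
have N u : `|u| ^+ 2 = `|P A u| ^+ 2 + `|P (~` A) u| ^+ 2.
  by rewrite -!(hm_intg hm)// intg_setC ?summable_pn2// (hm_intg hm)// hm_setT.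
by rewrite /ip (N (v + w)) (N (v - w)) -!(hmD, hmB)//; ring.
Qed.

Lemma hm_ip_proj A v w : measurable A -> ip (P A v) (P A w) = ip (P A v) w.
Proof.
move=> mA; have mCA := measurableC mA.
rewrite (hm_ip_split (P A v) w mA) -!(hm_setI hm)// setIid (setIC _ A) setICr.
by rewrite hm_set0 (ip0l para) addr0.
Qed.

Lemma hm_self_adjoint A v w : measurable A -> ip (P A v) w = ip v (P A w).
Proof.
by move=> mA; rewrite -hm_ip_proj// (ipC (P A v)) hm_ip_proj// ipC.
Qed.

Local Notation pin := (pin pn).

Lemma summable_pin v w : summable (pin v w).
Proof. by rewrite pin.unlock; apply: summableZ; apply: summableB; exact: summable_pn2. Qed.

Lemma intg_pin A v w : measurable A -> intg A (pin v w) = ip (P A v) (P A w).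
Proof.
move=> mA; rewrite pin.unlock /pinner intgZ//; last by apply: summableB; exact: summable_pn2.
rewrite intgB//; [|exact: summable_pn2..].
by rewrite !(hm_intg hm)// hmD// hmB.
Qed.

Lemma intg_pinr A v w : measurable A -> intg A (pin v w) = ip (P A v) w.
Proof. by move=> mA; rewrite intg_pin// hm_ip_proj. Qed.

Lemma pin_linear_l a v w u : pin (a *: v + w) u = a *: pin v u + pin w u.
Proof.
apply: intg_inj => [||A mA]; first exact: summable_pin.
  by apply: summable_lin; exact: summable_pin.
rewrite intg_lin//; [|exact: summable_pin..].
by rewrite !(intg_pin _ _ mA) (hm_linear hm)// (ip_linear_l para).
Qed.

Lemma pinC v w : pin v w = pin w v.
Proof.
apply: intg_inj => [||A mA]; [exact: summable_pin|exact: summable_pin|].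
by rewrite !(intg_pin _ _ mA) ipC.
Qed.

Lemma pin_linear_r a v w u : pin u (a *: v + w) = a *: pin u v + pin u w.
Proof. by rewrite pinC pin_linear_l !(pinC u). Qed.

Lemma pin_vv v : pin v v = pn v ^+ 2.
Proof.
apply: intg_inj => [||A mA]; [exact: summable_pin|exact: summable_pn2|].
by rewrite intg_pin// ipvv (hm_intg hm).
Qed.

Lemma pin_proj A v w : measurable A -> pin (P A v) w = ind m A * pin v w.
Proof.
move=> mA; apply: intg_inj => [||B mB]; first exact: summable_pin.
  by apply: summable_Loo; [exact: Loo_ind|exact: summable_pin].
rewrite intg_ind// (intg_pinr _ _ mB) (intg_pinr _ _ (measurableI _ _ mB mA)).
by rewrite (hm_setI hm).
Qed.

Lemma pn_sqr_lin a v w :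
  pn (a *: v + w) ^+ 2 = a ^+ 2 *: pn v ^+ 2 + (2 * a *: pin v w + pn w ^+ 2).
Proof.
rewrite -!pin_vv pin_linear_l !pin_linear_r (pinC w v).
apply/L0_eqP.
apply: filterS3 (L0_linE a (a *: pin v v + pin v w) (a *: pin v w + pin w w))
   (filterI (L0_linE a (pin v v) (pin v w)) (L0_linE a (pin v w) (pin w w)))
   (filterI (L0_linE (a ^+ 2) (pin v v) (2 * a *: pin v w + pin w w))
     (L0_linE (2 * a) (pin v w) (pin w w))).
by move=> x -> [-> ->] [-> ->]; ring.
Qed.

Lemma pin_CS v w : {ae m, forall x, `|pin v w x| <= pn v x * pn w x}.
Proof.
(* The rationals are enumerated through [unpickle], which turns the condition for all of them into a
   countable intersection; numbers that encode no rational impose nothing. *)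
have : {ae m, forall x, forall k, if @unpickle rat k is Some q then
    0 <= pn v x ^+ 2 + 2 * (ratr q * pin v w x) + ratr q ^+ 2 * pn w x ^+ 2 else true}.
  apply/ae_foralln => k; case: unpickle => [q|]; last exact: aeW.
  have := pn_sqr_lin (ratr q) w v; rewrite pinC => e.
  have := sqr_ge0_ae (pn (ratr q *: w + v)); rewrite e => {e}.
  apply: filterS5 (L0_linE (ratr q ^+ 2) (pn w ^+ 2) (2 * ratr q *: pin v w + pn v ^+ 2))
    (L0_linE (2 * ratr q) (pin v w) (pn v ^+ 2)) (sqrE (pn v)) (sqrE (pn w)).
  by move=> x -> -> -> ->; lra.
apply: filterS3 (hm_pn_ge0 hm v) (hm_pn_ge0 hm w) => x v0 w0 h.
rewrite -ler_sqr ?nnegrE ?mulr_ge0// exprMn real_normK ?num_real//.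
apply: sqr_le_of_quadratic_rat; first exact: sqr_ge0.
by move=> q; have := h (pickle q); rewrite pickleK.
Qed.

Lemma pnD v w : {ae m, forall x, pn (v + w) x <= pn v x + pn w x}.
Proof.
have := pn_sqr_lin 1 v w; rewrite scale1r => /L0_eqP e.
apply: filterS5 e (L0_linE (1 ^+ 2) (pn v ^+ 2) (2 * 1 *: pin v w + pn w ^+ 2))
  (L0_linE (2 * 1) (pin v w) (pn w ^+ 2))
  (filterI (filterI (filterI (sqrE (pn v)) (sqrE (pn w))) (sqrE (pn (v + w)))) (pin_CS v w))
  (filterI (hm_pn_ge0 hm v) (hm_pn_ge0 hm w)) => x h1 h2 h3 [[[e1 e2] e3] cs] [v0 w0].
move: h1; rewrite h2 h3 e1 e2 e3 => h.
have [//|/ltW vw] := leP 0 (pn (v + w) x); last by rewrite (le_trans vw)// addr_ge0.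
move=> vw; rewrite -ler_sqr ?nnegrE ?addr_ge0// h.
by move: cs; rewrite ler_norml; lra.
Qed.

Lemma pnZ a v : {ae m, forall x, pn (a *: v) x = `|a| * pn v x}.
Proof.
have := pn_sqr_lin a v 0; rewrite addr0 => /L0_eqP e.
have p0 : pn 0 ^+ 2 = 0.
  rewrite -pin_vv; have := pin_linear_l 1 0 0 0.
  by rewrite scale1r addr0 scale1r -[LHS]addr0 => /addrI.
have pv0 : pin v 0 = 0.
  have := pin_linear_r 1 0 0 v.
  by rewrite scale1r addr0 scale1r -[LHS]addr0 => /addrI.
move: e; rewrite p0 pv0 scaler0 !addr0 => e.
apply: filterS5 e (L0_scaleE (a ^+ 2) (pn v ^+ 2)) (filterI (sqrE (pn v))
  (sqrE (pn (a *: v)))) (hm_pn_ge0 hm v) (hm_pn_ge0 hm (a *: v)).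
move=> x h1 h2 [h3 h4] v0 av0; apply/eqP.
rewrite -(@eqrXn2 _ 2)?mulr_ge0// exprMn real_normK ?num_real//.
by rewrite -h4 h1 h2 h3.
Qed.

Lemma pn_dist v w : {ae m, forall x, `|pn v x - pn w x| <= pn (v - w) x}.
Proof.
have := pnZ (-1) (v - w); rewrite scaleN1r opprB normrN normr1 => hZ.
have := pnD (v - w) w; rewrite subrK => h1.
have := pnD (w - v) v; rewrite subrK => h2.
apply: filterS3 hZ h1 h2 => x; rewrite mul1r => -> h1 h2.
by rewrite ler_norml; apply/andP; split; lra.
Qed.

Lemma hm_pn_continuous v w : Lp_norm 2%:E (pn v - pn w) <= `|v - w|.
Proof.
have L2 u := hm_pn_L2 hm u.
rewrite -ler_sqr ?nnegrE ?Lp_norm_ge0// Lp_norm2; last exact: Lp2_sub.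
rewrite hm_norm Lp_norm2; last exact: L2.
apply: le_intg => //; [exact/Lp2P/Lp2_sub|exact: summable_pn2|].
apply: filterS4 (sqrE (pn v - pn w)) (sqrE (pn (v - w))) (L0_subE (pn v) (pn w))
  (pn_dist v w) => x -> -> -> h.
by rewrite -real_normK ?num_real// ler_sqr ?nnegrE// (le_trans _ h).
Qed.

Lemma summable_pn_mul v w : summable (pn v * pn w).
Proof. by apply: Lp2_mul; exact: hm_pn_L2. Qed.

Lemma pin_norm1 v w : Lp_norm 1%E (pin v w) <= `|v| * `|w|.
Proof.
rewrite Lp_norm1_abs.
apply: (@le_trans _ _ (intg setT (pn v * pn w))).
  apply: le_intg => //; [exact/summable_abs/summable_pin|exact: summable_pn_mul|].
  by apply: filterS3 (absLE (pin v w)) (L0_mulE (pn v) (pn w)) (pin_CS v w) => x -> ->.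
apply: (le_trans (ler_norm _)).
rewrite -ler_sqr ?nnegrE ?mulr_ge0// exprMn real_normK ?num_real// !hm_norm.
rewrite !Lp_norm2; [|exact: hm_pn_L2..].
by apply: intg_CS => //; exact: hm_pn_L2.
Qed.

Lemma intg_Loo_pin g v w : Loo g ->
  `|intg setT (g * pin v w)| <= Lp_norm +oo%E g * (`|v| * `|w|).
Proof.
move=> goo; have sg := summable_Loo goo (summable_pin v w).
apply: (le_trans (intg_le_norm1 sg)).
apply: (@le_trans _ _ (Lp_norm +oo%E g * Lp_norm 1%E (pin v w))); last first.
  by rewrite ler_wpM2l ?Lp_norm_ge0// pin_norm1.
rewrite !Lp_norm1_abs -intgZ//; last exact/summable_abs/summable_pin.
apply: le_intg => //; [exact: summable_abs|exact/summableZ/summable_abs/summable_pin|].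
apply: filterS5 (absLE (g * pin v w)) (L0_mulE g (pin v w)) (absLE (pin v w))
  (L0_scaleE (Lp_norm +oo%E g) (absL (pin v w))) (Loo_le goo).
by move=> z -> -> e -> h; rewrite e normrM ler_wpM2r.
Qed.

Section action.
Variable act : L0 -> T -> T.

Definition represents_action :=
  forall g v w, Loo g -> ip (act g v) w = intg setT (g * pin v w).

Hypothesis actE : represents_action.

(** Integrated over [A], the projection [P A] moves to [w] by self-adjointness; the defining
    identity of [act] then applies and gives back the indicator of [A] as a factor. *)
Lemma pin_act g v w : Loo g -> pin (act g v) w = g * pin v w.
Proof.
move=> goo; have sg := summable_Loo goo (summable_pin v w).
apply: intg_inj => [||A mA]; [exact: summable_pin|exact: sg|].
rewrite intg_pinr// hm_self_adjoint// actE// pinC pin_proj// pinC.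
rewrite mulrCA intg_ind// setTI//.
Qed.

Lemma pn_act g v : Loo g -> {ae m, forall x, pn (act g v) x = `|g x| * pn v x}.
Proof.
move=> goo; have /L0_eqP e : pn (act g v) ^+ 2 = g * (g * pn v ^+ 2).
  by rewrite -!pin_vv pin_act// pinC pin_act.
apply: filterS5 e (filterI (L0_mulE g (g * pn v ^+ 2)) (L0_mulE g (pn v ^+ 2)))
  (filterI (sqrE (pn v)) (sqrE (pn (act g v)))) (hm_pn_ge0 hm v)
  (hm_pn_ge0 hm (act g v)) => x e [e1 e2] [e3 e4] v0 gv0.
move: e; rewrite e1 e2 e3 e4 => e; apply/eqP.
rewrite -(@eqrXn2 _ 2)?mulr_ge0// exprMn real_normK ?num_real// e.
by rewrite mulrA -expr2.
Qed.

Lemma act_linear_l a f g v : Loo f -> Loo g ->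
  act (a *: f + g) v = a *: act f v + act g v.
Proof.
move=> foo goo; apply: (ip_inj para) => w.
rewrite actE ?(ip_linear_l para) ?actE//; last exact: Loo_lin.
rewrite -intg_lin//; [|by apply: summable_Loo => //; exact: summable_pin..].
congr intg; apply/L0_eqP.
apply: filterS5 (L0_mulE (a *: f + g) (pin v w)) (L0_linE a f g)
  (L0_linE a (f * pin v w) (g * pin v w)) (L0_mulE f (pin v w)) (L0_mulE g (pin v w)).
by move=> x -> -> -> -> ->; ring.
Qed.

Lemma act_linear_r a f v w : Loo f -> act f (a *: v + w) = a *: act f v + act f w.
Proof.
move=> foo; apply: (ip_inj para) => u.
rewrite actE// (ip_linear_l para) !actE// pin_linear_l.
rewrite -intg_lin//; [|by apply: summable_Loo => //; exact: summable_pin..].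
congr intg; apply/L0_eqP.
apply: filterS5 (L0_mulE f (a *: pin v u + pin w u)) (L0_linE a (pin v u) (pin w u))
  (L0_linE a (f * pin v u) (f * pin w u)) (L0_mulE f (pin v u)) (L0_mulE f (pin w u)).
by move=> x -> -> -> -> ->; ring.
Qed.

Lemma act_mul f g v : Loo f -> Loo g -> act (f * g) v = act f (act g v).
Proof.
move=> foo goo; apply: (ip_inj para) => u.
by rewrite !actE//; [rewrite pin_act// mulrA|exact: Loo_mul].
Qed.

Lemma act1 v : act 1 v = v.
Proof.
apply: (ip_inj para) => u; rewrite actE; last exact: Loo1.
by rewrite mul1r intg_pinr// hm_setT.
Qed.

Lemma act_ind A v : measurable A -> act (ind m A) v = P A v.
Proof.
move=> mA; apply: (ip_inj para) => u; rewrite actE; last exact: Loo_ind.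
by rewrite intg_ind// setTI intg_pinr.
Qed.

Lemma act_norm g v : Loo g -> `|act g v| <= Lp_norm +oo%E g * `|v|.
Proof.
move=> goo; set C := Lp_norm _ _; have C0 : 0 <= C by exact: Lp_norm_ge0.
rewrite -ler_sqr ?nnegrE ?mulr_ge0// exprMn !hm_norm !Lp_norm2; [|exact: hm_pn_L2..].
rewrite -intgZ ?summable_pn2//; apply: le_intg => //.
- exact: summable_pn2.
- exact/summableZ/summable_pn2.
- apply: filterS5 (sqrE (pn (act g v))) (L0_scaleE (C ^+ 2) (pn v ^+ 2)) (sqrE (pn v))
    (pn_act v goo) (Loo_le goo) => x -> -> -> -> h.
  by rewrite exprMn ler_wpM2r ?sqr_ge0// ler_sqr ?nnegrE.
Qed.

Lemma Hilbert_module_normed : Lp_normed_module 2%:E (fun v : T => `|v|) act pn.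
Proof.
split.
- exists T, (idfun : {linear T -> T}); split => //; exact: (Bijective (g := id)).
- exact: act_linear_l.
- exact: act_linear_r.
- exact: act_mul.
- exact: act1.
- exact: hm_pn_L2.
- exact: hm_pn_ge0.
- by move=> f v; exact: pn_act.
- exact: hm_norm.
Qed.

End action.

Lemma action_exists : exists act, represents_action act.
Proof.
have /choice[a aP] : forall p : L0 * T, exists u, Loo p.1 ->
    forall w, ip u w = intg setT (p.1 * pin p.2 w).
  move=> [g v] /=; have [goo|ng] := pselect (Loo g); last by exists 0.
  have sg w := summable_Loo goo (summable_pin v w).
  have [|x|w wE] := @Riesz_representation R T (fun w => intg setT (g * pin v w))
    (Lp_norm +oo%E g * `|v|) para.
  - move=> b x y; rewrite -intg_lin//; congr intg.
    rewrite pin_linear_r; apply/L0_eqP.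
    apply: filterS5 (L0_mulE g (b *: pin v x + pin v y)) (L0_linE b (pin v x) (pin v y))
      (L0_linE b (g * pin v x) (g * pin v y)) (L0_mulE g (pin v x)) (L0_mulE g (pin v y)).
    by move=> z -> -> -> -> ->; ring.
  - by rewrite -mulrA; exact: intg_Loo_pin.
  - by exists w.
by exists (fun g v => a (g, v)) => g v w goo; exact: aP (g, v) goo w.
Qed.

End Hilbert_module.

(** * Identification of a Hilbert module with its dual *)

Section dual_module.
Context d (X : measurableType d) (R : realType) (m : {measure set X -> \bar R}).
Implicit Types (f g h : L0 m) (A B : set X).
Local Notation L0 := (L0 m).
Local Notation Loo := (@Lp _ _ _ m +oo%E).
Context (T : completeNormedModType R) (P : set X -> T -> T) (pn : T -> L0).
Context (act : L0 -> T -> T).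
Implicit Types (v w u : T) (L : dual act).
Hypothesis hm : Hilbert_module P pn.
Hypothesis actE : represents_action pn act.
Let para := hm_parallelogram hm.
Local Notation pin := (pin pn).
Local Notation dual_pn := (dual_pn pn).

Lemma flat_subproof v : pin v \in dual_pred act.
Proof.
apply/asboolP; split.
- by move=> a w u; exact: (pin_linear_r hm).
- by move=> w; exact/Lp1P/(summable_pin hm).
- by exists `|v| => w; exact: (pin_norm1 hm).
- by move=> f w foo; rewrite (pinC hm) (pin_act hm actE)// (pinC hm).
Qed.

(** The map [v |-> <v, .>]. It turns out to be the only [sharp] that satisfies
    [is_Riesz_isomorphism]. *)
Definition flat v : dual act := Dual (flat_subproof v).

Lemma flat_linear a v w : flat (a *: v + w) = a *: flat v + flat w.
Proof. by apply/val_inj/funext => u; exact: (pin_linear_l hm). Qed.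

Lemma flat_inj : injective flat.
Proof.
move=> v w vw; apply: (ip_inj para) => u.
have e z : ip z u = intg setT (flat z u).
  by rewrite (intg_pinr hm)// (hm_setT hm).
by rewrite !e vw.
Qed.

(** The vector that represents [v |-> \int L(v)] determines [L(v)] itself: replacing [v] by [1_A v]
    and using the [L^oo]-linearity of [L] yields the integral of [L(v)] over every [A]. *)
Lemma flat_surj L : exists v, flat v = L.
Proof.
have /asboolP[lin l1 [C bC] loo] := valP L.
have sL v : summable (L v) := (Lp1P _).1 (l1 v).
have [||w wE] := @Riesz_representation R T (fun v => intg setT (L v)) C para.
- by move=> a v w; rewrite lin intg_lin; rewrite ?sL.
- by move=> v; apply: (le_trans (intg_le_norm1 (sL v))); exact: bC.
exists w; apply/val_inj/funext => v /=.
apply: intg_inj => [||A mA]; [exact: (summable_pin hm)|exact: sL|].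
rewrite (intg_pinr hm)// (hm_self_adjoint hm)// -wE -(act_ind hm actE)//.
by rewrite loo ?intg_ind ?setTI//; exact: Loo_ind.
Qed.

Lemma esssup_unique (S : set L0) g : is_esssup S g -> esssup S = g.
Proof.
move=> Sg; apply: xget_unique => // g' Sg'; apply/L0_eqP.
have [ub lub] := Sg; have [ub' lub'] := Sg'.
by apply: filterS2 (lub _ ub') (lub' _ ub) => x h1 h2; apply/eqP; rewrite eq_le h1 h2.
Qed.

(** The test vector is [v] divided by the maximum of [|v|] and [e]: the cutoff keeps the factor in
    [L^oo], and where [|v| >= e] the result is [v / |v|]. *)
Lemma pn_normalize v e : 0 < e -> exists w, {ae m, forall x, pn w x <= 1} /\
  {ae m, forall x, e <= pn v x -> pin v w x = pn v x}.
Proof.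
move=> e0; pose phi : L0 := L0_class m (fun x => Num.max (pn v x) e `^ (-1)).
have phiE : {ae m, forall x, phi x = (Num.max (pn v x) e)^-1}.
  have mphi : measurable_fun setT (fun x => Num.max (pn v x) e `^ (-1)).
    apply: (measurableT_comp (measurable_powR (-1))).
    by apply: measurable_maxr => //; exact: measurable_L0.
  apply: filterS (L0_classE m mphi) => x ->.
  by rewrite powR_inv1// le_max (ltW e0) orbT.
have mx x : 0 < Num.max (pn v x) e by rewrite lt_max e0 orbT.
have phioo : Loo phi.
  apply/LooP; exists e^-1; apply: filterS phiE => x ->.
  by rewrite gtr0_norm ?invr_gt0// lef_pV2 ?posrE// le_max lexx orbT.
exists (act phi v); split.
  apply: filterS2 (pn_act hm actE v phioo) phiE => x -> ->.
  by rewrite gtr0_norm ?invr_gt0// ler_pdivrMl// mulr1 le_max lexx.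
have -> : pin v (act phi v) = phi * pn v ^+ 2.
  by rewrite (pinC hm) (pin_act hm actE)// (pin_vv hm).
apply: filterS3 (L0_mulE phi (pn v ^+ 2)) phiE (sqrE (pn v)) => x -> -> -> ev.
by rewrite (max_idPl ev) expr2 mulrA mulVf ?mul1r// gt_eqF// (lt_le_trans e0).
Qed.

(** That [pn v] is an upper bound is Cauchy-Schwarz. Any other upper bound dominates [pn v] where
    [pn v >= 1 / (n + 1)], by the normalized test vectors, and these sets exhaust the region where
    [pn v] is positive; elsewhere its nonnegativity suffices. *)
Lemma dual_pn_flat v : dual_pn (flat v) = pn v.
Proof.
apply: esssup_unique; split=> [_ [w w1 ->]|g' ub].
  apply: filterS4 (absLE (pin v w)) (pin_CS hm v w) w1 (hm_pn_ge0 hm v).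
  by move=> x -> /le_trans h w1 v0; apply: h; rewrite ler_piMr.
have /choice[w wP] (n : nat) := @pn_normalize v n.+1%:R^-1
  (ltac:(by rewrite invr_gt0)).
have all n : {ae m, forall x, (n.+1%:R^-1 <= pn v x -> pn v x <= g' x) /\ 0 <= g' x}.
  have [w1 wv] := wP n.
  have g0 : {ae m, forall x, absL (pin v (w n)) x <= g' x} by apply: ub; exists (w n).
  apply: filterS3 g0 (absLE (pin v (w n))) wv => x gx e h.
  rewrite e in gx; split; last exact: le_trans gx.
  by move=> /h vx; rewrite -vx (le_trans _ gx)// ler_norm.
apply: filterS2 (ae_foralln all) (hm_pn_ge0 hm v) => x h v0.
have [vx|] := ltP 0 (pn v x); last by move=> /le_trans; apply; case: (h 0%N).
apply: (h (Num.truncn (pn v x)^-1)).1.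
by rewrite invf_ple ?posrE// ltW// truncnS_gt.
Qed.

Lemma dual_norm_flat v : dual_norm (flat v) = `|v|.
Proof.
have ub (w : T) : `|w| <= 1 -> Lp_norm 1%E (pin v w) <= `|v|.
  by move=> w1; apply: (le_trans (pin_norm1 hm v w)); rewrite ler_piMr.
rewrite /dual_norm; set S := (X in sup X); have S0 : S (Lp_norm 1%E (pin v 0)).
  by exists 0 => //=; rewrite normr0.
have hS : has_sup S by split; [eexists; exact: S0|exists `|v| => _ [w w1 <-]; exact: ub].
apply/eqP; rewrite eq_le; apply/andP; split.
  by apply: ge_sup => [|_ [w w1 <-]]; [case: hS|exact: ub].
case: (eqVneq v 0) => [v0|vN0].
  by rewrite {1}v0 normr0; apply: (le_trans (Lp_norm_ge0 _ _) (sup_upper_bound hS S0)).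
(* The supremum is attained here: the integral of [<v, w>] is already [|v|]. *)
pose w := `|v|^-1 *: v.
have vp : 0 < `|v| by rewrite normr_gt0.
have Sw : S (Lp_norm 1%E (pin v w)).
  exists w => //=; rewrite /w normrZ normfV normr_id mulVf// gt_eqF//.
apply: le_trans (sup_upper_bound hS Sw).
apply: le_trans (intg_le_norm1 (summable_pin hm v w)).
rewrite (intg_pinr hm)// (hm_setT hm) /w ipC (ipZl para) ipvv expr2 mulrA.
by rewrite mulVf ?mul1r ?normr_id// gt_eqF.
Qed.

Lemma dual_act_flat f v : Loo f -> dual_act f (flat v) = flat (act f v).
Proof.
move=> foo; apply/val_inj.
have e : (fun w => f * flat v w) = flat (act f v) :> (T -> L0).
  by apply/funext => w; rewrite /= (pin_act hm actE).
by rewrite /dual_act e insubdK//; exact: flat_subproof.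
Qed.

Lemma flat_Riesz : is_Riesz_isomorphism pn flat.
Proof.
split; first exact: flat_linear.
  have /choice[u uK] := flat_surj.
  by exists u => // v; apply: flat_inj; rewrite uK.
move=> v L; have [w <-] := flat_surj L.
rewrite /pinner -(scaleN1r (flat w)) (addrC (flat v)) (addrC (flat v)) -flat_linear.
have -> : flat w + flat v = flat (v + w).
  by rewrite -[flat w]scale1r -flat_linear scale1r addrC.
rewrite !dual_pn_flat scaleN1r (addrC _ v).
by have := pinC hm v w; rewrite {1}pin.unlock.
Qed.

(** If [sharp v = flat w], pairing with [flat u] gives [<u, v> = <u, w>] for all [u]. This reduces
    every statement on [sharp] to one on [flat]. *)
Lemma Riesz_isomorphism_unique sharp : is_Riesz_isomorphism pn sharp -> sharp = flat.
Proof.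
move=> [_ _ sE]; have [_ _ fE] := flat_Riesz.
apply/funext => v; have [w wv] := flat_surj (sharp v).
rewrite -wv; congr flat; apply: (ip_inj para) => u.
have : flat u v = flat u w by rewrite -sE -fE wv.
move=> /(congr1 (intg setT)); rewrite /= !(pinC hm u) !(intg_pinr hm)// !(hm_setT hm).
by [].
Qed.

(** Every clause is transported from [T] along the bijection [flat]; in particular [T] itself is the
    Banach space isometric to the dual. *)
Lemma dual_normed_module : Lp_normed_module 2%:E (@dual_norm _ _ _ _ T act)
  (@dual_act _ _ _ _ T act) dual_pn.
Proof.
split.
- have /choice[u uK] := flat_surj.
  have Ku : cancel flat u by move=> v; apply: flat_inj; rewrite uK.
  have ul : linear u by move=> a L L'; apply: flat_inj; rewrite flat_linear !uK.
  pose ul' := GRing.isLinear.Build R (dual act) T *:%R u ul.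
  pose phi : {linear dual act -> T} := HB.pack u ul'.
  exists T, phi; split; first by exists flat.
  by move=> L; rewrite -{1}(uK L) dual_norm_flat.
- move=> a f g L foo goo; have [v <-] := flat_surj L.
  rewrite !dual_act_flat//; last exact: Loo_lin.
  by rewrite (act_linear_l hm actE)// flat_linear.
- move=> a f L L' foo; have [v <-] := flat_surj L; have [w <-] := flat_surj L'.
  by rewrite -flat_linear !dual_act_flat// (act_linear_r hm actE)// flat_linear.
- move=> f g L foo goo; have [v <-] := flat_surj L.
  by rewrite !dual_act_flat//; [rewrite (act_mul hm actE)|exact: Loo_mul].
- move=> L; have [v <-] := flat_surj L.
  by rewrite dual_act_flat ?(act1 hm actE)//; exact: Loo1.
- by move=> L; have [v <-] := flat_surj L; rewrite dual_pn_flat; exact: (hm_pn_L2 hm).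
- by move=> L; have [v <-] := flat_surj L; rewrite dual_pn_flat; exact: (hm_pn_ge0 hm).
- move=> f L foo; have [v <-] := flat_surj L.
  by rewrite dual_act_flat// !dual_pn_flat; exact: (pn_act hm actE).
- move=> L; have [v <-] := flat_surj L.
  by rewrite dual_norm_flat dual_pn_flat; exact: (hm_norm hm).
Qed.

End dual_module.

(** * Energy measures *)

Section energy.
Context (R : realType) (M : ptopologicalType).
Local Notation X := (g_sigma_algebraType (@open M)).
Context (m : {sigma_finite_measure set X -> \bar R}).
Local Notation L0 := (L0 m).
Context (F : set L0) (E : L0 -> L0 -> R) (mu : L0 -> L0 -> {charge set X -> \bar R}).
Hypothesis E_form : Dirichlet_form F E.
Hypothesis mu_energy : energy_measure F E mu.
Hypothesis E_carre : carre_du_champ F mu.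
Implicit Types (f g h : L0) (A B : set X).
Local Notation Fe := (Fe F E).

Lemma dom_sub f g : F f -> F g -> F (f - g).
Proof. by move=> Ff Fg; rewrite addrC -scaleN1r; exact: (dom_lin E_form). Qed.

Lemma form_sqr_lin a f g : F f -> F g ->
  E (a *: f + g) (a *: f + g) = a ^+ 2 * E f f + 2 * a * E f g + E g g.
Proof.
move=> Ff Fg; have Fl := dom_lin E_form a Ff Fg.
rewrite (form_linear E_form)// (form_sym E_form Ff Fl) (form_sym E_form Fg Fl).
by rewrite !(form_linear E_form)// (form_sym E_form Fg Ff); ring.
Qed.

Lemma form_lin_le a f g : F f -> F g ->
  E (a *: f + g) (a *: f + g) <= 2 * (a ^+ 2 * E f f) + 2 * E g g.
Proof.
move=> Ff Fg; have := form_ge0 E_form (dom_lin E_form (- a) Ff Fg).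
by rewrite !form_sqr_lin// sqrrN; lra.
Qed.

Lemma approximates_lin a u v f g : approximates F E u f -> approximates F E v g ->
  approximates F E (fun n => a *: u n + v n) (a *: f + g).
Proof.
move=> [Fu cu uf] [Fv cv vg]; split.
- by move=> n; exact: (dom_lin E_form).
(* By [form_lin_le], the tolerances [e / (2 * D)] and [e / 4] contribute at most half of [e] each;
   the [1] in [D] covers the case [a = 0]. *)
- move=> e e0; pose D := 2 * a ^+ 2 + 1.
  have D0 : 0 < D by rewrite ltr_wpDl// mulr_ge0// sqr_ge0.
  have [N1 h1] := cu (e / (2 * D)) (divr_gt0 e0 (mulr_gt0 (ltr0Sn R 1) D0)).
  have [N2 h2] := cv (e / 4) (divr_gt0 e0 (ltr0Sn R 3)).
  exists (maxn N1 N2) => n k; rewrite !geq_max => /andP[n1 n2] /andP[k1 k2].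
  have -> : a *: u n + v n - (a *: u k + v k) = a *: (u n - u k) + (v n - v k).
    by rewrite scalerBr opprD addrACA.
  apply: (le_lt_trans (form_lin_le _ (dom_sub (Fu _) (Fu _)) (dom_sub (Fv _) (Fv _)))).
  have := h2 n k n2 k2; have := h1 n k n1 k1.
  have := form_ge0 E_form (dom_sub (Fu n) (Fu k)).
  move: (E _ _) (E _ _) => x y x0; rewrite ltr_pdivlMr ?mulr_gt0// /D => h3 h4.
  lra.
- have ul : {ae m, forall x, forall n,
      (a *: u n + v n : L0) x = a * u n x + v n x}.
    by apply/ae_foralln => n; exact: L0_linE.
  apply: filterS4 ul uf vg (L0_linE a f g) => x ul uf vg ->.
  under eq_fun do rewrite ul.
  by apply: cvgD => //; apply: cvgM => //; exact: cvg_cst.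
Qed.

Lemma Fe_lin a f g : Fe f -> Fe g -> Fe (a *: f + g).
Proof.
move=> [u uf] [v vg]; exists (fun n => a *: u n + v n).
exact: approximates_lin.
Qed.

Lemma Fe0 : Fe 0.
Proof.
exists (fun=> 0); split => [n|e e0|].
- exact: (dom0 E_form).
- exists 0%N => n k _ _; rewrite subr0.
  have := form_linear E_form 1 (dom0 E_form) (dom0 E_form) (dom0 E_form).
  rewrite scale1r addr0 mul1r => /eqP; rewrite -subr_eq0 opprD addNKr oppr_eq0.
  by move=> /eqP ->.
- by apply: aeW => x; exact: cvg_cst.
Qed.

Lemma FeD f g : Fe f -> Fe g -> Fe (f + g).
Proof. by move=> Ff Fg; rewrite -(scale1r f); exact: Fe_lin. Qed.

Lemma FeZ a f : Fe f -> Fe (a *: f).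
Proof. by move=> Ff; rewrite -[_ *: _]addr0; apply: Fe_lin => //; exact: Fe0. Qed.

Lemma FeB f g : Fe f -> Fe g -> Fe (f - g).
Proof. by move=> Ff Fg; rewrite addrC -scaleN1r; exact: Fe_lin. Qed.

Definition nu f g A : R := fine (mu f g A).

Lemma EFin_nu f g A : measurable A -> (nu f g A)%:E = mu f g A.
Proof. by move=> mA; rewrite fineK// fin_num_measure. Qed.

Lemma nu_lin_l a f g h A : Fe f -> Fe g -> Fe h -> measurable A ->
  nu (a *: f + g) h A = a * nu f h A + nu g h A.
Proof.
move=> Ff Fg Fh mA; apply: EFin_inj; rewrite EFinD EFinM !EFin_nu//.
exact: (em_linear mu_energy).
Qed.

Lemma nuC f g A : Fe f -> Fe g -> measurable A -> nu f g A = nu g f A.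
Proof. by move=> Ff Fg mA; rewrite /nu (em_sym mu_energy). Qed.

Lemma nu_lin_r a f g h A : Fe f -> Fe g -> Fe h -> measurable A ->
  nu h (a *: f + g) A = a * nu h f A + nu h g A.
Proof.
by move=> Ff Fg Fh mA; rewrite !(nuC Fh)//; [rewrite nu_lin_l|exact: Fe_lin].
Qed.

Lemma nu_ge0 f A : Fe f -> measurable A -> 0 <= nu f f A.
Proof. by move=> Ff mA; rewrite -lee_fin EFin_nu//; exact: (em_ge0 mu_energy). Qed.

Lemma nu_sqr_lin a f g A : Fe f -> Fe g -> measurable A ->
  nu (a *: f + g) (a *: f + g) A =
  a ^+ 2 * nu f f A + 2 * a * nu f g A + nu g g A.
Proof.
move=> Ff Fg mA; have Fl := Fe_lin a Ff Fg.
by rewrite nu_lin_l// !nu_lin_r// (nuC Fg Ff)//; ring.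
Qed.

Lemma nu_parallelogram f g A : Fe f -> Fe g -> measurable A ->
  nu (f + g) (f + g) A + nu (f - g) (f - g) A = 2 * (nu f f A + nu g g A).
Proof.
move=> Ff Fg mA; have := nu_sqr_lin 1 Fg Ff mA; have := nu_sqr_lin (-1) Fg Ff mA.
by rewrite scale1r scaleN1r !(addrC _ f) => -> ->; ring.
Qed.

Lemma nu0l g A : Fe g -> measurable A -> nu 0 g A = 0.
Proof.
move=> Fg mA; have := nu_lin_l 1 Fe0 Fe0 Fg mA.
rewrite scale1r addr0 mul1r => /eqP; rewrite -subr_eq0 opprD addNKr oppr_eq0.
by move=> /eqP.
Qed.

Lemma nuZ a f A : Fe f -> measurable A -> nu (a *: f) (a *: f) A = a ^+ 2 * nu f f A.
Proof.
move=> Ff mA; have := nu_sqr_lin a Ff Fe0 mA.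
by rewrite !addr0 (nuC Ff Fe0)// !nu0l// ?mulr0 ?addr0//; exact: Fe0.
Qed.

Lemma nu_CS f g A : Fe f -> Fe g -> measurable A ->
  nu f g A ^+ 2 <= nu f f A * nu g g A.
Proof.
move=> Ff Fg mA; rewrite [leRHS]mulrC; apply: sqr_le_of_quadratic; first exact: nu_ge0.
by move=> t; have := nu_ge0 (Fe_lin t Ff Fg) mA; rewrite nu_sqr_lin//; lra.
Qed.

Lemma nu_set0 f g : nu f g set0 = 0.
Proof. by rewrite /nu charge0. Qed.

Lemma nuU f g A B : measurable A -> measurable B ->
  nu f g A = nu f g (A `&` B) + nu f g (A `&` ~` B).
Proof.
move=> mA mB; have mCB := measurableC mB.
apply: EFin_inj; rewrite EFinD !EFin_nu//; [|exact: measurableI..].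
rewrite -chargeU//; [by rewrite -setIUr setUv setIT|exact: measurableI..|].
by rewrite setIACA setICr setI0.
Qed.

(** Absolute continuity is given on [F]; it passes to the extended domain because [em_approx] is
    convergence on each Borel set, null sets included. *)
Lemma mu_dominated f : Fe f -> mu f f `<< m.
Proof.
move=> [u uf]; apply/null_content_dominatesP => A mA mA0.
have := em_approx mu_energy uf uf mA.
have -> : (fun n => mu (u n) (u n) A) = cst 0%E.
  apply/funext => n; have [Fu _ _] := uf.
  by have /null_content_dominatesP := E_carre (Fu n); apply.
by move=> h; rewrite -(cvg_lim _ h)//; exact: lim_cst.
Qed.

Lemma GammaE f : Fe f -> {ae m, forall x, Gamma mu f f x = fine (Radon_Nikodym (mu f f) m x)}.
Proof.
move=> Ff; apply: L0_classE; apply: measurableT_comp => //.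
exact/measurable_int/Radon_Nikodym_integrable/mu_dominated.
Qed.

Lemma Gamma_summable f : Fe f -> summable (Gamma mu f f).
Proof.
move=> Ff; have domf := mu_dominated Ff.
apply: (@ae_integrable _ _ _ _ (fine \o Radon_Nikodym (mu f f) m)).
- exact: measurable_L0.
- by apply: filterS (GammaE Ff) => x ->.
- have -> : EFin \o (fine \o Radon_Nikodym (mu f f) m) = Radon_Nikodym (mu f f) m.
    by apply/funext => x /=; rewrite fineK// Radon_Nikodym_fin_num.
  exact: Radon_Nikodym_integrable.
Qed.

Lemma intg_Gamma f A : Fe f -> measurable A -> intg A (Gamma mu f f) = nu f f A.
Proof.
move=> Ff mA; have domf := mu_dominated Ff.
apply: EFin_inj; rewrite EFin_intg ?Gamma_summable// EFin_nu//.
rewrite (Radon_Nikodym_integral domf mA); apply: ae_eq_integral => //.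
- by apply/measurable_EFinP/measurable_funTS; exact: measurable_L0.
- exact/measurable_funTS/measurable_int/Radon_Nikodym_integrable.
- apply: filterS (GammaE Ff) => x -> _; rewrite fineK// Radon_Nikodym_fin_num//.
Qed.

Lemma Gamma_ge0 f : Fe f -> {ae m, forall x, 0 <= Gamma mu f f x}.
Proof.
move=> Ff; apply: intg_ge0_ae; first exact: Gamma_summable.
by move=> A mA; rewrite intg_Gamma//; exact: nu_ge0.
Qed.

End energy.

(** * Operations on [Pcm] and their energies *)

Section pieces.
Context (R : realType) (M : ptopologicalType).
Local Notation X := (g_sigma_algebraType (@open M)).
Context (m : {sigma_finite_measure set X -> \bar R}).
Local Notation L0 := (L0 m).
Context (F : set L0) (E : L0 -> L0 -> R) (mu : L0 -> L0 -> {charge set X -> \bar R}).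
Hypothesis E_form : Dirichlet_form F E.
Hypothesis mu_energy : energy_measure F E mu.
Hypothesis E_carre : carre_du_champ F mu.
Implicit Types (f g h : L0) (A : set X) (B : nat -> set X) (x y : piece m).
Local Notation Fe := (Fe F E).
Local Notation Pcm := (Pcm F E mu).
Local Notation pcm_norm2 := (pcm_norm2 mu).
Local Notation mu_ge0 := (em_ge0 mu_energy).

Lemma mu0 A : measurable A -> mu 0 0 A = 0%E.
Proof.
by move=> mA; rewrite -EFin_nu// (nu0l E_form mu_energy)//; exact: Fe0 E_form.
Qed.

Lemma mu_sum_partition f A B : Fe f -> measurable A -> Borel_partition B ->
  (\sum_(0 <= j <oo) mu f f (A `&` B j) = mu f f A)%E.
Proof.
move=> Ff mA [mB tB cB].
have := @charge_semi_sigma_additive _ _ _ (mu f f) (fun j => A `&` B j).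
rewrite -setI_bigcupr cB setIT => h; apply: cvg_lim => //; apply: h => //.
- by move=> j; exact: measurableI.
- exact: trivIset_setIl.
Qed.

(** All terms are nonnegative, so the series may be rearranged along [pickle]; numbers outside its
    range carry [set0] and contribute 0. *)
Lemma pcm_norm2_pairs (f : nat -> nat -> L0) (A : nat -> nat -> set X) :
  (forall i j, Fe (f i j)) -> (forall i j, measurable (A i j)) ->
  (pcm_norm2 (pcm_pairs f A) =
   \sum_(0 <= i <oo) \sum_(0 <= j <oo) mu (f i j) (f i j) (A i j))%E.
Proof.
move=> Ff mA; rewrite /pcm_norm2.
have t0 i j : (0 <= mu (f i j) (f i j) (A i j))%E by exact: mu_ge0.
pose t n := mu ((pcm_pairs f A).1 n) ((pcm_pairs f A).1 n) ((pcm_pairs f A).2 n).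
have tE p : t (pickle p) = mu (f p.1 p.2) (f p.1 p.2) (A p.1 p.2).
  by rewrite /t /pcm_pairs /= pickleK_inv; case: p.
have tN n : ~ range (@pickle (nat * nat)%type) n -> t n = 0%E.
  rewrite /t /pcm_pairs /=; case e : pickle_inv => [[i j]|] nr; last by rewrite charge0.
  by exfalso; apply: nr; exists (i, j) => //; have := @pickle_invK (nat * nat)%type n; rewrite e.
have tge0 n : (0 <= t n)%E.
  have [[p _ <-]|/tN ->//] := pselect (range (@pickle (nat * nat)%type) n).
  by rewrite tE.
rewrite nneseries_esumT//.
transitivity (\esum_(n in range (@pickle (nat * nat)%type)) t n)%E.
  rewrite [RHS]esum_mkcond; apply: eq_esum => n _; case: ifPn => //.
  by rewrite notin_setE => /tN.
rewrite esum_image; last by move=> p q _ _; exact: (pcan_inj pickleK_inv).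
rewrite nneseries_esumT; last by move=> i; exact: nneseries_ge0.
under [RHS]eq_esum => i _ do rewrite nneseries_esumT//.
rewrite (@esum_esum _ _ _ setT (fun=> setT) (fun i j => mu (f i j) (f i j) (A i j)))//.
have -> : [set: nat] `*`` (fun=> [set: nat]) = [set: nat * nat] by apply/seteqP; split.
by apply: eq_esum => p _; rewrite tE.
Qed.

Lemma Borel_partition_pairs (f : nat -> nat -> L0) (A B : nat -> set X) :
  Borel_partition A -> Borel_partition B ->
  Borel_partition (pcm_pairs f (fun i j => A i `&` B j)).2.
Proof.
move=> [mA tA cA] [mB tB cB]; split.
- by move=> n; rewrite /pcm_pairs /=; case: pickle_inv => [[i j]|]//; exact: measurableI.
- move=> n k _ _ [z []]; rewrite /pcm_pairs /=.
  case en : pickle_inv => [[i j]|]//; case ek : pickle_inv => [[i' j']|]// [Ai Bj] [Ai' Bj'].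
  have := @pickle_invK (nat * nat)%type n; have := @pickle_invK (nat * nat)%type k.
  rewrite en ek /= => <- <-; congr (pickle (_, _)).
    by apply: tA => //; exists z.
  by apply: tB => //; exists z.
- rewrite -subTset => z _.
  have [i _ Ai] : (\bigcup_i A i) z by rewrite cA.
  have [j _ Bj] : (\bigcup_j B j) z by rewrite cB.
  by exists (pickle (i, j)) => //; rewrite /pcm_pairs /= pickleK_inv.
Qed.

Lemma Pcm_partition x : Pcm x -> Borel_partition x.2. Proof. by case. Qed.
Lemma Pcm_Fe x i : Pcm x -> Fe (x.1 i). Proof. by case. Qed.
Lemma Pcm_measurable x i : Pcm x -> measurable (x.2 i). Proof. by case=> -[]. Qed.

Lemma Fe_pairs (f : nat -> nat -> L0) (A : nat -> nat -> set X) n :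
  (forall i j, Fe (f i j)) -> Fe ((pcm_pairs f A).1 n).
Proof.
by move=> Ff; rewrite /pcm_pairs /=; case: pickle_inv => [[i j]|]//; exact: Fe0 E_form.
Qed.

Lemma mu_add_le f g A : Fe f -> Fe g -> measurable A ->
  (mu (f + g)%R (f + g)%R A <= 2%:E * (mu f f A + mu g g A))%E.
Proof.
move=> Ff Fg mA; have FB := FeB E_form Ff Fg; have FD := FeD E_form Ff Fg.
rewrite -!EFin_nu// -EFinD -EFinM lee_fin.
have := nu_parallelogram E_form mu_energy Ff Fg mA.
by have := nu_ge0 mu_energy FB mA; lra.
Qed.

(** Together with [pcm_norm2_refine_r], this brings two families to the common refinement of their
    partitions, where sums can be compared termwise. *)
Lemma pcm_norm2_refine_l x B : Pcm x -> Borel_partition B ->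
  (\sum_(0 <= i <oo) \sum_(0 <= j <oo) mu (x.1 i) (x.1 i) (x.2 i `&` B j) =
   pcm_norm2 x)%E.
Proof.
move=> Px pB; apply: eq_eseriesr => i _; apply: mu_sum_partition => //.
  exact: Pcm_Fe.
exact: Pcm_measurable.
Qed.

Lemma pcm_norm2_refine_r x B : Pcm x -> Borel_partition B ->
  (\sum_(0 <= i <oo) \sum_(0 <= j <oo) mu (x.1 j) (x.1 j) (B i `&` x.2 j) =
   pcm_norm2 x)%E.
Proof.
move=> Px pB; have mB i : measurable (B i) by case: pB.
rewrite nneseries_interchange.
  by under eq_eseriesr do under eq_eseriesr do rewrite setIC; exact: pcm_norm2_refine_l.
move=> i j; apply: mu_ge0; first exact: Pcm_Fe.
by apply: measurableI => //; exact: Pcm_measurable.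
Qed.

Lemma pcm_norm2_add x y : Pcm x -> Pcm y ->
  (pcm_norm2 (pcm_add x y) = \sum_(0 <= i <oo) \sum_(0 <= j <oo)
     mu (x.1 i + y.1 j)%R (x.1 i + y.1 j)%R (x.2 i `&` y.2 j))%E.
Proof.
move=> Px Py; apply: pcm_norm2_pairs => i j.
  by apply: (FeD E_form); exact: Pcm_Fe.
by apply: measurableI; exact: Pcm_measurable.
Qed.

(** The energy is finite because [mu_add_le] applies on each set of the common refinement. *)
Lemma Pcm_add x y : Pcm x -> Pcm y -> Pcm (pcm_add x y).
Proof.
move=> Px Py.
have FD i j : Fe (x.1 i + y.1 j) by apply: (FeD E_form); exact: Pcm_Fe.
have Fx i := Pcm_Fe i Px; have Fy i := Pcm_Fe i Py.
have mI i j : measurable (x.2 i `&` y.2 j) by apply: measurableI; exact: Pcm_measurable.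
split.
- by apply: Borel_partition_pairs; exact: Pcm_partition.
- by move=> n; exact: Fe_pairs.
rewrite pcm_norm2_add//.
apply: (@le_lt_trans _ _ (2%:E * (pcm_norm2 x + pcm_norm2 y))%E); last first.
  have [_ _ xy] := Px; have [_ _ yy] := Py.
  by apply: lte_mul_pinfty => //; rewrite lte_add_pinfty.
rewrite -(pcm_norm2_refine_l Px (Pcm_partition Py)).
rewrite -(pcm_norm2_refine_r Py (Pcm_partition Px)).
have mu0 (h : L0) i j : Fe h -> (0 <= mu h h (x.2 i `&` y.2 j))%E.
  by move=> Fh; exact: mu_ge0.
rewrite -nneseriesD; last 2 first.
- by move=> i _ _; apply: nneseries_ge0 => j _ _; exact: mu0.
- by move=> i _ _; apply: nneseries_ge0 => j _ _; exact: mu0.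
rewrite -nneseriesZl; last first.
  move=> i _; apply: adde_ge0; apply: nneseries_ge0 => j _ _; exact: mu0.
apply: lee_nneseries => [i _ _|i _].
  by apply: nneseries_ge0 => j _ _; exact: mu0.
rewrite -nneseriesD//; last 2 first.
- by move=> j _ _; exact: mu0.
- by move=> j _ _; exact: mu0.
rewrite -nneseriesZl; last by move=> j _; apply: adde_ge0; exact: mu0.
apply: lee_nneseries => [j _ _|j _]; first exact: mu0.
exact: mu_add_le.
Qed.

Lemma muZ a f A : Fe f -> measurable A -> mu (a *: f) (a *: f) A = ((a ^+ 2)%:E * mu f f A)%E.
Proof.
move=> Ff mA; rewrite -!EFin_nu//; rewrite -EFinM (nuZ E_form mu_energy)//.
Qed.

Lemma pcm_norm2_scale a x : Pcm x ->
  pcm_norm2 (pcm_scale a x) = ((a ^+ 2)%:E * pcm_norm2 x)%E.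
Proof.
move=> Px; have mx i := Pcm_measurable i Px; have Fx i := Pcm_Fe i Px.
rewrite /pcm_norm2 -nneseriesZl; last by move=> i _; exact: mu_ge0.
by apply: eq_eseriesr => i _; rewrite /= muZ.
Qed.

Lemma Pcm_scale a x : Pcm x -> Pcm (pcm_scale a x).
Proof.
move=> Px; have [pB Fx ny] := Px; split => //.
  by move=> i; exact: (FeZ E_form).
by rewrite pcm_norm2_scale// lte_mul_pinfty ?lee_fin ?sqr_ge0.
Qed.

Lemma pcm_norm2_mul B c x : Pcm x -> Borel_partition B ->
  (pcm_norm2 (pcm_mul B c x) = \sum_(0 <= i <oo) \sum_(0 <= j <oo)
     mu (c j *: x.1 i)%R (c j *: x.1 i)%R (x.2 i `&` B j))%E.
Proof.
move=> Px [mB _ _]; apply: pcm_norm2_pairs => i j.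
  by apply: (FeZ E_form); exact: Pcm_Fe.
by apply: measurableI => //; exact: Pcm_measurable.
Qed.

Lemma Pcm_mul B c x n : Pcm x -> simple_partition B n -> Pcm (pcm_mul B c x).
Proof.
move=> Px [pB B0]; have [mB _ _] := pB.
have mx i := Pcm_measurable i Px; have Fx i := Pcm_Fe i Px.
split.
- by apply: Borel_partition_pairs => //; exact: Pcm_partition.
- by move=> k; apply: Fe_pairs => i j; exact: (FeZ E_form).
rewrite pcm_norm2_mul//.
(* [C] dominates each [c j ^+ 2] with [j < n]; the remaining [B j] are empty. *)
pose C := \sum_(j < n) c j ^+ 2.
have C0 : 0 <= C by apply: sumr_ge0 => j _; exact: sqr_ge0.
have mI i j : measurable (x.2 i `&` B j) by exact: measurableI.
have m0 (h : L0) i j : Fe h -> (0 <= mu h h (x.2 i `&` B j))%E.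
  by move=> Fh; exact: mu_ge0.
have Fc j i : Fe (c j *: x.1 i) by exact: (FeZ E_form).
apply: (@le_lt_trans _ _ (C%:E * pcm_norm2 x)%E); last first.
  by have [_ _ xy] := Px; exact: lte_mul_pinfty.
rewrite -(pcm_norm2_refine_l Px pB) -nneseriesZl; last first.
  by move=> i _; apply: nneseries_ge0 => j _ _; exact: m0.
apply: lee_nneseries => [i _ _|i _].
  by apply: nneseries_ge0 => j _ _; exact: m0.
rewrite -nneseriesZl; last by move=> j _; exact: m0.
apply: lee_nneseries => [j _ _|j _]; first exact: m0.
have [jn|nj] := ltnP j n; last by rewrite B0// setI0 !charge0 mule0.
rewrite muZ//; apply: lee_wpmul2r; first exact: m0.
rewrite lee_fin /C (bigD1 (Ordinal jn))//= lerDl.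
by apply: sumr_ge0 => k _; exact: sqr_ge0.
Qed.

(** Termwise on the common refinement. By density this is the source of the inner product on every
    cotangent module. *)
Lemma pcm_norm2_parallelogram x y : Pcm x -> Pcm y ->
  (pcm_norm2 (pcm_add x y) + pcm_norm2 (pcm_add x (pcm_scale (-1) y)) =
   2%:E * (pcm_norm2 x + pcm_norm2 y))%E.
Proof.
move=> Px Py; have PNy := Pcm_scale (-1) Py; have pBy := Pcm_partition Py.
have Fx i := Pcm_Fe i Px; have Fy i := Pcm_Fe i Py.
have mI i j : measurable (x.2 i `&` y.2 j) by apply: measurableI; exact: Pcm_measurable.
have FD i j : Fe (x.1 i + y.1 j) by exact: (FeD E_form).
have FB i j : Fe (x.1 i - y.1 j) by exact: (FeB E_form).
have m0 h i j : Fe h -> (0 <= mu h h (x.2 i `&` y.2 j))%E by move=> Fh; exact: mu_ge0.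
rewrite !pcm_norm2_add//= -(pcm_norm2_refine_l Px pBy).
rewrite -(pcm_norm2_refine_r Py (Pcm_partition Px)).
under [X in (_ + X)%E]eq_eseriesr do under eq_eseriesr do rewrite scaleN1r.
rewrite -nneseriesD; [|by move=> i _ _; apply: nneseries_ge0 => j _ _; exact: m0..].
rewrite -nneseriesD; [|by move=> i _ _; apply: nneseries_ge0 => j _ _; exact: m0..].
rewrite -nneseriesZl; last by move=> i _; apply: adde_ge0; apply: nneseries_ge0 => j _ _; exact: m0.
apply: eq_eseriesr => i _.
rewrite -nneseriesD; [|by move=> j _ _; exact: m0..].
rewrite -nneseriesD; [|by move=> j _ _; exact: m0..].
rewrite -nneseriesZl; last by move=> j _; rewrite adde_ge0// m0.
apply: eq_eseriesr => j _; rewrite -!EFin_nu// -!EFinD -EFinM.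
by rewrite (nu_parallelogram E_form mu_energy).
Qed.

Lemma Pcm_single f : Fe f -> Pcm (pcm_single f).
Proof.
move=> Ff; split.
- split.
  + by move=> [|i] /=.
  + by move=> [|i] [|j] _ _ [z []].
  + by rewrite -subTset => z _; exists 0%N.
- by move=> [|i] //=; exact: Fe0 E_form.
- rewrite /pcm_norm2 nneseries_recl//; last first.
    by move=> [|i] _ //=; [exact: mu_ge0|rewrite charge0].
  rewrite eseries0 ?adde0 /=; first by rewrite -EFin_nu// ltry.
  by move=> [|i] //= _ _; rewrite charge0.
Qed.

(** The function of the family that is in force at the point [p]. It allows equivalences between
    families to be checked point by point, without the numbering of pairs. *)
Definition piece_at x (p : X) f := exists2 i, x.2 i p & x.1 i = f.

Lemma pcm_equiv_at x y : Pcm x -> Pcm y ->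
  (forall p f g, piece_at x p f -> piece_at y p g -> f = g) -> pcm_equiv mu x y.
Proof.
move=> Px Py h i j.
have [->|/set0P[p [xp yp]]] := eqVneq (x.2 i `&` y.2 j) set0; first by rewrite charge0.
have -> : x.1 i = y.1 j by apply: (h p); [exists i|exists j].
by rewrite subrr mu0//; apply: measurableI; exact: Pcm_measurable.
Qed.

Lemma piece_at_pairs (f : nat -> nat -> L0) (A : nat -> nat -> set X) p h :
  piece_at (pcm_pairs f A) p h -> exists i j, A i j p /\ f i j = h.
Proof.
by move=> [n]; rewrite /pcm_pairs/=; case: pickle_inv => [[i j]|]// ? <-; exists i, j.
Qed.

Lemma piece_at_unique x p f g : Pcm x -> piece_at x p f -> piece_at x p g -> f = g.
Proof.
move=> [[_ tx _] _ _] [i ip <-] [j jp <-]; congr (x.1 _).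
by apply: tx => //; exists p.
Qed.

Lemma piece_at_add x y p h : piece_at (pcm_add x y) p h ->
  exists f g, [/\ piece_at x p f, piece_at y p g & f + g = h].
Proof.
move=> /piece_at_pairs[i [j [[xp yp] <-]]]; exists (x.1 i), (y.1 j).
by split => //; [exists i|exists j].
Qed.

Lemma piece_at_mul B c x p h : piece_at (pcm_mul B c x) p h ->
  exists f j, [/\ piece_at x p f, B j p & c j *: f = h].
Proof.
by move=> /piece_at_pairs[i [j [[xp Bp] <-]]]; exists (x.1 i), j; split => //; exists i.
Qed.

Lemma piece_at_scale a x p h : piece_at (pcm_scale a x) p h ->
  exists2 f, piece_at x p f & a *: f = h.
Proof. by move=> [i xp <-]; exists (x.1 i) => //; exists i. Qed.

Lemma piece_at_single f p h : piece_at (pcm_single f) p h -> f = h.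
Proof. by move=> [[|i]]. Qed.

End pieces.

(** * The pointwise norm on [Pcm] *)

Section piece_norm.
Context (R : realType) (M : ptopologicalType).
Local Notation X := (g_sigma_algebraType (@open M)).
Context (m : {sigma_finite_measure set X -> \bar R}).
Local Notation L0 := (L0 m).
Context (F : set L0) (E : L0 -> L0 -> R) (mu : L0 -> L0 -> {charge set X -> \bar R}).
Hypothesis E_form : Dirichlet_form F E.
Hypothesis mu_energy : energy_measure F E mu.
Hypothesis E_carre : carre_du_champ F mu.
Implicit Types (f g h : L0) (A : set X) (B : nat -> set X) (x y : piece m).
Local Notation Fe := (Fe F E).
Local Notation Pcm := (Pcm F E mu).
Local Notation pcm_norm2 := (pcm_norm2 mu).
Local Notation pcm_pn := (pcm_pn mu).
Local Notation mu_ge0 := (em_ge0 mu_energy).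

(** Disjointness of the partition leaves a single term of the series at each point. *)
Lemma pcm_pn_at x : Pcm x -> {ae m, forall p, forall i, x.2 i p ->
  pcm_pn x p = Num.sqrt (Gamma mu (x.1 i) (x.1 i) p)}.
Proof.
move=> Px; have [[mx tx cx] _ _] := Px.
pose t i p := \1_(x.2 i) p * Num.sqrt (Gamma mu (x.1 i) (x.1 i) p).
have t0 i p : (0 <= (t i p)%:E)%E by rewrite lee_fin mulr_ge0// sqrtr_ge0.
have mt i : measurable_fun setT (t i).
  apply: measurable_funM; first exact: measurable_indic.
  apply: (measurableT_comp (continuous_measurable_fun (@sqrt_continuous R))).
  exact: measurable_L0.
have mpn : measurable_fun setT (fun p => fine (\sum_(0 <= i <oo) (t i p)%:E)%E).
  apply: (@measurableT_comp _ _ _ _ _ _ (@fine R)) => //.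
  by apply: ge0_emeasurable_sum => // i _; exact/measurable_EFinP.
apply: filterS (L0_classE m mpn) => p -> i xi.
rewrite nneseries_esumT//.
rewrite (@esumID _ _ [set i])// !setTI.
rewrite esum_set1// esum1 ?adde0; first by rewrite /t indicE mem_set// mul1r.
move=> j /= ji; rewrite /t indicE memNset ?mul0r// => xj; apply: ji.
by apply: (tx j i I I); exists p.
Qed.

Lemma pcm_pn_ge0 x : Pcm x -> {ae m, forall p, 0 <= pcm_pn x p}.
Proof.
move=> Px; have [[mx tx cx] _ _] := Px.
apply: filterS (pcm_pn_at Px) => p h.
have [i _ xi] : (\bigcup_i x.2 i) p by rewrite cx.
by rewrite (h i xi) sqrtr_ge0.
Qed.

Lemma integral_pcm_pn x A : Pcm x -> measurable A ->
  (\int[m]_(p in A) ((pcm_pn x ^+ 2 : L0) p)%:E =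
   \sum_(0 <= i <oo) mu (x.1 i) (x.1 i) (A `&` x.2 i))%E.
Proof.
move=> Px mA; have [[mx tx cx] Fx _] := Px.
have mg : measurable_fun setT (fun p => (pcm_pn x p ^+ 2)%:E).
  by apply/measurable_EFinP/measurable_funX; exact: measurable_L0.
have mI i : measurable (A `&` x.2 i) by exact: measurableI.
have -> : (\int[m]_(p in A) ((pcm_pn x ^+ 2 : L0) p)%:E =
    \int[m]_(p in A) (pcm_pn x p ^+ 2)%:E)%E.
  apply: ae_eq_integral => //.
  - by apply/measurable_EFinP/measurable_funTS; exact: measurable_L0.
  - exact: measurable_funTS.
  - by apply: filterS (sqrE (pcm_pn x)) => p -> _.
have {1}-> : A = \bigcup_i (A `&` x.2 i) by rewrite -setI_bigcupr cx setIT.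
rewrite ge0_integral_bigcup//; last 3 first.
- exact: measurable_funTS.
- by move=> p _; rewrite lee_fin sqr_ge0.
- exact: trivIset_setIl.
apply: eq_eseriesr => i _.
rewrite -EFin_nu// -(intg_Gamma mu_energy E_carre)// EFin_intg//; last first.
  exact: (Gamma_summable mu_energy E_carre).
apply: ae_eq_integral => //.
- exact: measurable_funTS.
- by apply/measurable_EFinP/measurable_funTS; exact: measurable_L0.
- apply: filterS2 (pcm_pn_at Px) (Gamma_ge0 mu_energy E_carre (Fx i)).
  by move=> p h G0 [_ xi]; rewrite /= (h i xi) sqr_sqrtr.
Qed.

Lemma pcm_pn_L2 x : Pcm x -> Lp 2%:E (pcm_pn x).
Proof.
move=> Px; apply/Lp2P/integrableP; split.
  by apply/measurable_EFinP; exact: measurable_L0.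
have [_ _ fin] := Px; apply: le_lt_trans fin.
rewrite (_ : (\int[m]_p _ = \int[m]_p ((pcm_pn x ^+ 2 : L0) p)%:E)%E); last first.
  apply: ae_eq_integral => //.
  - apply: measurableT_comp => //.
    by apply/measurable_EFinP; exact: measurable_L0.
  - by apply/measurable_EFinP; exact: measurable_L0.
  - by apply: filterS (sqr_ge0_ae (pcm_pn x)) => p h _; rewrite /= ger0_norm.
rewrite integral_pcm_pn// /pcm_norm2.
by under eq_eseriesr do rewrite setTI.
Qed.

Lemma intg_pcm_pn x A : Pcm x -> measurable A ->
  ((intg A (pcm_pn x ^+ 2))%:E =
   \sum_(0 <= i <oo) mu (x.1 i) (x.1 i) (A `&` x.2 i))%E.
Proof.
move=> Px mA; rewrite EFin_intg//; last exact/Lp2P/pcm_pn_L2.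
exact: integral_pcm_pn.
Qed.

Lemma pcm_pn_single f : Fe f ->
  {ae m, forall p, pcm_pn (pcm_single f) p = Num.sqrt (Gamma mu f f p)}.
Proof.
move=> Ff; have Ps := Pcm_single E_form mu_energy Ff.
by apply: filterS (pcm_pn_at Ps) => p h; rewrite (h 0%N).
Qed.

End piece_norm.

(** * From cotangent modules to Hilbert modules *)

Section cotangent.
Context (R : realType) (M : ptopologicalType).
Local Notation X := (g_sigma_algebraType (@open M)).
Context (m : {sigma_finite_measure set X -> \bar R}).
Local Notation L0 := (L0 m).
Local Notation Loo := (@Lp _ _ _ m +oo%E).
Context (F : set L0) (E : L0 -> L0 -> R) (mu : L0 -> L0 -> {charge set X -> \bar R}).
Hypothesis E_form : Dirichlet_form F E.
Hypothesis mu_energy : energy_measure F E mu.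
Hypothesis E_carre : carre_du_champ F mu.
Implicit Types (f g h : L0) (A : set X) (B : nat -> set X) (x y : piece m).
Local Notation Fe := (Fe F E).
Local Notation Pcm := (Pcm F E mu).
Local Notation pcm_norm2 := (pcm_norm2 mu).
Local Notation pcm_pn := (pcm_pn mu).
Local Notation mu_ge0 := (em_ge0 mu_energy).

(** The partition into [A] and its complement, padded with empty sets: with [ind_values] it presents
    [1_A] as a simple function in the format of [act_simple]. *)
Definition ind_sets (A : set X) (j : nat) : set X :=
  if j is 0 then A else if j is 1 then ~` A else set0.

Definition ind_values (j : nat) : R := (j == 0)%:R.

Lemma ind_simple A : measurable A -> ind m A = simple_class m (ind_sets A) ind_values 2.
Proof.
move=> mA; congr L0_class; apply/funext => p.
by rewrite big_ord_recl big_ord1 /ind_values /= mulr1 mulr0 addr0.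
Qed.

Lemma ind_sets_simple A : measurable A -> simple_partition (ind_sets A) 2.
Proof.
move=> mA; split; last by move=> [|[|j]].
split.
- by move=> [|[|j]] //=; exact: measurableC.
- by move=> [|[|i]] [|[|j]] _ _ [z []].
- rewrite -subTset => z _; have [Az|Az] := pselect (A z); first by exists 0%N.
  by exists 1%N.
Qed.

Definition restr A x : piece m := pcm_mul (ind_sets A) ind_values x.

Lemma Pcm_restr A x : measurable A -> Pcm x -> Pcm (restr A x).
Proof.
move=> mA Px.
exact (Pcm_mul E_form mu_energy ind_values Px (ind_sets_simple mA)).
Qed.

Lemma piece_at_restr A x p h : piece_at (restr A x) p h ->
  exists2 f, piece_at x p f & \1_A p *: f = h.
Proof.
move=> /piece_at_mul[f [[|[|j]] [xf Ap <-]]]; exists f => //; rewrite indicE.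
  by rewrite mem_set.
by rewrite memNset.
Qed.

Lemma pcm_norm2_restr A x : measurable A -> Pcm x ->
  (pcm_norm2 (restr A x) = \sum_(0 <= i <oo) mu (x.1 i) (x.1 i) (A `&` x.2 i))%E.
Proof.
move=> mA Px; have [[mB tB cB] B0] := ind_sets_simple mA.
have mI i j : measurable (x.2 i `&` ind_sets A j).
  by apply: measurableI => //; exact: Pcm_measurable Px.
have Fx i := Pcm_Fe i Px.
rewrite (pcm_norm2_mul E_form mu_energy ind_values Px (ind_sets_simple mA).1).
apply: eq_eseriesr => i _; rewrite nneseries_recl//; last first.
  by move=> j _; apply: mu_ge0 => //; exact: (FeZ E_form).
rewrite [X in (_ + X)%E]eseries0 => [|[//|j] _ _]; last first.
  by rewrite (muZ E_form mu_energy)// /ind_values /= expr0n mul0e.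
by rewrite adde0 /ind_values /= scale1r setIC.
Qed.

Context (T : completeNormedModType R) (iota : piece m -> T).
Context (act : L0 -> T -> T) (pn : T -> L0).
Implicit Types v w : T.
Hypothesis cm : cotangent_module F E mu iota act pn.

Let P A v := act (ind m A) v.

Let aD : approximable (iota @` Pcm).
Proof. exact/dense_approximable/(iota_dense cm). Qed.

Let P_iota A x : measurable A -> Pcm x -> P A (iota x) = iota (restr A x).
Proof.
move=> mA Px; rewrite /P ind_simple//.
by rewrite (act_simple cm _ (ind_sets_simple mA))//.
Qed.

Let P_lin A a v w : measurable A -> P A (a *: v + w) = a *: P A v + P A w.
Proof. by move=> mA; apply: (act_linearr cm); exact: Loo_ind. Qed.

Let P_dist A v w : measurable A -> `|P A v - P A w| <= 1 * `|v - w|.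
Proof.
move=> mA; have -> : P A v - P A w = P A (v - w).
  by rewrite (addrC v) -(scaleN1r w) P_lin// scaleN1r addrC.
apply: (le_trans (act_bounded cm (v - w) (Loo_ind m mA))); rewrite ler_wpM2r//.
apply: (proj2 (Loo_norm_le _ _)) => //.
apply: filterS (indE m mA) => p ->; rewrite indicE.
by case: (_ \in _); rewrite ?normr1 ?normr0.
Qed.

Let iota_eq x y : Pcm x -> Pcm y ->
  (forall p f g, piece_at x p f -> piece_at y p g -> f = g) -> iota x = iota y.
Proof.
by move=> Px Py h; apply/(iota_equiv cm) => //; exact: (pcm_equiv_at E_form mu_energy).
Qed.

Let cotangent_parallelogram : parallelogram T.
Proof.
apply: (parallelogram_dense aD) => _ _ [x Px <-] [y Py <-].
have PNy := Pcm_scale E_form mu_energy (-1) Py.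
have Pa := Pcm_add E_form mu_energy Px Py.
have Ps := Pcm_add E_form mu_energy Px PNy.
have -> : iota x - iota y = iota (pcm_add x (pcm_scale (-1) y)).
  by rewrite (iota_add cm)// (iota_scale cm)// scaleN1r.
rewrite -(iota_add cm)// !(iota_norm cm)//.
have fin z : Pcm z -> pcm_norm2 z \is a fin_num.
  move=> Pz; have [_ Fz zy] := Pz; rewrite ge0_fin_numE//.
  by apply: nneseries_ge0 => i _ _; apply: mu_ge0 => //; exact: Pcm_measurable Pz.
rewrite -fineD ?fin// (pcm_norm2_parallelogram E_form mu_energy)//.
by rewrite fineM ?fin_numD ?fin// fineD ?fin.
Qed.

Let P_setI A A' v : measurable A -> measurable A' -> P (A `&` A') v = P A (P A' v).
Proof.
move=> mA mA'; have mI := measurableI _ _ mA mA'.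
suff -> : P (A `&` A') = P A \o P A' by [].
apply: (approximable_eq aD (C := 1)) => [u w|u w|_ [x Px <-]]; first exact: P_dist.
  (* Both sides are 1-Lipschitz, so it is enough to compare them on the classes of [Pcm]. *)
  by apply: (le_trans (P_dist _ _ mA)); rewrite mul1r; exact: P_dist.
have PR := Pcm_restr mA' Px.
rewrite /= !P_iota//; apply: iota_eq; [exact: Pcm_restr|exact: Pcm_restr|].
move=> p f g /piece_at_restr[f1 xf1 <-] /piece_at_restr[_ /piece_at_restr[f2 xf2 <-] <-].
by rewrite (piece_at_unique Px xf1 xf2) scalerA indicI.
Qed.

Let P_setT v : P setT v = v.
Proof.
suff -> : P setT = id by [].
apply: (approximable_eq aD (C := 1)) => [u w|u w|_ [x Px <-]]; first exact: P_dist.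
  by rewrite mul1r.
rewrite P_iota//; apply: iota_eq => //; first exact: Pcm_restr.
move=> p f g /piece_at_restr[f1 xf1 <-] xg.
by rewrite (piece_at_unique Px xf1 xg) indicE in_setT scale1r.
Qed.

Let P_intg_iota A x : measurable A -> Pcm x ->
  intg A (pn (iota x) ^+ 2) = `|P A (iota x)| ^+ 2.
Proof.
move=> mA Px; have PR := Pcm_restr mA Px.
rewrite P_iota// (iota_norm cm)// pcm_norm2_restr// (pn_iota cm)//.
by rewrite -(intg_pcm_pn mu_energy E_carre).
Qed.

Lemma pn_approx v (e : R) : 0 < e -> exists x,
  [/\ Pcm x, `|v - iota x| < e & Lp_norm 2%:E (pn (iota x) - pn v) < e].
Proof.
move=> e0; have /nbhs_ballP[r /= r0 rP] := pn_continuous cm v e0.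
have [|_ [x Px <-] vx] := aD v (e := Num.min r e); first by rewrite lt_min r0.
move: vx; rewrite lt_min => /andP[vr ve]; exists x; split => //.
by apply: rP; rewrite -ball_normE.
Qed.

Let P_intg A v : measurable A -> intg A (pn v ^+ 2) = `|P A v| ^+ 2.
Proof.
move=> mA; apply/eqP; rewrite -subr_eq0 -normr_le0.
apply/ler_addgt0Pl => e e0; rewrite addr0.
pose N := Lp_norm 2%:E (pn v); have N0 : 0 <= N by exact: Lp_norm_ge0.
(* The two errors below are at most [e' * (1 + 2 * N)] and [e' * (1 + 2 * |v|)], with sum [e' * C];
   requiring [e' <= 1] absorbs the squares of small terms. *)
pose C := 2 + 2 * N + 2 * `|v|; have C0 : 0 < C.
  by rewrite ltr_wpDr ?mulr_ge0// ltr_wpDr ?mulr_ge0.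
pose e' := Num.min 1 (e / C).
have e'0 : 0 < e' by rewrite lt_min ltr01 divr_gt0.
have [x [Px vx pnx]] := pn_approx v e'0.
have L2 := pn_L2 cm.
have h1 := intg_sqr_continuous mA (L2 v) (L2 (iota x)).
have h2 := P_dist v (iota x) mA.
have h3 := P_dist v 0 mA.
rewrite mul1r in h2.
have P0 : P A 0 = 0.
  have := P_lin 1 0 0 mA; rewrite !scale1r addr0 -[LHS]addr0 => /addrI.
  by move=> /esym.
rewrite P0 !subr0 mul1r in h3.
rewrite P_intg_iota// in h1.
have e'1 : e' <= 1 by rewrite /e' ge_min lexx.
have e'C : e' * C <= e.
  by rewrite -ler_pdivlMr// /e' ge_min lexx orbT.
have h4 : `| `|P A (iota x)| ^+ 2 - `|P A v| ^+ 2| <= e' * (1 + 2 * `|v|).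
  rewrite subr_sqr normrM; apply: ler_pM => //.
    by apply: (le_trans (ler_dist_dist _ _)); rewrite distrC (le_trans h2)// ltW.
  rewrite ger0_norm ?addr_ge0//.
  have : `|P A (iota x)| <= `|P A v| + e'.
    rewrite -[P A (iota x)](subrK (P A v)) addrC (le_trans (ler_normD _ _))//.
    by rewrite lerD2l distrC (le_trans h2)// ltW.
  by move: h3 e'1; lra.
have h5 : Lp_norm 2%:E (pn (iota x) - pn v) ^+ 2 +
    2 * (Lp_norm 2%:E (pn (iota x) - pn v) * N) <= e' * (1 + 2 * N).
  have q0 := Lp_norm_ge0 2%:E (pn (iota x) - pn v).
  move: q0 pnx; move: (Lp_norm _ _) => q q0 qe; nra.
rewrite -(subrKA (`|P A (iota x)| ^+ 2)) (le_trans (ler_normD _ _))//.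
rewrite distrC; apply: (le_trans (lerD (le_trans h1 h5) h4)).
by apply: le_trans e'C; rewrite /C; lra.
Qed.

(** Nonnegativity is inherited by [L^2] limits: since [pn (iota x)] is nonnegative, the negative
    part of [pn v] is at most the distance between [pn v] and [pn (iota x)], which can be made
    small. *)
Let pn_ge0 v : {ae m, forall p, 0 <= pn v p}.
Proof.
pose neg : L0 := L0_class m (fun p => Num.max (- pn v p) 0).
have mneg : measurable_fun setT (fun p => Num.max (- pn v p) 0).
  have mN : measurable_fun setT (\- (pn v : X -> R)).
    by apply: measurableT_comp => //; exact: measurable_L0.
  by apply: (measurable_maxr mN); exact: measurable_cst.
have negE := L0_classE m mneg.
have L2 := pn_L2 cm.
have neg2 : summable (neg ^+ 2).
  apply: (summable_dom (g := pn v ^+ 2)); first exact/Lp2P.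
  apply: filterS3 (sqrE neg) (sqrE (pn v)) negE => p -> -> ->.
  rewrite ger0_norm ?sqr_ge0// -[leRHS]sqrrN; case: (leP 0 (- pn v p)) => h; first by [].
  by rewrite expr0n sqr_ge0.
have n0 : intg setT (neg ^+ 2) = 0.
  apply/eqP; rewrite eq_le; apply/andP; split; last first.
    by apply: intg_ge0 => //; exact: sqr_ge0_ae.
  apply/ler_addgt0Pl => e e0; rewrite addr0.
  (* A norm below both 1 and [e] has a square below [e]. *)
  have e'0 : 0 < Num.min 1 e by rewrite lt_min ltr01.
  have [x [Px vx pnx]] := pn_approx v e'0.
  have dL2 : Lp 2%:E (pn (iota x) - pn v) by exact: Lp2_sub.
  apply: (@le_trans _ _ (Lp_norm 2%:E (pn (iota x) - pn v) ^+ 2)).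
    rewrite Lp_norm2//; apply: le_intg => //; first exact/Lp2P.
    have := pcm_pn_ge0 Px; rewrite -(pn_iota cm)// => px.
    apply: filterS5 px (sqrE neg) (sqrE (pn (iota x) - pn v)) negE
      (L0_subE (pn (iota x)) (pn v)) => p px -> -> -> ->.
    case: (leP 0 (- pn v p)) => h; last by rewrite expr0n sqr_ge0.
    rewrite ler_sqr ?nnegrE//; last by rewrite addr_ge0.
    by rewrite lerDr.
  move: pnx; rewrite lt_min => /andP[p1 pe].
  apply: (le_trans _ (ltW pe)); rewrite expr2 ler_piMl ?Lp_norm_ge0// ltW//.
have /L0_eqP : neg ^+ 2 = 0.
  apply: intg_inj => [//||A mA]; first exact: summable0.
  rewrite intg0//; apply/eqP; rewrite eq_le intg_ge0//; last exact: sqr_ge0_ae.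
  rewrite andbT -n0 -[A in intg A _]setTI -intg_ind//.
  have mi := summable_Loo (Loo_ind m mA) neg2.
  apply: le_intg => //.
  apply: filterS3 (L0_mulE (ind m A) (neg ^+ 2)) (indE m mA) (sqr_ge0_ae neg).
  by move=> p -> -> h; rewrite indicE; case: (_ \in _); rewrite ?mul1r ?mul0r.
apply: filterS4 (sqrE neg) negE (L0_zeroE m) => p -> -> ->.
move=> /eqP; rewrite sqrf_eq0 => /eqP; case: (leP 0 (- pn v p)) => h; last first.
  by move: h; rewrite oppr_lt0 => /ltW.
by move=> /eqP; rewrite oppr_eq0 => /eqP ->.
Qed.

Lemma cotangent_Hilbert_module : Hilbert_module P pn.
Proof.
by split => //; exact: (pn_L2 cm).
Qed.

Let hm := cotangent_Hilbert_module.
Local Notation pin := (pin pn).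

(** The defect [D g] is linear in [g], bounded by the [L^oo] norm of [g] and zero on indicators,
    where [act] is [P] by definition. Uniform approximation by step functions makes it vanish on
    [L^oo]. *)
Lemma cotangent_action : represents_action pn act.
Proof.
move=> g v w goo; have para := cotangent_parallelogram.
pose D g := ip (act g v) w - intg setT (g * pin v w).
have sp h : Loo h -> summable (h * pin v w).
  by move=> hoo; exact: summable_Loo hoo (summable_pin hm v w).
have Dlin a h h' : Loo h -> Loo h' -> D (a *: h + h') = a * D h + D h'.
  move=> hoo hoo'; rewrite /D (act_linearl cm)// (ip_linear_l para).
  have -> : (a *: h + h') * pin v w = a *: (h * pin v w) + h' * pin v w.
    apply/L0_eqP.
    apply: filterS5 (L0_mulE (a *: h + h') (pin v w)) (L0_linE a h h')
      (L0_linE a (h * pin v w) (h' * pin v w)) (L0_mulE h (pin v w))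
      (L0_mulE h' (pin v w)).
    by move=> x -> -> -> -> ->; ring.
  by rewrite intg_lin ?sp//; ring.
have Dbound h : Loo h -> `|D h| <= Lp_norm +oo%E h * (2 * (`|v| * `|w|)).
  move=> hoo; apply: (le_trans (ler_normB _ _)).
  have := intg_Loo_pin hm v w hoo.
  have : `|ip (act h v) w| <= Lp_norm +oo%E h * (`|v| * `|w|).
    apply: (le_trans (ip_CS para _ _)); rewrite mulrA ler_wpM2r//.
    exact: (act_bounded cm).
  lra.
have Dind A : measurable A -> D (ind m A) = 0.
  move=> mA; rewrite /D intg_ind// setTI (intg_pinr hm)//.
  by rewrite /P subrr.
have Loo_sum (B : nat -> set X) (c : nat -> R) n : (forall j, measurable (B j)) ->
    Loo (\sum_(j < n) c j *: ind m (B j)).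
  move=> mB; elim: n => [|n IH]; first by rewrite big_ord0; exact: Loo0.
  by rewrite big_ord_recr /= addrC; apply: Loo_lin => //; exact: Loo_ind.
have Dsum (B : nat -> set X) (c : nat -> R) n : (forall j, measurable (B j)) ->
    D (\sum_(j < n) c j *: ind m (B j)) = 0.
  move=> mB; elim: n => [|n IH].
    rewrite big_ord0; have := Dlin 1 0 0 (Loo0 m) (Loo0 m).
    by rewrite scale1r addr0 mul1r -[LHS]addr0 => /addrI <-.
  rewrite big_ord_recr /= addrC Dlin; [|exact: Loo_ind|exact: Loo_sum].
  by rewrite IH Dind// mulr0 addr0.
apply/eqP; rewrite -subr_eq0 -normr_le0 -/(D g).
apply/ler_addgt0Pl => e e0; rewrite addr0.
pose C := 2 * (`|v| * `|w|) + 1; have C0 : 0 < C by rewrite ltr_wpDl// mulr_ge0// mulr_ge0.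
have [B [c [n [mB gB]]]] := Loo_step goo (divr_gt0 e0 C0).
set s := \sum_(j < n) _ in gB.
have soo : Loo s by exact: Loo_sum.
have gsoo : Loo (g - s) by rewrite addrC -scaleN1r; exact: Loo_lin.
have -> : D g = D (g - s).
  by have := Dlin 1 (g - s) s gsoo soo; rewrite scale1r subrK Dsum// mul1r addr0.
apply: (le_trans (Dbound _ gsoo)).
rewrite ler_pdivlMr// in gB; apply: le_trans gB.
by rewrite ler_wpM2l ?Lp_norm_ge0// lerDl.
Qed.

Lemma differential_linear : linear_on Fe (differential iota).
Proof.
move=> a f g Ff Fg; split; first exact: (Fe_lin E_form).
have Pf := Pcm_single E_form mu_energy Ff; have Pg := Pcm_single E_form mu_energy Fg.
have Pa := Pcm_scale E_form mu_energy a Pf.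
rewrite /differential -(iota_scale cm)// -(iota_add cm)//.
apply: iota_eq; [|exact: Pcm_add|].
  by apply: (Pcm_single E_form mu_energy); exact: (Fe_lin E_form).
move=> p h h' /piece_at_single <- /piece_at_add[f1 [g1 [xf1 /piece_at_single <- <-]]].
by have [f2 /piece_at_single <- <-] := piece_at_scale xf1.
Qed.

Lemma pn_differential f : Fe f ->
  {ae m, forall p, pn (differential iota f) p = Num.sqrt (Gamma mu f f p)}.
Proof.
move=> Ff; rewrite /differential (pn_iota cm); first exact: (pcm_pn_single E_form mu_energy).
exact: Pcm_single.
Qed.

End cotangent.

(** * Existence of the cotangent module *)

Section energy_kernel.
Context (R : realType) (M : ptopologicalType).
Local Notation X := (g_sigma_algebraType (@open M)).
Context (m : {sigma_finite_measure set X -> \bar R}).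
Local Notation L0 := (L0 m).
Context (F : set L0) (E : L0 -> L0 -> R) (mu : L0 -> L0 -> {charge set X -> \bar R}).
Hypothesis E_form : Dirichlet_form F E.
Hypothesis mu_energy : energy_measure F E mu.
Hypothesis E_carre : carre_du_champ F mu.
Implicit Types (f g h : L0) (A B C : set X).
Local Notation Fe := (Fe F E).
Local Notation nu := (nu mu).

(* A generator [(A, f)] stands for the form [1_A df]. *)
Definition generator := {p : set X * L0 | measurable p.1 /\ Fe p.2}.

Definition gset (x : generator) := (proj1_sig x).1.
Definition gfun (x : generator) := (proj1_sig x).2.

Lemma gset_measurable x : measurable (gset x). Proof. by case: x => ? []. Qed.
Lemma gfun_Fe x : Fe (gfun x). Proof. by case: x => ? []. Qed.
Hint Resolve gset_measurable gfun_Fe : core.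

Definition genP A f (mA : measurable A) (Ff : Fe f) : generator :=
  exist _ (A, f) (conj mA Ff).

(** The pairing of [1_A df] and [1_B dg] integrated over [C] only. The set [C] is what the induction
    for positivity varies, and it later gives the norm of [1_C v] on kernel combinations. *)
Definition local_kernel C (x y : generator) : R :=
  nu (gfun x) (gfun y) (C `&` (gset x `&` gset y)).

Lemma local_kernel_sym C x y : measurable C -> local_kernel C x y = local_kernel C y x.
Proof.
move=> mC; rewrite /local_kernel (nuC mu_energy)// ?(setIC (gset y))//.
by apply: measurableI => //; exact: measurableI.
Qed.

Lemma local_kernel_split C A x y : measurable C -> measurable A ->
  local_kernel C x y = local_kernel (C `&` A) x y + local_kernel (C `&` ~` A) x y.
Proof.
move=> mC mA; rewrite /local_kernel [LHS](nuU _ _ _ (B := A))//; last first.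
  by apply: measurableI => //; exact: measurableI.
by rewrite ![_ `&` (gset x `&` gset y) `&` _]setIAC.
Qed.

Lemma gram_split C A s t : measurable C -> measurable A ->
  gram (local_kernel C) s t =
  gram (local_kernel (C `&` A)) s t + gram (local_kernel (C `&` ~` A)) s t.
Proof.
move=> mC mA; rewrite -gramD; congr gram; apply/funext => x; apply/funext => y.
exact: local_kernel_split.
Qed.

(* The square of [1_C df + s] for a combination [s] of generators; cutting [C] along
   the set of the first generator of [s] absorbs it into [f], which makes positivity
   an induction on [s]. *)
Lemma local_form_ge0 C f s : measurable C -> Fe f ->
  0 <= nu f f C + 2 * ev (fun x => nu f (gfun x) (C `&` gset x)) s +
       gram (local_kernel C) s s.
Proof.
elim: s C f => [|[a x] s IH] C f mC Ff.
  by rewrite /gram /ev !big_nil mulr0 !addr0; exact: (nu_ge0 mu_energy).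
have mA := gset_measurable x; have Fg := gfun_Fe x.
set A := gset x in mA *; set g := gfun x in Fg *.
have mCA : measurable (C `&` A) by exact: measurableI.
have mCN : measurable (C `&` ~` A) by apply: measurableI => //; exact: measurableC.
have Fl := Fe_lin E_form a Fg Ff.
have := addr_ge0 (IH _ _ mCA Fl) (IH _ _ mCN Ff).
have e1 : ev (fun y => nu (a *: g + f) (gfun y) (C `&` A `&` gset y)) s =
    a * ev (local_kernel C x) s + ev (fun y => nu f (gfun y) (C `&` A `&` gset y)) s.
  rewrite -ev_linear /ev; apply: eq_bigr => p _; congr (_ * _).
  rewrite (nu_lin_l mu_energy)//; last exact: measurableI.
  by rewrite /local_kernel setIA.
have e2 : ev (fun y => nu f (gfun y) (C `&` gset y)) s =
    ev (fun y => nu f (gfun y) (C `&` A `&` gset y)) s +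
    ev (fun y => nu f (gfun y) (C `&` ~` A `&` gset y)) s.
  rewrite /ev -big_split; apply: eq_bigr => p _ /=; rewrite -mulrDr; congr (_ * _).
  rewrite [LHS](nuU _ _ _ (measurableI _ _ mC (gset_measurable p.2)) mA).
  by rewrite ![_ `&` gset p.2 `&` _]setIAC.
have e3 : gram (local_kernel C) ((a, x) :: s) ((a, x) :: s) =
    a ^+ 2 * nu g g (C `&` A) + 2 * (a * ev (local_kernel C x) s) +
    gram (local_kernel C) s s.
  rewrite {1}/gram /ev !big_cons /=.
  under [X in _ + X]eq_bigr do rewrite big_cons mulrDr.
  rewrite big_split /= -/(ev _ _).
  have -> : \sum_(i <- s) i.1 * (a * local_kernel C i.2 x) = a * ev (local_kernel C x) s.
    rewrite /ev mulr_sumr; apply: eq_bigr => p _.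
    by rewrite local_kernel_sym// mulrCA.
  by rewrite /gram /ev {1}/local_kernel setIid -/A -/g; ring.
rewrite (nu_sqr_lin E_form mu_energy)// e1.
have e4 := nuU mu f f mC mA.
have e5 := nuC mu_energy Fg Ff mCA.
by rewrite e3 e4 ev_cons /= -/A -/g e2 e5 (gram_split s s mC mA); lra.
Qed.

Lemma gram_local_ge0 C s : measurable C -> 0 <= gram (local_kernel C) s s.
Proof.
move=> mC; have := local_form_ge0 s mC (Fe0 E_form).
rewrite (nu0l E_form mu_energy)//; last exact: Fe0 E_form.
rewrite /ev big1 ?mulr0 ?add0r// => p _.
by rewrite (nu0l E_form mu_energy) ?mulr0//; exact: measurableI.
Qed.

Definition energy_kernel : kernel R generator :=
  Kernel (fun x y => local_kernel_sym x y (@measurableT _ X))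
    (fun s => gram_local_ge0 s (@measurableT _ X)).

Local Notation k := energy_kernel.
Local Notation T := (rkhs energy_kernel).

Lemma generator_eq (x y : generator) : gset x = gset y -> gfun x = gfun y -> x = y.
Proof.
case: x y => [[A f] Af] [[B g] Bg]; rewrite /gset /gfun /= => eA ef.
by subst; congr exist; exact: Prop_irrelevance.
Qed.

Definition genI A (mA : measurable A) (x : generator) : generator :=
  genP (measurableI _ _ mA (gset_measurable x)) (gfun_Fe x).

Lemma gram_genI A (mA : measurable A) s :
  gram k [seq (p.1, genI mA p.2) | p <- s] [seq (p.1, genI mA p.2) | p <- s] =
  gram (local_kernel A) s s.
Proof.
rewrite /gram /ev big_map; apply: eq_bigr => p _; rewrite big_map; congr (_ * _).
apply: eq_bigr => q _; congr (_ * nu _ _ _); rewrite /gset /= -!/(gset _).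
by rewrite setTI setIACA setIid.
Qed.

(** The difference of the two sides is the Gram form over the complement of [A]. This is the
    contraction that [pullback] requires. *)
Lemma genI_le A (mA : measurable A) s :
  gram k [seq (p.1, genI mA p.2) | p <- s] [seq (p.1, genI mA p.2) | p <- s] <=
  gram k s s.
Proof.
rewrite gram_genI [leRHS](gram_split s s (@measurableT _ X) mA) setTI setTI lerDl.
by apply: gram_local_ge0; exact: measurableC.
Qed.

(** For nonmeasurable [A] the value is [v], which keeps [proj_contraction] valid for all sets. *)
Definition proj A (v : T) : T :=
  if pselect (measurable A) is left mA then pullback (genI_le mA) v else v.

Lemma projE A (mA : measurable A) v x : proj A v x = v (genI mA x).
Proof.
by rewrite /proj; case: pselect => // mA'; rewrite (Prop_irrelevance mA' mA).
Qed.

Lemma proj_linear A a v w : measurable A ->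
  proj A (a *: v + w) = a *: proj A v + proj A w.
Proof. by rewrite /proj; case: pselect => // mA _; exact: pullback_linear. Qed.

Lemma proj_contraction A v : `|proj A v| <= `|v|.
Proof. by rewrite /proj; case: pselect => // mA; exact: pullback_contraction. Qed.

Lemma proj_setI A B v : measurable A -> measurable B ->
  proj (A `&` B) v = proj A (proj B v).
Proof.
move=> mA mB; apply: rkhs_ext => x.
rewrite (projE (measurableI _ _ mA mB)) (projE mA) (projE mB).
by congr (rkhs_fun v _); apply: generator_eq => //=; rewrite /gset /= setIA (setIC A).
Qed.

Lemma proj_setT v : proj setT v = v.
Proof.
apply: rkhs_ext => x; rewrite (projE (@measurableT _ X)).
by congr (rkhs_fun v _); apply: generator_eq => //=; rewrite /gset /= setTI.
Qed.

Definition kform A f : T :=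
  if pselect (measurable A /\ Fe f) is left p then kvec k (exist _ (A, f) p) else 0.

Lemma kformE A f x : measurable A -> Fe f -> kform A f x = nu f (gfun x) (A `&` gset x).
Proof.
move=> mA Ff; rewrite /kform; case: pselect => [[mA' Ff']|[]]//.
by rewrite /= /local_kernel setTI.
Qed.

Lemma kform_linear A a f g : measurable A -> Fe f -> Fe g ->
  kform A (a *: f + g) = a *: kform A f + kform A g.
Proof.
move=> mA Ff Fg; apply: rkhs_ext => x; rewrite rkhs_linE !kformE//.
  by rewrite (nu_lin_l mu_energy)//; exact: measurableI.
exact: (Fe_lin E_form).
Qed.

Lemma proj_kform A B f : measurable A -> measurable B -> Fe f ->
  proj A (kform B f) = kform (A `&` B) f.
Proof.
move=> mA mB Ff; have mAB := measurableI _ _ mA mB.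
apply: rkhs_ext => x; rewrite (projE mA) !kformE//.
by rewrite {1}/gset /= setIA (setIC A).
Qed.

Lemma kform_norm A f : measurable A -> Fe f -> `|kform A f| ^+ 2 = nu f f A.
Proof.
move=> mA Ff; rewrite /kform; case: pselect => [[mA' Ff']|[]]//.
by rewrite kvec_norm /= /local_kernel setTI /gset /= setIid.
Qed.

(** Density of the kernel span as a criterion for subspaces; in this form it can be applied without
    reference to lists or kernels. *)
Lemma kform_span (D : set T) : D 0 -> (forall a v w, D v -> D w -> D (a *: v + w)) ->
  (forall A f, measurable A -> Fe f -> D (kform A f)) -> approximable D.
Proof.
move=> D0 Dlin DA v e e0; have [_ [s _ <-] vs] := kspan_dense v e0.
exists (kspan k s) => //; elim: s {vs} => [|[a x] s IH]; first by rewrite /kspan big_nil.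
rewrite /kspan big_cons /=; apply: Dlin => //.
have mx := gset_measurable x; have Fx := gfun_Fe x.
have -> : kvec k x = kform (gset x) (gfun x); last exact: DA.
rewrite /kform; case: pselect => [p|[]]//; congr kvec.
exact: generator_eq.
Qed.

Lemma proj_kspan A s : measurable A -> `|proj A (kspan k s)| ^+ 2 = gram (local_kernel A) s s.
Proof.
move=> mA; rewrite -(gram_genI mA) -kspan_norm; congr (`|_| ^+ 2).
apply: rkhs_ext => x; rewrite (projE mA) !kspanE.
rewrite /ev big_map; apply: eq_bigr => p _; congr (_ * nu _ _ _).
by rewrite /gset /= -!/(gset _) !setTI setIA (setIC A).
Qed.

Lemma nu_sigma f g (G : nat -> set X) : (forall i, measurable (G i)) ->
  trivIset setT G ->
  (fun n => \sum_(0 <= i < n) nu f g (G i)) @ \oo --> nu f g (\bigcup_i G i).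
Proof.
move=> mG tG; have mU : measurable (\bigcup_i G i) by exact: bigcup_measurable.
have -> : (fun n => \sum_(0 <= i < n) nu f g (G i)) =
    fine \o (fun n => \sum_(0 <= i < n) mu f g (G i))%E.
  apply/funext => n /=; have -> : (\sum_(0 <= i < n) mu f g (G i) =
      \sum_(0 <= i < n) (nu f g (G i))%:E)%E by apply: eq_bigr => i _; rewrite EFin_nu.
  by rewrite sumEFin.
have := @charge_semi_sigma_additive _ _ _ (mu f g) G mG tG mU.
by rewrite -EFin_nu// => /fine_cvgP[].
Qed.

Lemma gram_sigma (G : nat -> set X) s : (forall i, measurable (G i)) ->
  trivIset setT G ->
  (fun n => \sum_(0 <= i < n) gram (local_kernel (G i)) s s) @ \oo -->
  gram (local_kernel (\bigcup_i G i)) s s.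
Proof.
move=> mG tG.
have -> : (fun n => \sum_(0 <= i < n) gram (local_kernel (G i)) s s) =
    (fun n => gram (fun x y => \sum_(0 <= i < n) local_kernel (G i) x y) s s).
  apply/funext => n; elim: n => [|n IH].
    rewrite big_nil /gram /ev big1// => p _; rewrite big1 ?mulr0// => q _.
    by rewrite big_nil mulr0.
  rewrite big_nat_recr//= IH -gramD; congr gram.
  by apply/funext => x; apply/funext => y; rewrite big_nat_recr.
apply: cvg_ev => x; apply: cvg_ev => y; rewrite /local_kernel setI_bigcupl.
apply: nu_sigma => [i|]; first by apply: measurableI => //; exact: measurableI.
exact: trivIset_setIr.
Qed.

Lemma projB A v w : measurable A -> proj A (v - w) = proj A v - proj A w.
Proof. by move=> mA; rewrite addrC -scaleN1r proj_linear// scaleN1r addrC. Qed.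

Lemma proj_cvg A v (u : nat -> T) : measurable A -> u @ \oo --> v ->
  (fun n => proj A (u n)) @ \oo --> proj A v.
Proof.
move=> mA /cvgrPdist_lt uv; apply/cvgrPdist_lt => e e0.
by apply: filterS (uv e e0) => n; apply: le_lt_trans; rewrite -projB// proj_contraction.
Qed.

(** On kernel combinations this is the additivity of the Gram form in its set; both sides are
    continuous in [v]. *)
Lemma proj_split A v : measurable A ->
  `|v| ^+ 2 = `|proj A v| ^+ 2 + `|proj (~` A) v| ^+ 2.
Proof.
move=> mA; have mCA := measurableC mA.
have [u uD uv] := approximable_seq v (@kspan_dense R generator k).
have c1 := cvg_sqr_norm uv.
have c2 : (fun n => `|proj A (u n)| ^+ 2 + `|proj (~` A) (u n)| ^+ 2) @ \oo -->
    `|proj A v| ^+ 2 + `|proj (~` A) v| ^+ 2.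
  by apply: (@cvgD R R^o nat \oo); apply: cvg_sqr_norm; exact: proj_cvg.
rewrite -(cvg_lim _ c1)// -(cvg_lim _ c2)//.
congr (limn _); apply/funext => n /=; have [s _ <-] := uD n.
by rewrite !proj_kspan// kspan_norm [LHS](gram_split s s (@measurableT _ X) mA) !setTI.
Qed.

Lemma proj_set0 v : proj set0 v = 0.
Proof.
have := proj_split v (@measurableT _ X).
rewrite proj_setT setCT => /esym/eqP; rewrite -subr_eq0 addrAC subrr add0r.
by rewrite sqrf_eq0 normr_eq0 => /eqP.
Qed.

Lemma projU A B v : measurable A -> measurable B -> A `&` B = set0 ->
  `|proj (A `|` B) v| ^+ 2 = `|proj A v| ^+ 2 + `|proj B v| ^+ 2.
Proof.
move=> mA mB AB; have mU := measurableU _ _ mA mB.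
have mCA := measurableC mA.
rewrite (proj_split _ mA) -!proj_setI// setIUr setIid AB setU0.
by rewrite setIUr setICl set0U setIidr// => x Bx Ax; have : (A `&` B) x by []; rewrite AB.
Qed.

Lemma proj_sum (G : nat -> set X) v n : (forall i, measurable (G i)) ->
  trivIset setT G ->
  \sum_(0 <= i < n) `|proj (G i) v| ^+ 2 = `|proj (\big[setU/set0]_(0 <= i < n) G i) v| ^+ 2.
Proof.
move=> mG tG; elim: n => [|n IH].
  by rewrite !big_nil proj_set0 normr0 expr0n.
rewrite !big_nat_recr//= IH projU//.
  by apply: bigsetU_measurable => // i _.
rewrite big_mkord; apply/seteqP; split => // x [].
rewrite -bigcup_mkord => -[i /= ni Gi] Gn.
have : i = n by apply: tG => //; exists x.
by move=> e; rewrite e ltnn in ni.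
Qed.

(** By finite additivity, the claim is that the remainders [proj (D n) v] tend to 0. For kernel
    combinations this is the countable additivity of finitely many charges; since the [proj (D n)]
    are contractions, it extends to all [v] by density. *)
Lemma proj_sigma (G : nat -> set X) v : (forall i, measurable (G i)) ->
  trivIset setT G ->
  (fun n => \sum_(0 <= i < n) `|proj (G i) v| ^+ 2) @ \oo -->
  `|proj (\bigcup_i G i) v| ^+ 2.
Proof.
move=> mG tG; set U := \bigcup_i G i.
have mU : measurable U by exact: bigcup_measurable.
pose U_ n := \big[setU/set0]_(0 <= i < n) G i.
have mU_ n : measurable (U_ n) by apply: bigsetU_measurable => // i _.
pose D n := U `&` ~` U_ n.
have mD n : measurable (D n) by apply: measurableI => //; exact: measurableC.
have UD w n : `|proj U w| ^+ 2 = \sum_(0 <= i < n) `|proj (G i) w| ^+ 2 + `|proj (D n) w| ^+ 2.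
  rewrite proj_sum// -projU//.
  - congr (`|proj _ w| ^+ 2); rewrite /D -/(U_ n) setUIr setUv setIT setUidr//.
    by rewrite /U_ big_mkord -bigcup_mkord; apply: bigcup_sub => i _; exact: bigcup_sup.
  - exact: mU_.
  - by rewrite /D setICA setICr setI0.
have Dspan s : (fun n => `|proj (D n) (kspan k s)|) @ \oo --> (0 : R).
  have c : (fun n => `|proj (D n) (kspan k s)| ^+ 2) @ \oo --> (0 : R).
    have -> : (fun n => `|proj (D n) (kspan k s)| ^+ 2) = (fun n =>
        gram (local_kernel U) s s - \sum_(0 <= i < n) gram (local_kernel (G i)) s s).
      apply/funext => n; rewrite -proj_kspan// (UD _ n).
      under eq_bigr do rewrite proj_kspan//.
      by rewrite addrAC subrr add0r.
    rewrite -[X in _ --> X](subrr (gram (local_kernel U) s s)); apply: cvgB; first exact: cvg_cst.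
    exact: gram_sigma.
  apply/cvgrPdist_lt => e e0; have /cvgrPdist_lt/(_ _ (exprn_gt0 2 e0)) := c.
  apply: filterS => n; rewrite !sub0r !normrN normrX !normr_id.
  by rewrite ltr_sqr ?nnegrE// ltW.
have Dv : (fun n => `|proj (D n) v|) @ \oo --> (0 : R).
  apply/cvgrPdist_lt => e e0; have e20 : 0 < e / 2 by rewrite divr_gt0.
  have [_ [s _ <-] vs] := @kspan_dense R generator k v _ e20.
  have /cvgrPdist_lt/(_ _ e20) := Dspan s; apply: filterS => n.
  rewrite !sub0r !normrN !normr_id => h.
  rewrite -[v](subrK (kspan k s)) (splitr e).
  have -> : proj (D n) (v - kspan k s + kspan k s) =
      proj (D n) (v - kspan k s) + proj (D n) (kspan k s).
    by have := proj_linear 1 (v - kspan k s) (kspan k s) (mD n); rewrite !scale1r.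
  apply: (le_lt_trans (ler_normD _ _)); apply: ltrD => //.
  by apply: le_lt_trans vs; exact: proj_contraction.
have -> : (fun n => \sum_(0 <= i < n) `|proj (G i) v| ^+ 2) =
    (fun n => `|proj U v| ^+ 2 - `|proj (D n) v| ^+ 2).
  by apply/funext => n; rewrite (UD v n) addrK.
rewrite -[X in _ --> X]subr0; apply: cvgB; first exact: cvg_cst.
by rewrite -(mulr0 0); apply: cvgM.
Qed.

(** Absolute continuity is known for the diagonal measures; [nu_CS] extends it to the mixed ones,
    hence to kernel combinations, and density does the rest. *)
Lemma proj_null A v : measurable A -> m A = 0%E -> proj A v = 0.
Proof.
move=> mA mA0.
suff -> : proj A = (fun=> 0) by [].
apply: (approximable_eq (@kspan_dense R generator k) (C := 1)).
- by move=> w w'; rewrite -projB// mul1r proj_contraction.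
- by move=> w w'; rewrite subrr normr0 mul1r.
move=> _ [s _ <-]; apply/eqP; rewrite -normr_eq0 -sqrf_eq0 proj_kspan//.
rewrite /gram /ev big1// => p _; rewrite big1 ?mulr0// => q _.
set B := gset p.2 `&` gset q.2.
have mB : measurable B by exact: measurableI.
have mAB : measurable (A `&` B) by exact: measurableI.
have nu0 h : Fe h -> nu h h (A `&` B) = 0.
  move=> Fh; apply: EFin_inj; rewrite EFin_nu//.
  have /null_content_dominatesP := mu_dominated mu_energy E_carre Fh; apply => //.
  by apply: (subset_measure0 mAB mA) => //; exact: subIsetl.
have := nu_CS E_form mu_energy (gfun_Fe p.2) (gfun_Fe q.2) mAB.
rewrite nu0// mul0r => h; apply/eqP; rewrite mulf_eq0; apply/orP; right.
by rewrite -sqrf_eq0 eq_le h sqr_ge0.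
Qed.

End energy_kernel.

(** Radon-Nikodym for [q] as a finite charge. The square root of the density is taken because [p] is
    to be a pointwise norm, with [q A] the squared norm over [A]. *)
Lemma density_exists d (X : measurableType d) (R : realType)
    (m : {sigma_finite_measure set X -> \bar R}) (q : set X -> R) :
  q set0 = 0 -> (forall A, measurable A -> 0 <= q A) ->
  (forall G : nat -> set X, (forall i, measurable (G i)) -> trivIset setT G ->
    (fun n => \sum_(0 <= i < n) q (G i)) @ \oo --> q (\bigcup_i G i)) ->
  (forall A, measurable A -> m A = 0%E -> q A = 0) ->
  exists p : L0 m, [/\ {ae m, forall x, 0 <= p x}, Lp 2%:E p &
    forall A, measurable A -> intg A (p ^+ 2) = q A].
Proof.
move=> q0 qge0 qs qm.
pose nu0 A := (q A)%:E.
have nu00 : nu0 set0 = 0%E by rewrite /nu0 q0.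
have nufin A : measurable A -> nu0 A \is a fin_num by [].
have nus : semi_sigma_additive nu0.
  move=> G mG tG mU; rewrite /nu0.
  under eq_fun do rewrite sumEFin.
  by apply: cvg_EFin; [exact: nearW|exact: qs].
pose c := isCharge.Build _ X R nu0 nu00 nufin nus.
pose nu : {charge set X -> \bar R} := HB.pack nu0 c.
have nu_m : nu `<< m.
  by apply/null_content_dominatesP => A mA mA0; rewrite /nu/= /nu0 qm.
pose r : L0 m := L0_class m (fine \o Radon_Nikodym nu m).
have mRN : measurable_fun setT (Radon_Nikodym nu m).
  exact/measurable_int/Radon_Nikodym_integrable.
have mfRN : measurable_fun setT (fine \o Radon_Nikodym nu m).
  by apply: (@measurableT_comp _ _ _ _ _ _ (@fine R)).
have rE := L0_classE m mfRN.
have sr : summable r.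
  apply: (@ae_integrable _ _ _ _ (fine \o Radon_Nikodym nu m)).
  - exact: measurable_L0.
  - by apply: filterS rE => x ->.
  - have -> : EFin \o (fine \o Radon_Nikodym nu m) = Radon_Nikodym nu m.
      by apply/funext => x /=; rewrite fineK// Radon_Nikodym_fin_num.
    exact: Radon_Nikodym_integrable.
have rq A : measurable A -> intg A r = q A.
  move=> mA; apply: EFin_inj; rewrite EFin_intg//.
  rewrite -[RHS]/(nu A) (Radon_Nikodym_integral nu_m mA); apply: ae_eq_integral => //.
  - by apply/measurable_EFinP/measurable_funTS; exact: measurable_L0.
  - exact: measurable_funTS.
  - by apply: filterS rE => x -> _; rewrite /= fineK// Radon_Nikodym_fin_num.
have r0 : {ae m, forall x, 0 <= r x}.
  by apply: intg_ge0_ae => // A mA; rewrite rq//; exact: qge0.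
pose p : L0 m := L0_class m (fun x => Num.sqrt (r x)).
have pE : {ae m, forall x, p x = Num.sqrt (r x)}.
  apply: L0_classE; apply: (measurableT_comp (continuous_measurable_fun (@sqrt_continuous R))).
  exact: measurable_L0.
have p2 : p ^+ 2 = r.
  by apply/L0_eqP; apply: filterS3 (sqrE p) pE r0 => x -> -> h; rewrite sqr_sqrtr.
exists p; split.
- by apply: filterS pE => x ->; exact: sqrtr_ge0.
- by apply/Lp2P; rewrite p2.
- by move=> A mA; rewrite p2 rq.
Qed.

(** * Assembly of the cotangent module *)

Section construction.
Context (R : realType) (M : ptopologicalType).
Local Notation X := (g_sigma_algebraType (@open M)).
Context (m : {sigma_finite_measure set X -> \bar R}).
Local Notation L0 := (L0 m).
Local Notation Loo := (@Lp _ _ _ m +oo%E).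
Context (F : set L0) (E : L0 -> L0 -> R) (mu : L0 -> L0 -> {charge set X -> \bar R}).
Hypothesis E_form : Dirichlet_form F E.
Hypothesis mu_energy : energy_measure F E mu.
Hypothesis E_carre : carre_du_champ F mu.
Implicit Types (f g h : L0) (A : set X) (B : nat -> set X) (x y : piece m).
Local Notation Fe := (Fe F E).
Local Notation Pcm := (Pcm F E mu).
Local Notation pcm_norm2 := (pcm_norm2 mu).
Local Notation pcm_pn := (pcm_pn mu).
Local Notation mu_ge0 := (em_ge0 mu_energy).
Local Notation nu := (nu mu).

(* [e A f] stands for [1_A df] *)
Record energy_projections (T : completeNormedModType R) (P : set X -> T -> T)
    (e : set X -> L0 -> T) : Prop := {
  ep_parallelogram : parallelogram T ;
  ep_linear : forall A a v w, measurable A -> P A (a *: v + w) = a *: P A v + P A w ;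
  ep_contraction : forall A v, `|P A v| <= `|v| ;
  ep_setI : forall A A' v, measurable A -> measurable A' ->
    P (A `&` A') v = P A (P A' v) ;
  ep_setT : forall v, P setT v = v ;
  ep_sigma : forall (G : nat -> set X) v, (forall i, measurable (G i)) ->
    trivIset setT G ->
    (fun n => \sum_(0 <= i < n) `|P (G i) v| ^+ 2) @ \oo --> `|P (\bigcup_i G i) v| ^+ 2 ;
  ep_null : forall A v, measurable A -> m A = 0%E -> P A v = 0 ;
  ep_form_linear : forall A a f g, measurable A -> Fe f -> Fe g ->
    e A (a *: f + g) = a *: e A f + e A g ;
  ep_form_setI : forall A A' f, measurable A -> measurable A' -> Fe f ->
    P A (e A' f) = e (A `&` A') f ;
  ep_form_norm : forall A f, measurable A -> Fe f -> `|e A f| ^+ 2 = nu f f A ;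
  ep_span : forall D : set T, D 0 -> (forall a v w, D v -> D w -> D (a *: v + w)) ->
    (forall A f, measurable A -> Fe f -> D (e A f)) -> approximable D }.

Lemma energy_projections_exist : exists T P e, @energy_projections T P e.
Proof.
exists (rkhs (energy_kernel E_form mu_energy)).
exists (@proj _ _ _ _ _ _ E_form mu_energy), (@kform _ _ _ _ _ _ E_form mu_energy); split.
- exact: rkhs_parallelogram.
- exact: proj_linear.
- exact: proj_contraction.
- exact: proj_setI.
- exact: proj_setT.
- exact: proj_sigma.
- exact: (proj_null E_carre).
- exact: kform_linear.
- exact: proj_kform.
- exact: kform_norm.
- exact: kform_span.
Qed.

Context (T : completeNormedModType R) (P : set X -> T -> T) (e : set X -> L0 -> T).
Hypothesis ep : energy_projections P e.
Implicit Types v w : T.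

Let P0 A : measurable A -> P A 0 = 0.
Proof.
move=> mA; have := ep_linear ep 1 0 0 mA.
by rewrite !scale1r addr0 -[LHS]addr0 => /addrI.
Qed.

Let PD A v w : measurable A -> P A (v + w) = P A v + P A w.
Proof. by move=> mA; have := ep_linear ep 1 v w mA; rewrite !scale1r. Qed.

Let PB A v w : measurable A -> P A (v - w) = P A v - P A w.
Proof.
by move=> mA; rewrite addrC -scaleN1r (ep_linear ep)// scaleN1r addrC.
Qed.

Let PZ A a v : measurable A -> P A (a *: v) = a *: P A v.
Proof. by move=> mA; have := ep_linear ep a v 0 mA; rewrite !addr0 P0// addr0. Qed.

Let e0 A : measurable A -> e A 0 = 0.
Proof.
move=> mA; have := ep_form_linear ep 1 mA (Fe0 E_form) (Fe0 E_form).
by rewrite !scale1r addr0 -[LHS]addr0 => /addrI.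
Qed.

Let eD A f g : measurable A -> Fe f -> Fe g -> e A (f + g) = e A f + e A g.
Proof.
by move=> mA Ff Fg; have := ep_form_linear ep 1 mA Ff Fg; rewrite !scale1r.
Qed.

Let eZ A a f : measurable A -> Fe f -> e A (a *: f) = a *: e A f.
Proof.
move=> mA Ff; have := ep_form_linear ep a mA Ff (Fe0 E_form).
by rewrite !addr0 e0// addr0.
Qed.

Let e_set0 f : Fe f -> e set0 f = 0.
Proof.
by move=> Ff; apply/eqP; rewrite -normr_eq0 -sqrf_eq0 (ep_form_norm ep)// nu_set0.
Qed.

Let P_set0 v : P set0 v = 0.
Proof. by apply: (ep_null ep) => //; exact: measure0. Qed.

(** By [ep_sigma], the squared norm of [v - w] is the sum of those of its parts over the [B i]. *)
Lemma eq_on_partition B v w : Borel_partition B ->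
  (forall i, P (B i) v = P (B i) w) -> v = w.
Proof.
move=> [mB tB cB] vw; apply/eqP; rewrite -subr_eq0 -normr_eq0 -sqrf_eq0.
rewrite -(ep_setT ep (v - w)) -cB -(cvg_lim _ (ep_sigma ep mB tB))//.
rewrite (_ : (fun n => _) = cst 0) ?lim_cst//.
apply/funext => n; rewrite big1// => i _.
by rewrite PB// vw subrr normr0 expr0n.
Qed.

Lemma eq_on_pairs (A B : nat -> set X) v w : Borel_partition A -> Borel_partition B ->
  (forall i j, P (A i `&` B j) v = P (A i `&` B j) w) -> v = w.
Proof.
move=> pA pB vw.
apply: (eq_on_partition (Borel_partition_pairs (fun _ _ => 0 : L0) pA pB)) => n.
by rewrite /pcm_pairs /=; case: pickle_inv => [[i j]|]//; rewrite !P_set0.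
Qed.

(** Finite additivity as an instance of [ep_sigma], for the sequence of [A], its complement and
    empty sets: the partial sums are constant from index 2 on. *)
Lemma split_norm A v : measurable A -> `|v| ^+ 2 = `|P A v| ^+ 2 + `|P (~` A) v| ^+ 2.
Proof.
move=> mA; pose G (n : nat) := if n is 0 then A else if n is 1 then ~` A else set0.
have mG n : measurable (G n) by case: n => [|[|n]] //=; exact: measurableC.
have tG : trivIset setT G by move=> [|[|i]] [|[|j]] _ _ [z []].
have cG : \bigcup_i G i = setT.
  rewrite -subTset => z _; have [Az|Az] := pselect (A z); first by exists 0%N.
  by exists 1%N.
have := @ep_sigma _ _ _ ep G v mG tG; rewrite cG (ep_setT ep) => /(cvg_lim (@Rhausdorff R)) <-.
apply: (cvg_lim (@Rhausdorff R)); apply: cvg_near_cst; near=> n.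
have n2 : (2 <= n)%N by near: n; exact: nbhs_infty_ge.
rewrite -(subnKC n2) /index_iota subn0 iotaD big_cat /= !big_cons big_nil addr0.
rewrite [X in _ + X]big_seq big1 ?addr0// => i; rewrite mem_iota => /andP[i2 _].
by case: i i2 => [|[|i]]//= _; rewrite P_set0 normr0 expr0n.
Unshelve. all: by end_near. Qed.

(** Pythagoras: forms carried by disjoint sets are orthogonal. In the induction step [split_norm] at
    the last set separates the new term from the previous sum. *)
Lemma partial_sum_norm x k n : Pcm x ->
  `|\sum_(k <= i < n) e (x.2 i) (x.1 i)| ^+ 2 = \sum_(k <= i < n) nu (x.1 i) (x.1 i) (x.2 i).
Proof.
move=> Px; have mx i := Pcm_measurable i Px; have Fx i := Pcm_Fe i Px.
have [[_ tx _] _ _] := Px.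
have Psum A u : measurable A ->
    P A (\sum_(k <= i < u) e (x.2 i) (x.1 i)) = \sum_(k <= i < u) e (A `&` x.2 i) (x.1 i).
  move=> mA; rewrite (big_morph (P A) (fun v w => PD v w mA) (P0 mA)).
  by apply: eq_bigr => i _; rewrite (ep_form_setI ep).
elim: n => [|n IH]; first by rewrite !big_geq// normr0 expr0n.
have [kn|nk] := leqP k n; last by rewrite !big_geq// normr0 expr0n.
rewrite big_nat_recr//= [in RHS]big_nat_recr//= -IH addrC.
set S := \sum_(k <= i < n) _; have mC := measurableC (mx n).
have disj i : (i < n)%N -> x.2 n `&` x.2 i = set0.
  move=> ni; apply/seteqP; split => // z zz.
  by have := tx n i I I (ex_intro _ z zz); move=> h; rewrite h ltnn in ni.
have S1 : P (x.2 n) S = 0.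
  rewrite Psum// big_nat_cond big1// => i /andP[/andP[_ ni] _].
  by rewrite disj// e_set0.
have S2 : P (~` x.2 n) S = S.
  rewrite Psum//; apply: eq_big_nat => i /andP[_ ni].
  rewrite setIidr// => z zi zn; suff : set0 z by [].
  by rewrite -(disj i ni).
rewrite (split_norm _ (mx n)) !PD// S1 S2 !(ep_form_setI ep)//.
by rewrite setIid setICl e_set0// addr0 add0r (ep_form_norm ep)// addrC.
Qed.

Lemma nu_summable x : Pcm x ->
  (fun n => \sum_(0 <= i < n) nu (x.1 i) (x.1 i) (x.2 i)) @ \oo --> fine (pcm_norm2 x).
Proof.
move=> Px; have mx i := Pcm_measurable i Px; have Fx i := Pcm_Fe i Px.
have [_ _ fin] := Px.
have p0 i : (0 <= mu (x.1 i) (x.1 i) (x.2 i))%E by exact: mu_ge0.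
have : (fun n => \sum_(0 <= i < n) mu (x.1 i) (x.1 i) (x.2 i))%E @ \oo --> pcm_norm2 x.
  by apply: is_cvg_nneseries => i _ _; exact: p0.
rewrite -(@fineK _ (pcm_norm2 x)); last first.
  by rewrite ge0_fin_numE//; apply: nneseries_ge0 => i _ _; exact: p0.
move=> /fine_cvgP[_]; apply: cvg_trans; apply: near_eq_cvg; apply: nearW => n /=.
have -> : (\sum_(0 <= i < n) mu (x.1 i) (x.1 i) (x.2 i) =
    \sum_(0 <= i < n) (nu (x.1 i) (x.1 i) (x.2 i))%:E)%E.
  by apply: eq_bigr => i _; rewrite EFin_nu.
by rewrite sumEFin.
Qed.

Definition represents x v := forall i, P (x.2 i) v = e (x.2 i) (x.1 i).

(** The vector is the sum of the series of the forms [1_(A_i) df_i]. Its blocks have as squared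
    norms the blocks of the convergent energy series, so the partial sums are Cauchy. *)
Lemma represents_exists x : Pcm x -> exists v, represents x v.
Proof.
move=> Px; have mx i := Pcm_measurable i Px; have Fx i := Pcm_Fe i Px.
have [[_ tx _] _ _] := Px.
pose S n := \sum_(0 <= i < n) e (x.2 i) (x.1 i).
have cS : cvgn S.
  apply: cauchy_seq_cvg => r r0.
  pose s n := \sum_(0 <= i < n) nu (x.1 i) (x.1 i) (x.2 i).
  have /cvgrPdist_lt cs := nu_summable Px.
  have r20 : 0 < r ^+ 2 / 2 by rewrite divr_gt0// exprn_gt0.
  have [N _ sN] := cs _ r20; exists N.
  have main n k : (N <= n)%N -> (n <= k)%N -> `|S k - S n| < r.
    move=> Nn nk; have Nk := leq_trans Nn nk.
    rewrite /S (big_cat_nat (leq0n n) nk)//= addrAC subrr add0r.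
    rewrite -ltr_sqr ?nnegrE// ?(ltW r0)// partial_sum_norm//.
    have -> : \sum_(n <= i < k) nu (x.1 i) (x.1 i) (x.2 i) = s k - s n.
      by rewrite /s (big_cat_nat (leq0n n) nk)//= addrAC subrr add0r.
    have := sN n Nn; have := sN k Nk; rewrite /= -/(s n) -/(s k) !ltr_norml.
    by move=> /andP[? ?] /andP[? ?]; lra.
  move=> n k Nn Nk; have [nk|/ltnW kn] := leqP n k; last exact: main.
  by rewrite distrC; exact: main.
exists (limn S) => j; apply/eqP; rewrite -subr_eq0 -normr_le0.
apply/ler_addgt0Pl => r r0; rewrite addr0.
have /cvgrPdist_lt/(_ _ r0)[N _ SN] := cS.
(* Once [n > j], restricting the partial sum to the [j]-th set leaves exactly its [j]-th term. *)
pose n := maxn N j.+1.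
have -> : e (x.2 j) (x.1 j) = P (x.2 j) (S n).
  rewrite /S (big_morph (P (x.2 j)) (fun v w => PD v w (mx j)) (P0 (mx j))).
  have jn : j \in index_iota 0 n by rewrite mem_index_iota /n /= leq_maxr.
  rewrite (bigD1_seq j jn (iota_uniq _ _)) /=.
  rewrite (ep_form_setI ep)// setIid big1 ?addr0// => i ij.
  rewrite (ep_form_setI ep)// (_ : x.2 j `&` x.2 i = set0) ?e_set0//.
  apply/seteqP; split => // z zz.
  by have := tx j i I I (ex_intro _ z zz); move=> h; rewrite h eqxx in ij.
rewrite -PB//; apply: (le_trans (ep_contraction ep _ _)).
by apply/ltW/SN; rewrite /= leq_maxl.
Qed.

Lemma represents_unique x v w : Pcm x -> represents x v -> represents x w -> v = w.
Proof.
move=> Px xv xw; apply: (eq_on_partition (Pcm_partition Px)) => i.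
by rewrite xv xw.
Qed.

Lemma represents_norm x v : Pcm x -> represents x v -> `|v| ^+ 2 = fine (pcm_norm2 x).
Proof.
move=> Px xv; have mx i := Pcm_measurable i Px; have Fx i := Pcm_Fe i Px.
have [[_ tx cx] _ _] := Px.
have c := @ep_sigma _ _ _ ep x.2 v mx tx; rewrite cx (ep_setT ep) in c.
rewrite -(cvg_lim (@Rhausdorff R) c) -(cvg_lim (@Rhausdorff R) (nu_summable Px)).
congr (limn _); apply/funext => n; apply: eq_bigr => i _.
by rewrite xv (ep_form_norm ep).
Qed.

Lemma represents_pairs (f : nat -> nat -> L0) (A : nat -> nat -> set X) v :
  (forall i j, P (A i j) v = e (A i j) (f i j)) -> represents (pcm_pairs f A) v.
Proof.
move=> h n; rewrite /pcm_pairs /=; case: pickle_inv => [[i j]|]//.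
by rewrite P_set0 e_set0//; exact: Fe0 E_form.
Qed.

Lemma represents_on x v A i : Pcm x -> represents x v -> measurable A ->
  P (x.2 i `&` A) v = e (x.2 i `&` A) (x.1 i).
Proof.
move=> Px xv mA; have mx := Pcm_measurable i Px; have Fx := Pcm_Fe i Px.
by rewrite setIC (ep_setI ep)// xv (ep_form_setI ep).
Qed.

Lemma represents_add x y v w : Pcm x -> Pcm y -> represents x v -> represents y w ->
  represents (pcm_add x y) (v + w).
Proof.
move=> Px Py xv yw; apply: represents_pairs => i j.
have mx := Pcm_measurable i Px; have Fx := Pcm_Fe i Px.
have my := Pcm_measurable j Py; have Fy := Pcm_Fe j Py.
have mI := measurableI _ _ mx my.
rewrite PD// eD// (represents_on _ Px)//; congr (_ + _).
by rewrite setIC (represents_on _ Py).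
Qed.

Lemma represents_scale a x v : Pcm x -> represents x v ->
  represents (pcm_scale a x) (a *: v).
Proof.
move=> Px xv i; have mx := Pcm_measurable i Px; have Fx := Pcm_Fe i Px.
by rewrite /= PZ// eZ// xv.
Qed.

Lemma represents_single f : Fe f -> represents (pcm_single f) (e setT f).
Proof.
move=> Ff [|i] /=; first by rewrite (ep_setT ep).
by rewrite P_set0 e_set0//; exact: Fe0 E_form.
Qed.

(** The product enters only through its restrictions to the sets [B j]; this covers both [P A] and
    the action of simple classes. *)
Lemma represents_mul B c x v w n : Pcm x -> simple_partition B n -> represents x v ->
  (forall A j, measurable A -> P (A `&` B j) w = c j *: P (A `&` B j) v) ->
  represents (pcm_mul B c x) w.
Proof.
move=> Px [[mB _ _] _] xv h; apply: represents_pairs => i j.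
have mx := Pcm_measurable i Px; have Fx := Pcm_Fe i Px.
have mI := measurableI _ _ mx (mB j).
by rewrite h// (represents_on _ Px)// eZ.
Qed.

Lemma represents_restr A x v : Pcm x -> measurable A -> represents x v ->
  represents (restr A x) (P A v).
Proof.
move=> Px mA xv; apply: (represents_mul Px (ind_sets_simple mA) xv) => A' j mA'.
have mCA := measurableC mA.
case: j => [|[|j]] /=; rewrite /ind_values /= ?scale1r ?scale0r.
- by rewrite -(ep_setI ep) -?setIA ?setIid//; exact: measurableI.
- rewrite -(ep_setI ep) -?setIA ?setICl ?setI0 ?P_set0//.
  exact: measurableI.
- by rewrite setI0 P_set0.
Qed.

(** On a set of the common refinement, [v - w] restricts to the form of [x.1 i - y.1 j], whose
    squared norm is the quantity that [pcm_equiv] requires to vanish. *)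
Lemma pcm_equiv_represents x y v w : Pcm x -> Pcm y -> represents x v -> represents y w ->
  v = w <-> pcm_equiv mu x y.
Proof.
move=> Px Py xv yw.
have key i j : P (x.2 i `&` y.2 j) v = P (x.2 i `&` y.2 j) w <->
    mu (x.1 i - y.1 j) (x.1 i - y.1 j) (x.2 i `&` y.2 j) = 0%E.
  have mx := Pcm_measurable i Px; have Fx := Pcm_Fe i Px.
  have my := Pcm_measurable j Py; have Fy := Pcm_Fe j Py.
  have mI := measurableI _ _ mx my; have FB := FeB E_form Fx Fy.
  rewrite -EFin_nu// -(ep_form_norm ep)//.
  have -> : e (x.2 i `&` y.2 j) (x.1 i - y.1 j) =
      P (x.2 i `&` y.2 j) v - P (x.2 i `&` y.2 j) w.
    rewrite (represents_on _ Px)// [in RHS]setIC (represents_on _ Py)// (setIC (y.2 j)).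
    have FN : Fe (-1 *: y.1 j) by exact: (FeZ E_form).
    by rewrite -(scaleN1r (y.1 j)) (eD mI Fx FN) (eZ _ mI Fy) scaleN1r.
  split => [->|[] /eqP]; first by rewrite subrr normr0 expr0n.
  by rewrite sqrf_eq0 normr_eq0 subr_eq0 => /eqP.
split => [vw i j|h]; first by apply/key; rewrite vw.
by apply: (eq_on_pairs (Pcm_partition Px) (Pcm_partition Py)) => i j; exact/key.
Qed.

Lemma Hilbert_module_exists : exists pn : T -> L0, Hilbert_module P pn.
Proof.
have /choice[pn pnP] : forall v, exists p : L0, [/\ {ae m, forall z, 0 <= p z},
    Lp 2%:E p & forall A, measurable A -> intg A (p ^+ 2) = `|P A v| ^+ 2].
  move=> v; apply: (density_exists (q := fun A => `|P A v| ^+ 2)).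
  - by rewrite P_set0 normr0 expr0n.
  - by move=> A _; exact: sqr_ge0.
  - by move=> G mG tG; exact: (ep_sigma ep).
  - by move=> A mA mA0; rewrite (ep_null ep)// normr0 expr0n.
exists pn; split.
- exact: (ep_parallelogram ep).
- exact: (ep_linear ep).
- exact: (ep_setI ep).
- exact: (ep_setT ep).
- by move=> v; case: (pnP v).
- by move=> v; case: (pnP v).
- by move=> A v mA; have [_ _ ->] := pnP v.
Qed.

Lemma simple_classE B c n : simple_partition B n ->
  {ae m, forall p, simple_class m B c n p = \sum_(j < n) \1_(B j) p * c j}.
Proof.
move=> [[mB _ _] _]; apply: L0_classE; apply: measurable_sum => j.
by apply: measurable_funM => //; exact: measurable_indic.
Qed.

Lemma Loo_simple_class B c n : simple_partition B n -> Loo (simple_class m B c n).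
Proof.
move=> pB; apply/LooP; exists (\sum_(j < n) `|c j|).
apply: filterS (simple_classE c pB) => p ->.
apply: (le_trans (ler_norm_sum _ _ _)); apply: ler_sum => j _.
rewrite normrM ler_piMl// indicE; case: (_ \in _); by rewrite ?normr1 ?normr0.
Qed.

Lemma ind_simple_class B c n A j : simple_partition B n -> measurable A -> (j < n)%N ->
  ind m (A `&` B j) * simple_class m B c n = c j *: ind m (A `&` B j).
Proof.
move=> pB mA jn; have [[mB tB _] _] := pB; have mI := measurableI _ _ mA (mB j).
apply/L0_eqP.
apply: filterS4 (L0_mulE (ind m (A `&` B j)) (simple_class m B c n)) (indE m mI)
  (simple_classE c pB) (L0_scaleE (c j) (ind m (A `&` B j))).
move=> p -> e1 -> ->; rewrite e1 indicE.
have [|_] := boolP (p \in A `&` B j); last by rewrite mul0r mulr0.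
rewrite inE => -[_ Bp]; rewrite mul1r mulr1 (bigD1 (Ordinal jn))//= big1.
  by rewrite indicE mem_set// mul1r addr0.
move=> k kj; rewrite indicE memNset ?mul0r// => Bk; move/eqP: kj; apply.
by apply/val_inj => /=; apply: (tB _ _ I I); exists p.
Qed.

Lemma cotangent_module_of_projections :
  exists iota act pn, @cotangent_module R M m F E mu T iota act pn.
Proof.
have [pn hm] := Hilbert_module_exists.
have [act actE] := action_exists hm.
have /choice[iota iotaP] : forall x, exists v, Pcm x -> represents x v.
  move=> x; have [Px|nPx] := pselect (Pcm x); last by exists 0.
  by have [v xv] := represents_exists Px; exists v.
have iotaE x v : Pcm x -> represents x v -> iota x = v.
  by move=> Px xv; apply: (represents_unique Px) => //; exact: iotaP.
have iD x y : Pcm x -> Pcm y -> iota (pcm_add x y) = iota x + iota y.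
  move=> Px Py; apply: iotaE; first exact: (Pcm_add E_form mu_energy).
  by apply: represents_add => //; exact: iotaP.
have iZ a x : Pcm x -> iota (pcm_scale a x) = a *: iota x.
  move=> Px; apply: iotaE; first exact: (Pcm_scale E_form mu_energy).
  by apply: represents_scale => //; exact: iotaP.
have iR A x : Pcm x -> measurable A -> iota (restr A x) = P A (iota x).
  move=> Px mA; apply: iotaE; first exact: (Pcm_restr E_form mu_energy).
  by apply: represents_restr => //; exact: iotaP.
have iS f : Fe f -> iota (pcm_single f) = e setT f.
  by move=> Ff; apply: iotaE; [exact: (Pcm_single E_form mu_energy)|exact: represents_single].
exists iota, act, pn; split.
- by move=> x y Px Py; apply: pcm_equiv_represents => //; exact: iotaP.
- exact: iD.
- exact: iZ.
- by move=> x Px; apply: represents_norm => //; exact: iotaP.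
- apply/approximable_dense/(ep_span ep).
  + exists (pcm_single (0 : L0)); first exact: (Pcm_single E_form mu_energy (Fe0 E_form)).
    by rewrite iS ?e0//; exact: Fe0 E_form.
  + move=> a _ _ [x Px <-] [y Py <-].
    have Pa := Pcm_scale E_form mu_energy a Px.
    exists (pcm_add (pcm_scale a x) y); first exact: (Pcm_add E_form mu_energy).
    by rewrite iD// iZ.
  (* The form [1_A df] is itself the class of an element of [Pcm], namely the single piece [f]
     restricted to [A]. *)
  + move=> A f mA Ff; have Ps := Pcm_single E_form mu_energy Ff.
    exists (restr A (pcm_single f)); first exact: (Pcm_restr E_form mu_energy).
    by rewrite iR// iS// (ep_form_setI ep)// setIT.
- exact: (act_linear_l hm actE).
- exact: (act_linear_r hm actE).
- by move=> f v; exact: (act_norm hm actE).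
- move=> B c n x pB Px; have soo := Loo_simple_class c pB.
  have [[mB _ _] B0] := pB.
  apply/esym/iotaE; first exact: (Pcm_mul E_form mu_energy _ Px pB).
  apply: (represents_mul Px pB (iotaP _ Px)) => A j mA.
  have [jn|nj] := ltnP j n; last by rewrite B0// setI0 !P_set0 scaler0.
  have mI := measurableI _ _ mA (mB j); have Ioo := Loo_ind m mI.
  (* On [B j] the simple function equals [c j], so multiplying it by the indicator of a subset of
     [B j] gives [c j] times this indicator. *)
  rewrite -!(act_ind hm actE)// -(act_mul hm actE)// ind_simple_class//.
  have act0 v : act 0 v = 0.
    have := act_linear_l hm actE 1 v (Loo0 m) (Loo0 m).
    by rewrite !scale1r addr0 -[LHS]addr0 => /addrI.
  have := act_linear_l hm actE (c j) (iota x) Ioo (Loo0 m).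
  by rewrite act0 !addr0.
- exact: (hm_pn_L2 hm).
- move=> v r r0; apply/nbhs_ballP; exists r => //= w.
  rewrite -ball_normE /= => vw; apply: le_lt_trans vw.
  by rewrite distrC; exact: (hm_pn_continuous hm).
- move=> x Px; have L2 := pcm_pn_L2 mu_energy E_carre Px.
  (* Both pointwise norms are nonnegative, so their squares are compared; over each [A] the two
     integrals are the squared norm of the class of [restr A x]. *)
  have /L0_eqP p2 : pn (iota x) ^+ 2 = pcm_pn x ^+ 2.
    apply: intg_inj => [||A mA]; [exact: (summable_pn2 hm)|exact/Lp2P|].
    have PR := Pcm_restr E_form mu_energy mA Px.
    rewrite (hm_intg hm)// -iR// (represents_norm PR (iotaP _ PR)).
    rewrite (pcm_norm2_restr E_form mu_energy)//.
    by rewrite -(intg_pcm_pn mu_energy E_carre).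
  apply/L0_eqP.
  apply: filterS4 p2 (filterI (sqrE (pn (iota x))) (sqrE (pcm_pn x)))
    (hm_pn_ge0 hm (iota x)) (pcm_pn_ge0 Px) => p p2 [s1 s2] h1 h2.
  by apply/eqP; rewrite -(@eqrXn2 _ 2)// -s1 -s2 p2.
Qed.

End construction.

Theorem theorem0p1 (R : realType) (M : ptopologicalType)
    (m : {sigma_finite_measure set (g_sigma_algebraType (@open M)) -> \bar R})
    (F : set (L0 m)) (E : L0 m -> L0 m -> R)
    (mu : L0 m -> L0 m -> {charge set (g_sigma_algebraType (@open M)) -> \bar R})
    (M_Lusin : Lusin R M) (m_support : full_support m)
    (E_form : Dirichlet_form F E) (E_quasi_regular : quasi_regular F E)
    (E_strongly_local : strongly_local F E)
    (mu_energy : energy_measure F E mu) (E_carre : carre_du_champ F mu) :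
  (exists (T : completeNormedModType R) (iota : piece m -> T)
     (act : L0 m -> T -> T) (pn : T -> L0 m),
     cotangent_module F E mu iota act pn) /\
  forall (T : completeNormedModType R) (iota : piece m -> T)
    (act : L0 m -> T -> T) (pn : T -> L0 m),
    cotangent_module F E mu iota act pn ->
    [/\ Lp_normed_module 2%:E (fun v : T => `|v|) act pn,
        Lp_normed_module 2%:E (@dual_norm _ _ _ _ T act)
          (@dual_act _ _ _ _ T act) (@dual_pn _ _ _ _ T act pn),
        linear_on (Fe F E) (differential iota),
        (exists sharp : T -> dual act, is_Riesz_isomorphism pn sharp) &
        forall sharp : T -> dual act, is_Riesz_isomorphism pn sharp ->
          linear_on (Fe F E) (gradient iota sharp) /\
          forall f, Fe F E f ->
            {ae m, forall x, pn (differential iota f) x = Num.sqrt (Gamma mu f f x)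
              /\ dual_pn pn (gradient iota sharp f) x = Num.sqrt (Gamma mu f f x)}].
Proof.
split.
  have [T [P [e ep]]] := energy_projections_exist E_form mu_energy E_carre.
  exists T; exact: (cotangent_module_of_projections E_form mu_energy E_carre ep).
move=> T iota act pn cm.
have hm := cotangent_Hilbert_module E_form mu_energy E_carre cm.
have actE := cotangent_action E_form mu_energy E_carre cm.
have dlin := differential_linear E_form mu_energy cm.
split.
- exact: (Hilbert_module_normed hm actE).
- exact: (dual_normed_module hm actE).
- exact: dlin.
- by exists (flat hm actE); exact: flat_Riesz.
- move=> sharp /(Riesz_isomorphism_unique hm actE) ->; split.
    move=> a f g Ff Fg; have [Fl dl] := dlin a f g Ff Fg; split => //.
    by rewrite /gradient dl flat_linear.
  move=> f Ff; rewrite /gradient dual_pn_flat.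
  by apply: filterS (pn_differential E_form mu_energy cm Ff).
Qed.
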